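(* Let $X=\mathbb{CP}^1$ and let $(\boldsymbol{\mathfrak g},\boldsymbol K)$ be the contraction family of Harish-Chandra pairs over $X$ for $SL(2)$ defined in the context. Fix one of the classes $I_k$ or $II_k$ (for a fixed integer $k$), $III$, or $IV$ of $(\boldsymbol{\mathfrak g},\boldsymbol K)$-modules described in the context. The classification of the generically irreducible quasi-admissible $(\boldsymbol{\mathfrak g},\boldsymbol K)$-modules in that class, up to isomorphism and the action of the Picard group of $X$ by tensor product, is as follows. (i) The set of weights of any generically irreducible quasi-admissible module is one of: $2\mathbb Z$; $2\mathbb Z+1$; $\ell+2\mathbb N$ for an integer $\ell\ge 1$; $\ell-2\mathbb N$ for an integer $\ell\le -1$; $\{d,d-2,\dots,-d\}$ for an integer $d\ge 0$. (ii) For each set of weights in (i) having an extreme (highest or lowest) weight (and containing $k$, if the class is $I_k$ or $II_k$), the Casimir section $C$ acts by a constant determined by the extreme weight, namely $\ell^2-2|\ell|$ if the weights are $\ell+2\mathbb N$ ($\ell\ge1$) or $\ell-2\mathbb N$ ($\ell\le-1$), and $d^2+2d$ if the weights are $\{d,d-2,\dots,-d\}$; and there is a unique module in the given class with the given weights (up to isomorphism and the action of the Picard group). (iii) When there is no extreme weight, the set of weights is either $2\mathbb Z$ or $2\mathbb Z+1$ (required to contain $k$, if the class is $I_k$ or $II_k$). The Casimir section cannot act by a constant $m(m+2)$ where $m\in\mathbb Z$ has the same parity as the weights. For every other rational function of the form $c_1z+c_0+c_{-1}z^{-1}$ with $c_1,c_0,c_{-1}\in\mathbb C$, there is a unique module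 in the given class (up to isomorphism and the action of the Picard group) with the given weights on which the Casimir section acts by multiplication by that function.
   Context: All objects are complex algebraic. $\mathbb N=\{0,1,2,\dots\}$. $X=\mathbb{CP}^1$ has homogeneous coordinates $[\alpha:\beta]$, and $z=\alpha/\beta$. The family: $\boldsymbol{\mathfrak g}$ is the sheaf of sections of the rank-three subbundle of the trivial bundle over $X$ with fiber $\mathfrak{sl}(2,\mathbb C)\times\mathfrak{sl}(2,\mathbb C)$ whose fiber over $[\alpha:\beta]$ is the Lie subalgebra $$\left\{\left(\begin{bmatrix}a&\alpha b\\ \beta c&-a\end{bmatrix},\begin{bmatrix}a&\beta b\\ \alpha c&-a\end{bmatrix}\right): a,b,c\in\mathbb C\right\}.$$ It is a sheaf of Lie algebras over $O_X$ (pointwise bracket). $\boldsymbol K=K\times X$ is the constant family of groups with fiber $K=\{k_a=(h_a,h_a): a\in\mathbb C^\times\}$, $h_a=\operatorname{diag}(a,a^{-1})$. It acts on $\boldsymbol{\mathfrak g}$ by the adjoint action, and $\operatorname{Lie}(\boldsymbol K)=O_X\otimes\operatorname{Lie}(K)$ is included in $\boldsymbol{\mathfrak g}$ in the obvious way. A $(\boldsymbol{\mathfrak g},\boldsymbol K)$-module (algebraic family of Harish-Chandra modules) is a flat quasicoherent $O_X$-module $\mathcal F$ with an algebraic $O_X$-linear action of $\boldsymbol K$ and an $O_X$-linear Lie algebra action $\boldsymbol{\mathfrak g}\otimes_{O_X}\mathcal F\to\mathcal F$ that is $\boldsymbol K$-equivariant and such that the differential of the $\boldsymbol K$-action equals the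 restriction of the $\boldsymbol{\mathfrak g}$-action to $\operatorname{Lie}(\boldsymbol K)$. It has a weight decomposition $\mathcal F=\bigoplus_{n\in\mathbb Z}\mathcal F_n$, where $k_a$ acts on $\mathcal F_n$ by $a^n$; the weights of $\mathcal F$ are the $n$ with $\mathcal F_n\neq0$. $\mathcal F$ is quasi-admissible if every $\mathcal F_n$ is coherent (hence locally free of finite rank). $\mathcal F$ is generically irreducible if $\Bbbk\otimes_{O_X}\mathcal F$ is an irreducible module over the Lie algebra $\Bbbk\otimes_{O_X}\boldsymbol{\mathfrak g}$, where $\Bbbk$ is the algebraic closure of the field of rational functions on $X$. For the present family this is equivalent, for quasi-admissible $\mathcal F$, to all but at most countably many fibers of $\mathcal F$ being irreducible. For a generically irreducible quasi-admissible $\mathcal F$ each nonzero $\mathcal F_n$ is an invertible sheaf, with degree $\deg(\mathcal F_n)\in\mathbb Z$. Casimir section: define rational sections of $\boldsymbol{\mathfrak g}$ (the letter $X$ below denotes a section, not the base) $$X=\left(\begin{bmatrix}0&z\\ 0&0\end{bmatrix},\begin{bmatrix}0&1\\ 0&0\end{bmatrix}\right),\quad Y=\left(\begin{bmatrix}0&0\\ z^{-1}&0\end{bmatrix},\begin{bmatrix}0&0\\ 1&0\end{bmatrix}\right),\quad H=\left(\begin{bmatrix}1&0\\ 0&-1\end{bmatrix},\begin{bmatrix}1&0\\ 0&-1\end{bmatrix}\right).$$ The Casimir section is the rational section $C=H^2+2XY+2YX=H^2+2H+4YX$ of the center of the sheaf of enveloping algebras $\mathcal U(\boldsymbol{\mathfrak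 g})$. On a generically irreducible quasi-admissible module it acts by multiplication by a rational function of $z$. The classes (all degree conditions are imposed whenever both weight spaces involved are nonzero): $I_k$: modules with $\mathcal F_k\ne0$, $\deg(\mathcal F_{n+2})=\deg(\mathcal F_n)-1$ whenever $n\ge k$, and $\deg(\mathcal F_{n-2})=\deg(\mathcal F_n)-1$ whenever $n\le k$. $II_k$: modules with $\mathcal F_k\neq0$, $\deg(\mathcal F_{n+2})=\deg(\mathcal F_n)+1$ whenever $n\ge k$, and $\deg(\mathcal F_{n-2})=\deg(\mathcal F_n)+1$ whenever $n\le k$. $III$: modules with $\deg(\mathcal F_{n+2})=\deg(\mathcal F_n)+1$ for all $n$. $IV$: modules with $\deg(\mathcal F_{n+2})=\deg(\mathcal F_n)-1$ for all $n$. The Picard group of $X$ (isomorphism classes of invertible sheaves) acts on $(\boldsymbol{\mathfrak g},\boldsymbol K)$-modules by tensor product over $O_X$. *)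

(* Defs.v *)
From HB Require Import structures.
From mathcomp Require Import all_boot all_order all_algebra.
From mathcomp Require Import boolp classical_sets cardinality reals.

Set Implicit Arguments.
Unset Strict Implicit.
Unset Printing Implicit Defensive.

Import Order.TTheory GRing.Theory Num.Theory.
Local Open Scope classical_set_scope.
Local Open Scope ring_scope.

(* C stands for the field of complex numbers, i.e. R[i] for R : realType. *)

(* Some a is the point [a : 1] and None is the point [1 : 0]. *)
Definition P1 (C : numClosedFieldType) : Type := option C.

Definition hcoord (C : numClosedFieldType) (x : P1 C) : C * C :=
  if x is Some a then (a, 1) else (1, 0).

Definition ratfun (C : numClosedFieldType) : fieldType := {fraction {poly C}}.

(* z = alpha / beta *)
Definition zfun (C : numClosedFieldType) : ratfun C := tofrac 'X.

Definition constfun (C : numClosedFieldType) (c : C) : ratfun C := tofrac c%:P.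

(* The value at the chosen coordinates of x of the form
   \sum_i p_i alpha^i beta^(d - i), which has degree d when size p <= d.+1. *)
Definition heval (C : numClosedFieldType) (d : nat) (p : {poly C}) (x : P1 C) : C :=
  \sum_(i < d.+1) p`_i * (hcoord x).1 ^+ i * (hcoord x).2 ^+ (d - i).

(* f is regular at x with value v: it is a quotient of two forms of the same
   degree, the denominator being nonzero at x. *)
Definition has_value (C : numClosedFieldType) (f : ratfun C) (x : P1 C) (v : C) : Prop :=
  exists (d : nat) (p q : {poly C}),
    [/\ (size p <= d.+1)%N, (size q <= d.+1)%N, heval d q x != 0,
        f = tofrac p / tofrac q & v = heval d p x / heval d q x].

(* Nonempty Zariski open sets of P1 are the cofinite ones. The empty open set,
   on which every sheaf of modules vanishes, is left out throughout. *)
Record zopen (C : numClosedFieldType) := ZOpen {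
  zset :> set (P1 C);
  zset_cofinite : finite_set (~` zset) }.

(* The affine open sets of P1 are the proper ones. *)
Definition affine (C : numClosedFieldType) (U : zopen C) : Prop := exists x, ~ zset U x.

Lemma cofinite0 (C : numClosedFieldType) : finite_set (~` (~` [set (None : P1 C)])).
Proof. by rewrite setCK; exact: finite_set1. Qed.

Lemma cofinite_inf (C : numClosedFieldType) :
  finite_set (~` (~` [set (Some 0 : P1 C)])).
Proof. by rewrite setCK; exact: finite_set1. Qed.

Lemma cofinite01 (C : numClosedFieldType) :
  finite_set (~` (~` [set (None : P1 C); Some 0])).
Proof. by rewrite setCK; exact: finite_set2. Qed.

Definition U0 (C : numClosedFieldType) : zopen C := ZOpen (cofinite0 C).
Definition Uinf (C : numClosedFieldType) : zopen C := ZOpen (cofinite_inf C).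
Definition U01 (C : numClosedFieldType) : zopen C := ZOpen (cofinite01 C).

Lemma U01_sub0 (C : numClosedFieldType) : U01 C `<=` U0 C.
Proof. by move=> x /= h e; apply: h; left. Qed.

Lemma U01_subinf (C : numClosedFieldType) : U01 C `<=` Uinf C.
Proof. by move=> x /= h e; apply: h; right. Qed.

Definition regular_on (C : numClosedFieldType) (U : zopen C) : {pred ratfun C} :=
  fun f => `[< forall x, zset U x -> exists v, has_value f x v >].

Lemma heval_fin (C : numClosedFieldType) d (p : {poly C}) (a : C) :
  (size p <= d.+1)%N -> heval d p (Some a) = p.[a].
Proof.
move=> sp; rewrite (horner_coef_wide _ sp) /heval /=.
by apply: eq_bigr => i _; rewrite expr1n mulr1.
Qed.

Lemma heval_inf (C : numClosedFieldType) d (p : {poly C}) :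
  heval d p None = p`_d.
Proof.
rewrite /heval /= big_ord_recr /= subnn expr0 expr1n !mulr1 big1 ?add0r // => i _.
by rewrite expr0n subn_eq0 leqNgt ltn_ord /= mulr0.
Qed.

Lemma size_mul_homog (C : numClosedFieldType) d e (p q : {poly C}) :
  (size p <= d.+1)%N -> (size q <= e.+1)%N -> (size (p * q)%R <= (d + e).+1)%N.
Proof.
move=> sp sq; apply: leq_trans (size_polyMleq _ _) _.
have := leq_add sp sq; rewrite addSn addnS.
by case: (size p + size q)%N.
Qed.

Lemma hevalM (C : numClosedFieldType) d e (p q : {poly C}) x :
  (size p <= d.+1)%N -> (size q <= e.+1)%N ->
  heval (d + e) (p * q) x = heval d p x * heval e q x.
Proof.
move=> sp sq; case: x => [a|].
  by rewrite !heval_fin ?hornerM // size_mul_homog.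
rewrite !heval_inf coefM (bigD1 (Ordinal (leq_addr e d : (d < (d + e).+1)%N))) //=.
rewrite addKn big1 ?addr0 // => i; rewrite -val_eqE /= neq_ltn => /orP[] lt_id.
  by rewrite [q`__]nth_default ?mulr0 // (leq_trans sq) // ltn_subRL ltn_add2r.
by rewrite [p`__]nth_default ?mul0r // (leq_trans sp).
Qed.

Lemma hevalB (C : numClosedFieldType) d (p q : {poly C}) x :
  heval d (p - q) x = heval d p x - heval d q x.
Proof.
rewrite /heval -sumrB; apply: eq_bigr => i _.
by rewrite coefB !mulrBl.
Qed.

Lemma heval_neq0 (C : numClosedFieldType) d (q : {poly C}) x :
  heval d q x != 0 -> tofrac q != 0 :> ratfun C.
Proof.
move=> h; rewrite tofrac_eq0; apply: contra_neq h => ->.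
by rewrite /heval big1 // => i _; rewrite coef0 !mul0r.
Qed.

Lemma has_value_const (C : numClosedFieldType) (c : C) x :
  has_value (constfun c) x c.
Proof.
have h (b : C) : heval 0 b%:P x = b.
  by rewrite /heval big_ord1 subnn !expr0 !mulr1 coefC.
exists 0%N, c%:P, 1%:P; split; rewrite ?size_polyC_leq1 // ?h ?oner_eq0 ?divr1 //.
Qed.

Lemma has_valueB (C : numClosedFieldType) (f g : ratfun C) x v w :
  has_value f x v -> has_value g x w -> has_value (f - g) x (v - w).
Proof.
move=> [d [p [q [sp sq q0 -> ->]]]] [e [r [s [sr ss s0 -> ->]]]].
exists (d + e)%N, (p * s - q * r), (q * s).
have [fq fs] := (heval_neq0 q0, heval_neq0 s0).
split; rewrite ?size_mul_homog //.
- by rewrite (leq_trans (size_polyD _ _)) // size_polyN geq_max !size_mul_homog.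
- by rewrite hevalM // mulf_neq0.
- rewrite tofracB !tofracM -mulNr addf_div // mulNr.
  by congr (_ / _); rewrite [in LHS](mulrC (tofrac r)).
- rewrite hevalB !hevalM // -mulNr addf_div // mulNr.
  by congr (_ / _); rewrite [in LHS](mulrC (heval e r x)).
Qed.

Lemma has_valueM (C : numClosedFieldType) (f g : ratfun C) x v w :
  has_value f x v -> has_value g x w -> has_value (f * g) x (v * w).
Proof.
move=> [d [p [q [sp sq q0 -> ->]]]] [e [r [s [sr ss s0 -> ->]]]].
exists (d + e)%N, (p * r), (q * s).
split; rewrite ?size_mul_homog //.
- by rewrite hevalM // mulf_neq0.
- by rewrite !tofracM mulf_div.
- by rewrite !hevalM // mulf_div.
Qed.

Lemma regular_const (C : numClosedFieldType) (U : zopen C) (c : C) :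
  constfun c \in regular_on U.
Proof. by apply/asboolP => x _; exists c; exact: has_value_const. Qed.

Lemma regular_on_subring (C : numClosedFieldType) (U : zopen C) :
  subring_closed (regular_on U).
Proof.
split=> [|f g /asboolP hf /asboolP hg|f g /asboolP hf /asboolP hg].
- by have := regular_const U 1; rewrite /constfun tofrac1.
- apply/asboolP => x Ux; have [v fv] := hf _ Ux; have [w gw] := hg _ Ux.
  by exists (v - w); exact: has_valueB.
- apply/asboolP => x Ux; have [v fv] := hf _ Ux; have [w gw] := hg _ Ux.
  by exists (v * w); exact: has_valueM.
Qed.

HB.instance Definition _ (C : numClosedFieldType) (U : zopen C) :=
  GRing.isSubringClosed.Build (ratfun C) (regular_on U) (regular_on_subring U).

Record O (C : numClosedFieldType) (U : zopen C) := MkO {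
  Oval :> ratfun C;
  OvalP : Oval \in regular_on U }.

HB.instance Definition _ (C : numClosedFieldType) (U : zopen C) :=
  [isSub for @Oval C U].
HB.instance Definition _ (C : numClosedFieldType) (U : zopen C) :=
  [Choice of O U by <:].
HB.instance Definition _ (C : numClosedFieldType) (U : zopen C) :=
  [SubChoice_isSubComNzRing of O U by <:].

Definition Oconst (C : numClosedFieldType) (U : zopen C) (c : C) : O U :=
  MkO (regular_const U c).

Definition bilinear_map (A : comNzRingType) (M N T : lmodType A)
    (b : M -> N -> T) : Prop :=
  (forall m, linear (b m)) /\ (forall n, linear (b^~ n)).

Definition is_tensor (A : comNzRingType) (M N T : lmodType A)
    (b : M -> N -> T) : Prop :=
  bilinear_map b /\
  forall (P : lmodType A) (c : M -> N -> P), bilinear_map c ->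
    exists! h : T -> P, linear h /\ forall m n, h (b m n) = c m n.

Definition flat (A : comNzRingType) (M : lmodType A) : Prop :=
  forall (N N' : lmodType A) (i : N -> N'), linear i -> injective i ->
  forall (T T' : lmodType A) (b : M -> N -> T) (b' : M -> N' -> T'),
    is_tensor b -> is_tensor b' ->
  forall h : T -> T', linear h -> (forall m n, h (b m n) = b' m (i n)) ->
    injective h.

Record sheaf (C : numClosedFieldType) := Sheaf {
  sec :> forall U : zopen C, lmodType (O U);
  res : forall U V : zopen C, V `<=` U -> sec U -> sec V;
  res_id : forall (U : zopen C) (h : U `<=` U) (m : sec U), res h m = m;
  res_comp : forall (U V W : zopen C) (hVU : V `<=` U) (hWV : W `<=` V)
    (hWU : W `<=` U) (m : sec U), res hWU m = res hWV (res hVU m);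
  res_add : forall (U V : zopen C) (h : V `<=` U) (m m' : sec U),
    res h (m + m') = res h m + res h m';
  (* f and f' are the same rational function, i.e. f' is the restriction of f *)
  res_scale : forall (U V : zopen C) (h : V `<=` U) (f : O U) (f' : O V) (m : sec U),
    Oval f' = Oval f -> res h (f *: m) = f' *: res h m;
  sheaf_sep : forall (U : zopen C) (I : Type) (V : I -> zopen C)
    (hV : forall i, V i `<=` U), (forall x, zset U x -> exists i, zset (V i) x) ->
    forall m m' : sec U, (forall i, res (hV i) m = res (hV i) m') -> m = m';
  sheaf_glue : forall (U : zopen C) (I : Type) (V : I -> zopen C)
    (hV : forall i, V i `<=` U), (forall x, zset U x -> exists i, zset (V i) x) ->
    forall s : forall i, sec (V i),
    (forall i j (W : zopen C) (hi : W `<=` V i) (hj : W `<=` V j),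
       res hi (s i) = res hj (s j)) ->
    exists m : sec U, forall i, res (hV i) m = s i }.

(* For U affine and f in O(U), the sections over D(f) are the localization of
   the sections over U at f. *)
Definition quasicoherent (C : numClosedFieldType) (F : sheaf C) : Prop :=
  forall (U V : zopen C) (h : V `<=` U) (f : O U), affine U ->
    (forall x, zset V x <-> zset U x /\ ~ has_value (Oval f) x 0) ->
    (forall m : F U, res h m = 0 -> exists k, f ^+ k *: m = 0) /\
    (forall (s : F V) (f' : O V), Oval f' = Oval f ->
       exists (k : nat) (m : F U), res h m = f' ^+ k *: s).

Definition flat_sheaf (C : numClosedFieldType) (F : sheaf C) : Prop :=
  forall U : zopen C, affine U -> flat (F U).

(* Subsheaves are given by a family of subsets of sections. *)

(* e is a nowhere vanishing section over U of the subsheaf P, i.e.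
   multiplication by e is an isomorphism from O_U to the restriction of P. *)
Definition trivializes (C : numClosedFieldType) (F : sheaf C)
    (P : forall U : zopen C, set (F U)) (U : zopen C) (e : F U) : Prop :=
  P U e /\
  forall (V : zopen C) (h : V `<=` U),
    (forall f : O V, P V (f *: res h e)) /\
    (forall m : F V, P V m -> exists! f : O V, m = f *: res h e).

Definition invertible (C : numClosedFieldType) (L : sheaf C) : Prop :=
  forall x : P1 C, exists (U : zopen C) (e : L U),
    zset U x /\ trivializes (fun V => [set: L V]) e.

(* P is isomorphic to O(d), the line bundle with transition function z^d
   between the standard trivializations beta^d over U0 and alpha^d over Uinf. *)
Definition has_degree (C : numClosedFieldType) (F : sheaf C)
    (P : forall U : zopen C, set (F U)) (d : int) : Prop :=
  exists (e0 : F (U0 C)) (e1 : F (Uinf C)) (f : O (U01 C)),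
    [/\ trivializes P e0, trivializes P e1, Oval f = zfun C ^ d &
        res (@U01_subinf C) e1 = f *: res (@U01_sub0 C) e0].

Definition degree (C : numClosedFieldType) (F : sheaf C)
    (P : forall U : zopen C, set (F U)) : int :=
  xget 0 [set d | has_degree P d].

(* The sheaf being a direct summand of a quasicoherent one, coherence amounts
   to finite generation over affine open sets. *)
Definition coherent (C : numClosedFieldType) (F : sheaf C)
    (P : forall U : zopen C, set (F U)) : Prop :=
  forall U : zopen C, affine U ->
    exists (k : nat) (s : 'I_k -> F U), (forall i, P U (s i)) /\
      forall m, P U m -> exists f : 'I_k -> O U, m = \sum_i f i *: s i.

Definition mx2 (A : comNzRingType) (a b c d : A) : 'M[A]_2 :=
  \matrix_(i < 2, j < 2)
    if i == 0 then (if j == 0 then a else b) else (if j == 0 then c else d).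

Notation mxpair A := ('M[A]_2 * 'M[A]_2)%type.

Definition mpmul (A : comNzRingType) (x y : mxpair A) : mxpair A :=
  (x.1 *m y.1, x.2 *m y.2).

Definition bracket (A : comNzRingType) (x y : mxpair A) : mxpair A :=
  mpmul x y - mpmul y x.

Definition mpmap (A B : comNzRingType) (f : A -> B) (x : mxpair A) : mxpair B :=
  (map_mx f x.1, map_mx f x.2).

Definition gfiber (A : comNzRingType) (alpha beta : A) : set (mxpair A) :=
  [set x : mxpair A | exists a b c : A,
     x = (mx2 a (alpha * b) (beta * c) (- a), mx2 a (beta * b) (alpha * c) (- a))].

(* Sections over U of the subbundle with fibers gfiber. *)
Definition gsec (C : numClosedFieldType) (U : zopen C) : set (mxpair (ratfun C)) :=
  [set xi : mxpair (ratfun C) | forall x, zset U x ->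
     exists2 eta, gfiber (hcoord x).1 (hcoord x).2 eta &
       forall i j, has_value (xi.1 i j) x (eta.1 i j) /\
                   has_value (xi.2 i j) x (eta.2 i j)].

Definition secH (C : numClosedFieldType) : mxpair (ratfun C) :=
  (mx2 1 0 0 (-1), mx2 1 0 0 (-1)).
Definition secX (C : numClosedFieldType) : mxpair (ratfun C) :=
  (mx2 0 (zfun C) 0 0, mx2 0 1 0 0).
Definition secY (C : numClosedFieldType) : mxpair (ratfun C) :=
  (mx2 0 0 (zfun C)^-1 0, mx2 0 0 1 0).

(* k_a = (h_a, h_a) *)
Definition kelt (C : numClosedFieldType) (a : C) : mxpair (ratfun C) :=
  (mx2 (constfun a) 0 0 (constfun a^-1), mx2 (constfun a) 0 0 (constfun a^-1)).

Definition Ad (C : numClosedFieldType) (a : C) (xi : mxpair (ratfun C)) :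
  mxpair (ratfun C) := mpmul (mpmul (kelt a) xi) (kelt a^-1).

(* kact U a is the action of k_a, relevant for a != 0 only, and gact U xi is
   the action of xi, relevant for xi in g(U) only. *)
Record hcmodule (C : numClosedFieldType) := HCModule {
  hcsheaf :> sheaf C;
  hc_qc : quasicoherent hcsheaf;
  hc_flat : flat_sheaf hcsheaf;

  kact : forall U : zopen C, C -> hcsheaf U -> hcsheaf U;
  kact_linear : forall (U : zopen C) (a : C), a != 0 -> linear (@kact U a);
  kact_res : forall (U V : zopen C) (h : V `<=` U) (a : C) (m : hcsheaf U),
    a != 0 -> res h (kact a m) = kact a (res h m);
  kact1 : forall (U : zopen C) (m : hcsheaf U), kact 1 m = m;
  kactM : forall (U : zopen C) (a b : C) (m : hcsheaf U), a != 0 -> b != 0 ->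
    kact (a * b) m = kact a (kact b m);
  (* the action is algebraic: a |-> k_a m is a Laurent polynomial in a *)
  kact_alg : forall (U : zopen C) (m : hcsheaf U),
    exists s : seq (int * hcsheaf U), forall a : C, a != 0 ->
      kact a m = \sum_(t <- s) Oconst U (a ^ t.1) *: t.2;

  gact : forall U : zopen C, mxpair (ratfun C) -> hcsheaf U -> hcsheaf U;
  gact_linearr : forall (U : zopen C) xi, gsec U xi -> linear (@gact U xi);
  gact_linearl : forall (U : zopen C) (f : O U) xi eta (m : hcsheaf U),
    gsec U xi -> gsec U eta ->
    gact (Oval f *: xi + eta) m = f *: gact xi m + gact eta m;
  gact_bracket : forall (U : zopen C) xi eta (m : hcsheaf U),
    gsec U xi -> gsec U eta ->
    gact (bracket xi eta) m = gact xi (gact eta m) - gact eta (gact xi m);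
  gact_res : forall (U V : zopen C) (h : V `<=` U) xi (m : hcsheaf U),
    gsec U xi -> res h (gact xi m) = gact xi (res h m);

  hc_equivariant : forall (U : zopen C) (a : C) xi (m : hcsheaf U),
    a != 0 -> gsec U xi -> kact a (gact xi m) = gact (Ad a xi) (kact a m);
  (* Lie(K) is spanned by H, the derivative of a |-> k_a at a = 1; the
     derivative of \sum_i a^i m_i at a = 1 is \sum_i i m_i *)
  hc_differential : forall (U : zopen C) (m : hcsheaf U)
    (s : seq (int * hcsheaf U)),
    (forall a : C, a != 0 ->
       kact a m = \sum_(t <- s) Oconst U (a ^ t.1) *: t.2) ->
    gact (secH C) m = \sum_(t <- s) t.2 *~ t.1 }.

Definition weight_space (C : numClosedFieldType) (F : hcmodule C) (n : int)
    (U : zopen C) : set (F U) :=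
  [set m | forall a : C, a != 0 -> kact a m = Oconst U (a ^ n) *: m].

Definition weights (C : numClosedFieldType) (F : hcmodule C) : set int :=
  [set n | exists (U : zopen C) (m : F U), weight_space n m /\ m <> 0].

Definition quasi_admissible (C : numClosedFieldType) (F : hcmodule C) : Prop :=
  forall n : int, coherent (@weight_space C F n).

Definition wdegree (C : numClosedFieldType) (F : hcmodule C) (n : int) : int :=
  degree (@weight_space C F n).

(* Compatible semilinear maps from the sections of F to a kk-vector space;
   equivalently, a C(z)-semilinear map on the stalk of F at the generic point. *)
Definition generic_map (C : numClosedFieldType) (kk : closedFieldType)
    (iota : {rmorphism ratfun C -> kk}) (F : sheaf C) (V : lmodType kk)
    (j : forall U : zopen C, F U -> V) : Prop :=
  (forall (U : zopen C) (f : O U) (m m' : F U),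
     j U (f *: m + m') = iota (Oval f) *: j U m + j U m') /\
  (forall (U W : zopen C) (h : W `<=` U) (m : F U), j W (res h m) = j U m).

(* (V, j) is the tensor product of kk and F. *)
Definition is_generic_fiber (C : numClosedFieldType) (kk : closedFieldType)
    (iota : {rmorphism ratfun C -> kk}) (F : sheaf C) (V : lmodType kk)
    (j : forall U : zopen C, F U -> V) : Prop :=
  generic_map iota j /\
  forall (W : lmodType kk) (j' : forall U : zopen C, F U -> W),
    generic_map iota j' ->
    exists! h : V -> W, linear h /\ forall (U : zopen C) (m : F U), h (j U m) = j' U m.

Definition lie_rep (kk : fieldType) (g : set (mxpair kk)) (V : lmodType kk)
    (rho : mxpair kk -> V -> V) : Prop :=
  [/\ forall xi, g xi -> linear (rho xi),
      forall (c : kk) xi eta v, g xi -> g eta ->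
        rho (c *: xi + eta) v = c *: rho xi v + rho eta v &
      forall xi eta v, g xi -> g eta ->
        rho (bracket xi eta) v = rho xi (rho eta v) - rho eta (rho xi v)].

Definition subspace (kk : fieldType) (V : lmodType kk) (P : set V) : Prop :=
  P 0 /\ forall (c : kk) v w, P v -> P w -> P (c *: v + w).

Definition irreducible_rep (kk : fieldType) (g : set (mxpair kk))
    (V : lmodType kk) (rho : mxpair kk -> V -> V) : Prop :=
  (exists v : V, v <> 0) /\
  forall P : set V, subspace P -> (forall xi v, g xi -> P v -> P (rho xi v)) ->
    P = [set 0] \/ P = [set: V].

(* The Lie algebra obtained from the family by base change to kk is its fiber
   at the geometric generic point [z : 1]. *)
Definition generic_lie (C : numClosedFieldType) (kk : closedFieldType)
    (iota : {rmorphism ratfun C -> kk}) : set (mxpair kk) :=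
  gfiber (iota (zfun C)) 1.

Definition generically_irreducible (C : numClosedFieldType) (kk : closedFieldType)
    (iota : {rmorphism ratfun C -> kk}) (F : hcmodule C) : Prop :=
  exists (V : lmodType kk) (j : forall U : zopen C, F U -> V)
    (rho : mxpair kk -> V -> V),
    [/\ is_generic_fiber iota j,
        lie_rep (generic_lie iota) rho,
        forall (U : zopen C) xi (m : F U), gsec U xi ->
          rho (mpmap iota xi) (j U m) = j U (gact xi m) &
        irreducible_rep (generic_lie iota) rho].

Definition giqa (C : numClosedFieldType) (kk : closedFieldType)
    (iota : {rmorphism ratfun C -> kk}) (F : hcmodule C) : Prop :=
  generically_irreducible iota F /\ quasi_admissible F.

(* X, Y and H are regular over U01. *)
Definition casimir (C : numClosedFieldType) (F : hcmodule C) (U : zopen C)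
    (m : F U) : F U :=
  gact (secH C) (gact (secH C) m)
  + (gact (secX C) (gact (secY C) m)) *+ 2
  + (gact (secY C) (gact (secX C) m)) *+ 2.

Definition casimir_acts_by (C : numClosedFieldType) (F : hcmodule C)
    (q : ratfun C) : Prop :=
  forall (U : zopen C) (f : O U) (m : F U), U `<=` U01 C -> Oval f = q ->
    casimir m = f *: m.

(* b exhibits T as the tensor product of F and L over O_X, by its universal
   property among all sheaves of O_X-modules. *)
Definition bilinear_sheaf_map (C : numClosedFieldType) (F L T : sheaf C)
    (b : forall U : zopen C, F U -> L U -> T U) : Prop :=
  (forall U, bilinear_map (b U)) /\
  (forall (U V : zopen C) (h : V `<=` U) (m : F U) (l : L U),
     res h (b U m l) = b V (res h m) (res h l)).

Definition sheaf_map (C : numClosedFieldType) (F G : sheaf C)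
    (h : forall U : zopen C, F U -> G U) : Prop :=
  (forall U, linear (h U)) /\
  (forall (U V : zopen C) (i : V `<=` U) (m : F U), res i (h U m) = h V (res i m)).

Definition is_sheaf_tensor (C : numClosedFieldType) (F L T : sheaf C)
    (b : forall U : zopen C, F U -> L U -> T U) : Prop :=
  bilinear_sheaf_map b /\
  forall (G : sheaf C) (c : forall U : zopen C, F U -> L U -> G U),
    bilinear_sheaf_map c ->
    exists! h : forall U : zopen C, T U -> G U,
      sheaf_map h /\ forall U m l, h U (b U m l) = c U m l.

(* F' is isomorphic, as a (g,K)-module, to the tensor product of F and some
   invertible sheaf L, with g and K acting through F. *)
Definition picard_equiv (C : numClosedFieldType) (F F' : hcmodule C) : Prop :=
  exists (L : sheaf C) (b : forall U : zopen C, F U -> L U -> F' U),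
    [/\ invertible L, is_sheaf_tensor b,
        forall (U : zopen C) (a : C) m l, a != 0 ->
          b U (kact a m) l = kact a (b U m l) &
        forall (U : zopen C) xi m l, gsec U xi ->
          b U (gact xi m) l = gact xi (b U m l)].

Definition unique_up_to_picard (C : numClosedFieldType)
    (P : hcmodule C -> Prop) : Prop :=
  (exists F, P F) /\ (forall F F', P F -> P F' -> picard_equiv F F').

Inductive hcclass := ClassI of int | ClassII of int | ClassIII | ClassIV.

Definition step_up (C : numClosedFieldType) (F : hcmodule C) (n e : int) : Prop :=
  weights F n -> weights F (n + 2) -> wdegree F (n + 2) = wdegree F n + e.

Definition step_down (C : numClosedFieldType) (F : hcmodule C) (n e : int) : Prop :=
  weights F n -> weights F (n - 2) -> wdegree F (n - 2) = wdegree F n + e.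

Definition in_class (C : numClosedFieldType) (c : hcclass) (F : hcmodule C) : Prop :=
  match c with
  | ClassI k => [/\ weights F k, forall n, k <= n -> step_up F n (-1)
                   & forall n, n <= k -> step_down F n (-1)]
  | ClassII k => [/\ weights F k, forall n, k <= n -> step_up F n 1
                    & forall n, n <= k -> step_down F n 1]
  | ClassIII => forall n, step_up F n 1
  | ClassIV => forall n, step_up F n (-1)
  end.

(* The given weights contain k, if the class is I_k or II_k. *)
Definition class_allows (c : hcclass) (S : set int) : Prop :=
  match c with ClassI k | ClassII k => S k | _ => True end.

(* 2Z for b = false and 2Z + 1 for b = true *)
Definition parity_weights (b : bool) : set int := [set n | odd `|n|%N = b].

Definition weights_from (l : int) : set int :=
  [set n | exists i : nat, n = l + 2 * i%:Z].

Definition weights_upto (l : int) : set int :=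
  [set n | exists i : nat, n = l - 2 * i%:Z].

Definition weights_between (d : nat) : set int :=
  [set n | exists2 i : nat, (i <= d)%N & n = d%:Z - 2 * i%:Z].

(* The sets of weights with an extreme weight, each with the corresponding
   value of the Casimir section. *)
Inductive extreme_weights : set int -> int -> Prop :=
| ExtremeLow (l : int) of 1 <= l :
    extreme_weights (weights_from l) (l ^+ 2 - 2 * `|l|)
| ExtremeHigh (l : int) of l <= -1 :
    extreme_weights (weights_upto l) (l ^+ 2 - 2 * `|l|)
| ExtremeBoth (d : nat) :
    extreme_weights (weights_between d) (d%:Z ^+ 2 + 2 * d%:Z).

Definition casimir_fun (C : numClosedFieldType) (c1 c0 cm1 : C) : ratfun C :=
  constfun c1 * zfun C + constfun c0 + constfun cm1 * (zfun C)^-1.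

(* Main.v *)
Require Import Defs.
From HB Require Import structures.
From mathcomp Require Import all_boot all_order all_algebra.
From mathcomp Require Import boolp classical_sets functions cardinality reals complex.
From mathcomp Require Import ring zify.

(** The generic fiber of a generically irreducible quasi-admissible module has
weight spaces of dimension at most one, because [Y X] commutes with [H] and an
eigenvector of [Y X] in a weight space generates a submodule meeting that weight
space in a line. Trivialising the weight sheaves over the two affine lines
therefore presents the module as a sum of sheaves [O(d n)], on which [X] and [Y]
act by rational functions [a n] (from weight [n] to [n + 2]) and [b n] (from [n]
to [n - 2]). Regularity of the action forces [a n * b (n + 2)] to have at most
simple poles at [0] and infinity and none elsewhere, and the Casimir section is
[n (n + 2) + 4 a n b (n + 2)] for every weight [n]; its coincidences with the
integers [n (n + 2)] are exactly the places where the set of weights breaks off.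
If [d (n + 2) - d n] is [-1] (resp. [1]), then [a n] (resp. [z b (n + 2)]) is
regular at every point, hence constant, so that after rescaling the weight
vectors and twisting by a line bundle everything is determined by the weights
and the Casimir section. Conversely these formulas define modules. *)

Set Implicit Arguments.
Unset Strict Implicit.
Unset Printing Implicit Defensive.

Import Order.TTheory GRing.Theory Num.Theory.
Local Open Scope classical_set_scope.
Local Open Scope ring_scope.

(* Keeps conversion from computing in the field of fractions, where it
   practically never ends. *)
Opaque ratfun.

(** * Rational functions on the projective line *)

(** All classes are one problem: each prescribes through [step_sign] the jump, +1 or -1, of the
    degree between the weights [n] and [n + 2], and either jump leaves one of the two arrows between
    them without freedom, so that the other one carries the Casimir function. Once multiplicity one
    is known, irreducibility is used in combinatorial form: the weights are vertices, the nonzero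
    [a n] and [b n] are arrows, and no proper nonempty set of weights is closed under the arrows.
    Hence [a n * b (n + 2)] cannot vanish between two weights, which excludes the constants m(m+2)
    when the weights do not end, and it must vanish where they end. The obstacle is that modules are
    abstract sheaves, with tensor products, flatness and the generic fiber known only through
    universal properties. For a given module flatness is exploited as torsion-freeness, so that
    sections are determined on arbitrarily small open sets, and the two halves of the universal
    property of the generic fiber yield coordinate functionals and equality of linear maps. For the
    constructed modules the same properties are verified in explicit coordinates. *)

Section RationalFunctions.
Variable C : numClosedFieldType.
Local Notation K := (ratfun C).
Local Notation z := (zfun C).
Implicit Types (x : P1 C) (f g : K) (p q : {poly C}).

Definition reg x f := exists v, has_value f x v.
(** The units of the local ring at [x], whose elements are the functions satisfying [reg x]. *)
Definition uniat x f := exists2 v, v != 0 & has_value f x v.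

Lemma fracP f : exists p q, q != 0 /\ f = tofrac p / tofrac q.
Proof.
elim/(@quotW _ {fraction {poly C}}) : f => r; exists (frac r).1, (frac r).2.
have r2 := denom_ratioP r; split => //.
apply: (canRL (mulfK _)); first by rewrite tofrac_eq0.
rewrite !piE; apply/eqmodP => /=.
rewrite FracField.equivfE /FracField.mulf !numden_Ratio ?mulr1 ?oner_eq0 //.
by rewrite mulrC.
Qed.

Lemma zfun_neq0 : z != 0.
Proof. by rewrite tofrac_eq0 polyX_eq0. Qed.

Lemma constfunE (c : C) : constfun c = tofrac c%:P. Proof. by []. Qed.

Lemma constfun_is_zmod_morphism : zmod_morphism (@constfun C).
Proof. by move=> c d; rewrite /constfun polyCB tofracB. Qed.

Lemma constfun_is_monoid_morphism : monoid_morphism (@constfun C).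
Proof. by split=> [|c d]; rewrite /constfun ?polyCM ?tofracM // tofrac1. Qed.

HB.instance Definition _ :=
  GRing.isZmodMorphism.Build C (ratfun C) (@constfun C) constfun_is_zmod_morphism.
HB.instance Definition _ :=
  GRing.isMonoidMorphism.Build C (ratfun C) (@constfun C) constfun_is_monoid_morphism.

Lemma constfun_eq0 (c : C) : (constfun c == 0) = (c == 0).
Proof. exact: fmorph_eq0. Qed.

Lemma has_value0 x v : has_value 0 x v -> v = 0.
Proof.
move=> [d [p [q [sp sq q0 /esym/eqP f0 ->]]]].
move: f0; rewrite mulf_eq0 invr_eq0 (negPf (heval_neq0 q0)) orbF tofrac_eq0.
by move=> /eqP->; rewrite /heval big1 ?mul0r // => i _; rewrite coef0 !mul0r.
Qed.

Lemma has_value_uniq f x v w : has_value f x v -> has_value f x w -> v = w.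
Proof.
move=> h1 h2; have := has_valueB h1 h2; rewrite subrr => /has_value0/eqP.
by rewrite subr_eq0 => /eqP.
Qed.

Lemma has_valueV f x v : has_value f x v -> v != 0 -> has_value f^-1 x v^-1.
Proof.
move=> [d [p [q [sp sq q0 -> ->]]]] v0; exists d, q, p; split => //.
- by move: v0; rewrite mulf_eq0 negb_or => /andP[].
- by rewrite invf_div.
- by rewrite invf_div.
Qed.

Lemma regC x c : reg x (constfun c). Proof. by exists c; exact: has_value_const. Qed.
Lemma reg1 x : reg x 1. Proof. by rewrite -(rmorph1 (@constfun C)); exact: regC. Qed.
Lemma reg0 x : reg x 0. Proof. by rewrite -(rmorph0 (@constfun C)); exact: regC. Qed.
Lemma regB x f g : reg x f -> reg x g -> reg x (f - g).
Proof. by move=> [v hv] [w hw]; exists (v - w); exact: has_valueB. Qed.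
Lemma regN x f : reg x f -> reg x (- f).
Proof. by move=> h; rewrite -sub0r; exact: regB (reg0 x) h. Qed.
Lemma regD x f g : reg x f -> reg x g -> reg x (f + g).
Proof. by move=> h1 h2; rewrite -[g]opprK; apply: regB => //; exact: regN. Qed.
Lemma regM x f g : reg x f -> reg x g -> reg x (f * g).
Proof. by move=> [v hv] [w hw]; exists (v * w); exact: has_valueM. Qed.
Lemma regX x f n : reg x f -> reg x (f ^+ n).
Proof. by move=> h; elim: n => [|n IH]; rewrite ?expr0 ?exprS; [exact: reg1|exact: regM]. Qed.
Lemma reg_sum x (I : Type) (s : seq I) (F : I -> K) :
  (forall i, reg x (F i)) -> reg x (\sum_(i <- s) F i).
Proof. by move=> h; elim/big_ind : _ => //; [exact: reg0|exact: regD]. Qed.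

Lemma uniat_reg x f : uniat x f -> reg x f. Proof. by case=> v _ h; exists v. Qed.
Lemma uniatV x f : uniat x f -> uniat x f^-1.
Proof. by case=> v v0 h; exists v^-1; rewrite ?invr_eq0 //; exact: has_valueV. Qed.
Lemma uniatM x f g : uniat x f -> uniat x g -> uniat x (f * g).
Proof. by move=> [v v0 hv] [w w0 hw]; exists (v * w); rewrite ?mulf_neq0 //; exact: has_valueM. Qed.
Lemma uniatC x c : c != 0 -> uniat x (constfun c).
Proof. by move=> c0; exists c => //; exact: has_value_const. Qed.
Lemma uniat1 x : uniat x 1.
Proof. by rewrite -(rmorph1 (@constfun C)); apply: uniatC; rewrite oner_eq0. Qed.
Lemma uniatX x f (n : int) : uniat x f -> uniat x (f ^ n).
Proof.
move=> h; have hn m : uniat x (f ^+ m).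
  by elim: m => [|m IH]; rewrite ?expr0 ?exprS; [exact: uniat1|exact: uniatM].
by case: n => n; [rewrite -exprnP|rewrite NegzE -invr_expz -exprnP; apply: uniatV].
Qed.
Lemma uniat_neq0 x f : uniat x f -> f != 0.
Proof. by case=> v v0 hv; apply: contra_neq v0 => f0; move: hv; rewrite f0 => /has_value0. Qed.

Lemma uniat_inv x f : f != 0 -> reg x f -> reg x f^-1 -> uniat x f.
Proof.
move=> f0 [v hv] [w hw]; exists v => //; apply/eqP => v0.
have := has_valueM hv hw; rewrite divff // v0 mul0r => h.
have := @has_value_uniq 1 x _ _ (has_value_const 1 x) h.
by move/eqP; rewrite oner_eq0.
Qed.

Lemma reg_uniatM x f g : uniat x g -> reg x (f * g) -> reg x f.
Proof.
move=> ug h; have g0 := uniat_neq0 ug.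
by rewrite -(mulfK g0 f); apply: regM => //; apply/uniat_reg/uniatV.
Qed.

(* [lin x] is the linear form vanishing at x, divided by beta. *)
Definition linpoly x : {poly C} := if x is Some a then 'X - a%:P else 1.
Definition lin x : K := tofrac (linpoly x).

Lemma lin_neq0 x : lin x != 0.
Proof. by rewrite tofrac_eq0; case: x => [a|] /=; rewrite ?polyXsubC_eq0 ?oner_eq0. Qed.

Lemma size_linpoly x : (size (linpoly x) <= 2)%N.
Proof. by case: x => [a|] /=; rewrite ?size_XsubC ?size_poly1. Qed.

Lemma heval_linpoly x y : (heval 1 (linpoly x) y == 0) = (x == y).
Proof.
case: y => [b|]; rewrite ?heval_fin ?size_linpoly // ?heval_inf; case: x => [a|] /=.
- by rewrite hornerXsubC subr_eq0 eq_sym.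
- by rewrite hornerE oner_eq0.
- by rewrite coefB coefX coefC subr0 oner_eq0.
- by rewrite coef1 /= mulr0n !eqxx.
Qed.

Lemma has_value_lin a b x : x != b ->
  exists v, has_value (lin a / lin b) x v /\ (v == 0) = (x == a).
Proof.
move=> xb; exists (heval 1 (linpoly a) x / heval 1 (linpoly b) x); split.
  by exists 1%N, (linpoly a), (linpoly b); split; rewrite ?size_linpoly // heval_linpoly eq_sym.
by rewrite mulf_eq0 invr_eq0 !heval_linpoly !(eq_sym x) (eq_sym b) (negPf xb) orbF.
Qed.

Lemma uniat_lin a b x : x != a -> x != b -> uniat x (lin a / lin b).
Proof.
move=> xa xb; have [v [hv v0]] := has_value_lin a xb.
by exists v => //; rewrite v0.
Qed.

Lemma linNone : lin None = 1. Proof. by rewrite /lin /= tofrac1. Qed.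
Lemma lin0 : lin (Some 0) = z. Proof. by rewrite /lin /= subr0. Qed.

(** A uniformizer at [x]: the linear form vanishing at [x], divided by beta at a finite point and by
    alpha at infinity. *)
Definition par x : K := lin x / lin (if x is None then Some 0 else None).

Lemma par_neq0 x : par x != 0.
Proof. by rewrite mulf_neq0 ?invr_eq0 ?lin_neq0. Qed.

Lemma par0 x : has_value (par x) x 0.
Proof.
rewrite /par; set y := (if _ is None then _ else _).
have xy : x != y by rewrite /y; case: (x).
have [v [hv e]] := has_value_lin x xy.
have /eqP v0 : v == 0 by rewrite e eqxx.
by rewrite v0 in hv.
Qed.

Lemma parfin a : par (Some a) = tofrac ('X - a%:P).
Proof. by rewrite /par /= linNone divr1. Qed.
Lemma parinf : par None = z^-1.
Proof. by rewrite /par /= linNone lin0 div1r. Qed.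

Lemma has_value_fin p a : has_value (tofrac p) (Some a) p.[a].
Proof.
exists (size p), p, 1; split; rewrite ?size_poly1 ?heval_fin ?size_poly1 //.
- by rewrite hornerC oner_eq0.
- by rewrite tofrac1 divr1.
- by rewrite hornerC divr1.
Qed.

Lemma has_value_inf p n : (size p <= n.+1)%N -> has_value (tofrac p / z ^+ n) None p`_n.
Proof.
move=> sp; exists n, p, 'X^n; split; rewrite ?size_polyXn ?heval_inf //.
- by rewrite coefXn eqxx oner_eq0.
- by rewrite tofracXn.
- by rewrite coefXn eqxx divr1.
Qed.

(** At a finite point the exponent is minus the multiplicity of the root; at infinity it is the
    degree, and the value of the unit is the leading coefficient. *)
Lemma factor_poly x p : p != 0 -> exists k : int, uniat x (tofrac p * par x ^ k).
Proof.
move=> p0; case: x => [a|].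
  have [m [r /implyP/(_ p0) ra ->]] := multiplicity_XsubC p a.
  exists (- m%:Z); rewrite parfin tofracM tofracXn -exprnN mulfK.
    exists r.[a]; [exact: ra|exact: has_value_fin].
  by rewrite expf_neq0 // tofrac_eq0 polyXsubC_eq0.
exists (size p).-1%:Z; rewrite parinf -exprnP exprVn.
exists (lead_coef p); first by rewrite lead_coef_eq0.
by apply: has_value_inf; rewrite prednK // size_poly_gt0.
Qed.

(** The exponent is the order of [f] at [x]: the local ring is a discrete valuation ring. *)
Lemma factorP x f : f != 0 -> exists k : int, uniat x (f / par x ^ k).
Proof.
have [p [q [q0 ->]]] := fracP f.
rewrite mulf_eq0 invr_eq0 !tofrac_eq0 negb_or => /andP[p0 _].
have [k hk] := factor_poly x p0; have [l hl] := factor_poly x q0.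
exists (l - k); have := uniatM hk (uniatV hl).
congr (uniat x _); rewrite expfzDr ?par_neq0 // -!invr_expz !invfM invrK.
by ring.
Qed.

Lemma reg_par x (k : int) : 0 <= k -> reg x (par x ^ k).
Proof. by case: k => // k _; apply: regX; exists 0; exact: par0. Qed.

Lemma has_value_parS x (k : int) : 0 < k -> has_value (par x ^ k) x 0.
Proof.
case: k => // -[//|k] _; rewrite -exprnP exprS.
have [v hv] : reg x (par x ^+ k) by apply: (@reg_par x k).
by have := has_valueM (par0 x) hv; rewrite mul0r.
Qed.

Lemma uniat_par x (k : int) f : uniat x f -> uniat x (f * par x ^ k) -> k = 0.
Proof.
move=> uf ufk; have : uniat x (par x ^ k).
  by have := uniatM (uniatV uf) ufk; rewrite mulKf // (uniat_neq0 uf).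
move=> u; have neg (l : int) : 0 < l -> ~ uniat x (par x ^ l).
  by move=> l0 [v v0 hv]; move: v0; rewrite (has_value_uniq hv (has_value_parS x l0)) eqxx.
case: (ltrgtP k 0) => // k0; last by case: (neg k).
by case: (neg (- k)); rewrite ?oppr_gt0 // -invr_expz; exact: uniatV.
Qed.

Lemma zero_factor x f : has_value f x 0 -> exists2 f1, reg x f1 & f = par x * f1.
Proof.
move=> h; have [->|f0] := eqVneq f 0; first by exists 0; rewrite ?mulr0 //; exact: reg0.
exists (f / par x); last by rewrite mulrCA divff ?par_neq0 ?mulr1.
have [k u] := factorP x f0.
(* A nonpositive order would make the inverse of [f] regular, and 1 = f / f would vanish at [x]. *)
have k0 : 0 < k.
  case: (ltP 0 k) => // k0; have [w hw] := uniat_reg (uniatV u).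
  have [w' hw'] : reg x (par x ^ (- k)) by apply: reg_par; rewrite oppr_ge0.
  have := has_valueM (has_valueM h hw) hw'; rewrite !mul0r invfM mulVKf // -invr_expz.
  rewrite invrK divff ?expfz_neq0 ?par_neq0 // => h1.
  by have /eqP := @has_value_uniq 1 x _ _ (has_value_const 1 x) h1; rewrite oner_eq0.
have -> : f / par x = f / par x ^ k * par x ^ (k - 1).
  by rewrite expfzDr ?par_neq0 // mulrA divfK ?expfz_neq0 ?par_neq0.
by apply: regM; [exact: uniat_reg|apply: reg_par; lia].
Qed.

(** The power of [f] has order at least [l], which outweighs the pole of [g]. This gives the
    quasicoherence of the constructed sheaves. *)
Lemma kill_pole x f g : has_value f x 0 ->
  exists k : nat, forall l, (k <= l)%N -> reg x (f ^+ l * g).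
Proof.
move=> /zero_factor[f1 r1 ->].
have [->|g0] := eqVneq g 0; first by exists 0 => l _; rewrite mulr0; exact: reg0.
have [k u] := factorP x g0; exists `|k|%N => l kl.
have -> : (par x * f1) ^+ l * g = f1 ^+ l * (g / par x ^ k) * par x ^ (l%:Z + k).
  rewrite exprMn expfzDr ?par_neq0 // -[par x ^+ l]/(par x ^ l%:Z).
  have := expfz_neq0 k (par_neq0 x).
  move: (par x ^ k) (par x ^ l) (f1 ^+ l) => b a c b0.
  have -> : c * (g / b) * (a * b) = a * (c * (g / b * b)) by ring.
  by rewrite divfK // mulrA.
apply: regM; last by apply: reg_par; lia.
by apply: regM; [exact: regX|exact: uniat_reg].
Qed.

Lemma finite_roots p : p != 0 -> finite_set [set a | root p a].
Proof.
move=> p0; have [r pr] := closed_field_poly_normal p.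
apply: (@sub_finite_set _ _ [set` r]); last exact: finite_seq.
move=> a /=; rewrite pr rootZ ?lead_coef_eq0 //.
by rewrite root_prod_XsubC.
Qed.

Lemma finite_irreg f : finite_set [set x | ~ reg x f].
Proof.
have [p [q [q0 ->]]] := fracP f.
apply: (@sub_finite_set _ _ ([set None] `|` Some @` [set a | root q a])).
  move=> [a|] /= h; last by left.
  right; exists a => //; apply/negPn/negP => qa; apply: h.
  have u : uniat (Some a) (tofrac q) by exists q.[a] => //; exact: has_value_fin.
  apply: regM; first by exists p.[a]; exact: has_value_fin.
  exact/uniat_reg/uniatV.
by rewrite finite_setU; split; [exact: finite_set1|apply: finite_image; exact: finite_roots].
Qed.

Lemma finite_zero f : f != 0 -> finite_set [set x | has_value f x 0].
Proof.
move=> f0; apply: sub_finite_set (finite_irreg f^-1) => x /= h [w hw].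
have := has_valueM h hw; rewrite divff // mul0r => h1.
by have /eqP := @has_value_uniq 1 x _ _ (has_value_const 1 x) h1; rewrite oner_eq0.
Qed.

Lemma reg_poly p a : reg (Some a) (tofrac p).
Proof. by exists p.[a]; exact: has_value_fin. Qed.

(** Induction on the degree of the denominator: at a root of [q] the product f q = p vanishes as
    well, so a linear factor cancels. *)
Lemma poly_of_reg f : (forall a, reg (Some a) f) -> exists p, f = tofrac p.
Proof.
have [p [q [q0 ->]]] := fracP f.
have [n] := ubnP (size q); elim: n p q q0 => // n IH p q q0 sq h.
have [/eqP/size_poly1P[c c0 ->]|sq1] := eqVneq (size q) 1%N.
  by exists (c^-1 *: p); rewrite -mul_polyC tofracM mulrC -!constfunE -fmorphV.
have /closed_rootP[a qa] := sq1.
have pa : root p a.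
  have [v hv] := h a; have := has_valueM hv (has_value_fin q a).
  rewrite divfK ?tofrac_eq0 // (eqP qa) mulr0 => h0.
  by rewrite /root (has_value_uniq (has_value_fin p a) h0).
have /factor_theorem[p1 ep] := pa; have /factor_theorem[q1 eq] := qa.
have q10 : q1 != 0 by apply: contra_neq q0 => e; rewrite eq e mul0r.
have e1 : tofrac p / tofrac q = tofrac p1 / tofrac q1.
  rewrite ep eq !tofracM -mulf_div divff ?mulr1 // tofrac_eq0 polyXsubC_eq0 //.
rewrite e1; apply: IH => //; last by move=> b; rewrite -e1; exact: h.
by move: sq; rewrite eq size_Mmonic ?monicXsubC // size_XsubC addn2.
Qed.

(** If the degree of [p] exceeded [n], dividing by z to the degree would insert a positive power of
    the uniformizer at infinity, and the leading coefficient would be zero. *)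
Lemma size_of_reg p n : reg None (tofrac p / z ^+ n) -> (size p <= n.+1)%N.
Proof.
move=> h; rewrite leqNgt; apply/negP => lt_n.
have p0 : p != 0 by rewrite -size_poly_gt0; apply: leq_ltn_trans lt_n.
have hv := @has_value_inf p (size p).-1 (leqSpred _).
have [v hw] := h; have e : tofrac p / z ^+ (size p).-1 =
    (tofrac p / z ^+ n) * par None ^ ((size p).-1 - n)%N%:Z.
  rewrite parinf -exprnP exprVn -mulrA -invfM -exprD subnKC //.
  by rewrite -ltnS (leq_trans _ (leqSpred _)) // ltnW.
have := has_valueM hw (has_value_parS None (_ : 0 < ((size p).-1 - n)%N%:Z)).
rewrite -e mulr0 => /(_ _)/(has_value_uniq hv)h0.
have : lead_coef p = 0.
  apply: h0; rewrite ltz_nat subn_gt0 -ltnS prednK //.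
  by rewrite size_poly_gt0.
by move/eqP; rewrite lead_coef_eq0 (negPf p0).
Qed.

Lemma poly_bounded f n : (forall a, reg (Some a) f) -> reg None (f / z ^+ n) ->
  exists2 p : {poly C}, (size p <= n.+1)%N & f = tofrac p.
Proof. by move=> /poly_of_reg[p ->] /size_of_reg sp; exists p. Qed.

Lemma const_of_reg f : (forall x, reg x f) -> exists c, f = constfun c.
Proof.
move=> h; have h0 : reg None (f / z ^+ 0) by rewrite expr0 divr1; exact: h.
have [p sp ->] := poly_bounded (fun a => h (Some a)) h0.
by exists p`_0; rewrite constfunE -size1_polyC.
Qed.

Lemma const_of_uniat f : (forall a, uniat (Some a) f) ->
  exists2 c, c != 0 & f = constfun c.
Proof.
move=> h; have [p fp] : exists p, f = tofrac p.
  by apply: poly_of_reg => a; apply: uniat_reg.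
have p0 : p != 0 by have := uniat_neq0 (h 0); rewrite fp tofrac_eq0.
have [/eqP/size_poly1P[c c0 pc]|sp] := eqVneq (size p) 1%N.
  by exists c => //; rewrite fp pc.
have /closed_rootP[a /eqP pa] := sp.
have [v v0 hv] := h a; rewrite fp in hv.
by move: v0; rewrite (has_value_uniq hv (has_value_fin p a)) pa eqxx.
Qed.

Lemma uniat_z a : a != 0 -> uniat (Some a) z.
Proof. by move=> a0; exists a => //; have := has_value_fin 'X a; rewrite hornerX. Qed.

Lemma reg_z a : reg (Some a) z. Proof. exact: reg_poly. Qed.

Lemma reg_zV : reg None z^-1.
Proof. by rewrite -parinf; exists 0; exact: par0. Qed.

(** The units on the punctured line: removing the order at 0 leaves a polynomial without roots. *)
Lemma monomial_of_uniat f : (forall a, a != 0 -> uniat (Some a) f) ->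
  exists (c : C) (k : int), c != 0 /\ f = constfun c * z ^ k.
Proof.
move=> h; have f0 : f != 0 by apply: uniat_neq0 (h 1 (oner_neq0 _)).
have [k] := factorP (Some 0) f0; rewrite parfin subr0 => u.
have [a|c c0 e] := @const_of_uniat (f / z ^ k).
  have [->|a0] := eqVneq a 0; first exact: u.
  by apply: uniatM; [exact: h|apply/uniatV/uniatX/uniat_z].
by exists c, k; split; [exact: c0|rewrite -e divfK ?expfz_neq0 ?zfun_neq0].
Qed.

Lemma zpow_uniat_inf (k : int) f : uniat None f -> uniat None (f * z ^ k) -> k = 0.
Proof.
move=> h1 h2; suff : - k = 0 by lia.
apply: (uniat_par h1); rewrite parinf exprz_inv opprK.
exact: h2.
Qed.

Lemma infinite_P1 : infinite_set [set: P1 C].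
Proof.
move=> fin; apply: infinite_nat.
have := @finite_preimage nat (P1 C) [set: P1 C] (fun n => Some n%:R) _ fin.
rewrite preimage_setT; apply => m n _ _ [] /eqP.
by rewrite eqr_nat => /eqP.
Qed.

Lemma zopen_nonempty (U : zopen C) : exists x, zset U x.
Proof.
apply: contrapT => h; apply: infinite_P1.
apply: sub_finite_set (zset_cofinite U) => x _ Ux; apply: h.
by exists x.
Qed.

End RationalFunctions.

(** * Open sets and sheaves of modules *)

Section Opens.
Variable C : numClosedFieldType.
Local Notation K := (ratfun C).
Implicit Types (U V W : zopen C).

Lemma cofinite_cap U V : finite_set (~` (zset U `&` zset V)).
Proof. by rewrite setCI finite_setU; split; exact: zset_cofinite. Qed.
Definition capU U V : zopen C := ZOpen (cofinite_cap U V).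

Lemma capUl U V : capU U V `<=` U. Proof. by move=> x []. Qed.
Lemma capUr U V : capU U V `<=` V. Proof. by move=> x []. Qed.

Lemma U0P (x : P1 C) : zset (U0 C) x <-> exists a, x = Some a.
Proof. by case: x => [a|]; split => //; [exists a|move=> []|move=> [a]]. Qed.

Lemma UinfP (x : P1 C) : zset (Uinf C) x <-> x != Some 0.
Proof. by split => [h|/eqP]; [apply/eqP|]. Qed.

Lemma Uinf_None : zset (Uinf C) None. Proof. by []. Qed.

Lemma affine_sub U V : V `<=` U -> affine U -> affine V.
Proof. by move=> h [x nx]; exists x => /h. Qed.
Lemma affine_U0 : affine (U0 C). Proof. by exists None => /= h; exact: h. Qed.
Lemma affine_Uinf : affine (Uinf C). Proof. by exists (Some 0) => /= h; exact: h. Qed.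
Lemma affine_U01 : affine (U01 C). Proof. by exists None => /= h; apply: h; left. Qed.

Lemma U01P (x : P1 C) : zset (U01 C) x <-> exists2 a, a != 0 & x = Some a.
Proof.
split=> [h|[a a0 ->] [//|[/eqP]]]; last by rewrite (negPf a0).
case: x h => [a|] h; last by case: h; left.
by exists a => //; apply/eqP => a0; apply: h; right; rewrite a0.
Qed.

Lemma Oreg U (f : O U) x : zset U x -> reg x (Oval f).
Proof. by move=> Ux; have /asboolP := OvalP f; apply. Qed.

Definition mkO U (f : K) (H : forall x, zset U x -> reg x f) : O U :=
  MkO (introT (asboolP _) H : f \in regular_on U).

Lemma OvalE U (f g : O U) : Oval f = Oval g -> f = g.
Proof. exact: val_inj. Qed.

Lemma Oval0 U : Oval (0 : O U) = 0. Proof. by []. Qed.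
Lemma Oval1 U : Oval (1 : O U) = 1. Proof. by []. Qed.
Lemma OvalD U (f g : O U) : Oval (f + g) = Oval f + Oval g. Proof. by []. Qed.
Lemma OvalB U (f g : O U) : Oval (f - g) = Oval f - Oval g. Proof. by []. Qed.
Lemma OvalN U (f : O U) : Oval (- f) = - Oval f. Proof. by []. Qed.
Lemma OvalM U (f g : O U) : Oval (f * g) = Oval f * Oval g. Proof. by []. Qed.
Lemma OvalX U (f : O U) n : Oval (f ^+ n) = Oval f ^+ n.
Proof. by elim: n => [|n IH]; rewrite ?expr0 // !exprS OvalM IH. Qed.

Lemma O_eq0 U (f : O U) : (f == 0) = (Oval f == 0).
Proof. by rewrite -val_eqE. Qed.

Definition Ores U V (h : V `<=` U) (f : O U) : O V :=
  mkO (fun x Vx => Oreg f (h x Vx)).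

Lemma Oconst_is_zmod_morphism U : zmod_morphism (@Oconst C U).
Proof. by move=> c d; apply: OvalE; rewrite OvalB /= rmorphB. Qed.

Lemma Oconst_is_monoid_morphism U : monoid_morphism (@Oconst C U).
Proof. by split=> [|c d]; apply: OvalE; rewrite /= ?rmorph1 // rmorphM. Qed.

HB.instance Definition _ U :=
  GRing.isZmodMorphism.Build C (O U) (@Oconst C U) (@Oconst_is_zmod_morphism U).
HB.instance Definition _ U :=
  GRing.isMonoidMorphism.Build C (O U) (@Oconst C U) (@Oconst_is_monoid_morphism U).

Lemma regular_open k (f : 'I_k -> K) U :
  exists2 V : zopen C, V `<=` U & forall i x, zset V x -> reg x (f i).
Proof.
have fin : finite_set (~` (zset U `&` [set x | forall i, reg x (f i)])).
  rewrite setCI finite_setU; split; first exact: zset_cofinite.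
  apply: (@sub_finite_set _ _ (\bigcup_(i in [set: 'I_k]) [set x | ~ reg x (f i)])).
    by move=> x /= /existsNP[i hi]; exists i.
  by apply: bigcup_finite => [|i _]; [exact: finite_finset|exact: finite_irreg].
by exists (ZOpen fin) => [x []|i x [_]].
Qed.

Lemma regular_open1 (f : K) U :
  exists2 V : zopen C, V `<=` U & forall x, zset V x -> reg x f.
Proof.
by have [V VU h] := regular_open (fun _ : 'I_1 => f) U; exists V => //; exact: h ord0.
Qed.

(** Multiply the linear forms of the points outside [V], each divided by the linear form of a point
    [x0] outside [U], so that no pole lies in [U]. Quasicoherence thus applies to every inclusion of
    open sets in an affine one. *)
Lemma basic_open U V : affine U -> V `<=` U ->
  exists f : O U, [/\ Oval f != 0,
    forall x, zset V x <-> zset U x /\ ~ has_value (Oval f) x 0 &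
    forall x, zset V x -> uniat x (Oval f)].
Proof.
move=> [x0 nx0] VU; have /finite_seqP[s es] := zset_cofinite V.
have sP x : (~ zset V x) <-> x \in s.
  by rewrite -[~ _]/((~` zset V) x) es.
pose ss := [seq x <- s | x != x0].
pose g : K := \prod_(a <- ss) (lin a / lin x0).
have gx x : x != x0 -> exists v, has_value g x v /\ (v == 0) = (x \in ss).
  move=> xx0; rewrite /g; elim: (ss) => [|a t [v [hv v0]]].
    exists 1; rewrite big_nil in_nil oner_eq0; split => //.
    by rewrite -(rmorph1 (@constfun C)); exact: has_value_const.
  have [w [hw w0]] := has_value_lin a xx0.
  exists (w * v); rewrite big_cons in_cons mulf_eq0 w0 v0; split => //.
  exact: has_valueM.
have Ux0 x : zset U x -> x != x0 by move=> Ux; apply/eqP => e; apply: nx0; rewrite -e.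
have rg x : zset U x -> reg x g by move=> /Ux0/gx[v [hv _]]; exists v.
have Vu x : zset V x -> uniat x g.
  move=> Vx; have [v [hv v0]] := gx x (Ux0 _ (VU _ Vx)); exists v => //.
  by rewrite v0 mem_filter; apply/negP => /andP[_ /sP]; apply.
exists (mkO rg); split => //.
- have [x Vx] := zopen_nonempty V; exact: uniat_neq0 (Vu x Vx).
- move=> x; split=> [Vx|[Ux nz]].
    by split; [exact: VU|have [v v0 hv] := Vu x Vx => /(has_value_uniq hv)/eqP; rewrite (negPf v0)].
  apply: contrapT => /sP xs; apply: nz => /=; have [v [hv]] := gx x (Ux0 _ Ux).
  by rewrite mem_filter xs (Ux0 _ Ux) /= => /eqP v0; rewrite v0 in hv.
Qed.

End Opens.

(** * Torsion-freeness from flatness *)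

Section FlatTorsion.
Variables (A : comNzRingType) (M : lmodType A).

(** The tensor product of [M] with the ring is [M]; this is the concrete tensor product to which the
    definition of flatness gets applied. *)
Lemma is_tensor_regular : is_tensor (fun (m : M) (a : A^o) => (a : A) *: m).
Proof.
split; first by split=> [m a x y|a c m m'] /=; rewrite ?scalerDl ?scalerDr ?scalerA // mulrC.
move=> P c [cl cr]; exists (fun m => c m 1); split.
  split=> [a m m'|m a] /=; first exact: cr.
  rewrite -[a in RHS]mulr1.
  have := cr 1 a m 0; rewrite addr0 => ->; have := cl m a 1 0.
  have c0 m0 : c m0 0 = 0 by have := cl m0 (-1) 0 0; rewrite scaler0 addr0 scaleN1r addNr.
  have c00 : c 0 1 = 0 by have := cr 1 (-1) 0 0; rewrite scaler0 addr0 scaleN1r addNr.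
  by rewrite c0 c00 !addr0.
by move=> h [hl hb]; apply: funext => m; rewrite -hb scale1r.
Qed.

(** Flatness applied to the injection of the ring into itself given by multiplication by [f]. *)
Lemma flat_torsionfree (f : A) : flat M -> injective (fun a : A => f * a) ->
  forall m : M, f *: m = 0 -> m = 0.
Proof.
move=> fM fi m fm; have l (N : lmodType A) : linear (fun n : N => f *: n).
  by move=> a u v; rewrite scalerDr !scalerA mulrC.
apply: (fM _ _ (fun a : A^o => f *: a) (l _) fi _ _ _ _ is_tensor_regular
  is_tensor_regular (fun n => f *: n) (l _)) => [m' n|]; last by rewrite scaler0.
by rewrite /= scalerA.
Qed.

End FlatTorsion.

(** * Injectivity of restriction and extension of sections *)

Section SheafLemmas.
Variables (C : numClosedFieldType) (F : sheaf C).
Implicit Types (U V W : zopen C).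

Lemma res0 U V (h : V `<=` U) : res h (0 : F U) = 0.
Proof.
have := res_add h (0 : F U) 0; rewrite addr0 => /eqP.
by rewrite -subr_eq0 opprD addrA subrr sub0r oppr_eq0 => /eqP.
Qed.

Lemma res_sum U V (h : V `<=` U) I (s : seq I) (P : pred I) (m : I -> F U) :
  res h (\sum_(i <- s | P i) m i) = \sum_(i <- s | P i) res h (m i).
Proof. by apply: (big_morph (res h)); [exact: res_add|exact: res0]. Qed.

Lemma resZ U V (h : V `<=` U) (f : O U) (m : F U) :
  res h (f *: m) = Ores h f *: res h m.
Proof. exact: res_scale. Qed.

Lemma resK U V W (h : V `<=` U) (h' : W `<=` V) (h'' : W `<=` U) (m : F U) :
  res h' (res h m) = res h'' m.
Proof. by rewrite -(res_comp h h' h''). Qed.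

Hypotheses (qc : quasicoherent F) (fl : flat_sheaf F).

Lemma torsionfree_affine U (f : O U) (m : F U) : affine U ->
  Oval f != 0 -> f *: m = 0 -> m = 0.
Proof.
move=> aU f0; apply: (flat_torsionfree (fl aU)) => a b /(congr1 (@Oval C U)).
by rewrite !OvalM => /(mulfI f0)/OvalE.
Qed.

(** Quasicoherence makes a power of [f] annihilate [m], and torsion-freeness removes that power. *)
Lemma res_inj_affine U V (h : V `<=` U) (m : F U) : affine U ->
  res h m = 0 -> m = 0.
Proof.
move=> aU; have [f [f0 fV _]] := basic_open aU h.
have [/(_ m) inj _] := qc h aU fV => /inj[k].
have fk : Oval (f ^+ k) != 0.
  rewrite OvalX.
  apply: expf_neq0.
  exact: f0.
move=> e.
apply: torsionfree_affine e.
exact: aU.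
exact: fk.
Qed.

Lemma cover01 U (x : P1 C) : zset U x ->
  exists b : bool, zset (capU U (if b then U0 C else Uinf C)) x.
Proof.
case: x => [a|] Ux; first by exists true; split => //; apply/U0P; exists a.
by exists false; split.
Qed.

(** The two affine lines cover [U], and since all open sets are nonempty each part of [U] still
    meets [V]. *)
Lemma res_inj U V (h : V `<=` U) (m : F U) : res h m = 0 -> m = 0.
Proof.
move=> m0.
apply: (@sheaf_sep _ F U bool (fun b => capU U (if b then U0 C else Uinf C)) (fun b => @capUl C U _)).
  exact: cover01.
move=> b; rewrite res0; set W := capU U _.
have hW : affine W.
  apply: affine_sub (@capUr C U _) _; case: b {W}; [exact: affine_U0|exact: affine_Uinf].
apply: (@res_inj_affine _ (capU W V) (@capUl C _ _)) => //.
have h1 : capU W V `<=` U by move=> x [[]].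
by rewrite (resK _ _ h1) -(resK h (@capUr C _ _) h1) m0 res0.
Qed.

(** The factor [g] is a power of the function that cuts out [V], hence invertible on [V]. *)
Lemma extend_section U V (h : V `<=` U) (m : F V) : affine U ->
  exists (g : O U) (m1 : F U), [/\ Oval g != 0, forall x, zset V x -> uniat x (Oval g) &
    res h m1 = Ores h g *: m].
Proof.
move=> aU; have [f [f0 fV fu]] := basic_open aU h.
have [_ /(_ m (Ores h f) erefl)[k [m1 e]]] := qc h aU fV.
exists (f ^+ k), m1; split.
- by rewrite OvalX expf_neq0.
- by move=> x Vx; rewrite OvalX; exact: (@uniatX _ _ _ k%:Z (fu x Vx)).
- by rewrite e; congr (_ *: _); apply: OvalE; rewrite /= !OvalX.
Qed.

End SheafLemmas.

(** * The family of Lie algebras *)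

Lemma forall_ord2 (P : 'I_2 -> 'I_2 -> Prop) :
  P 0 0 -> P 0 1 -> P 1 0 -> P 1 1 -> forall i j, P i j.
Proof.
move=> h00 h01 h10 h11.
have h (i : 'I_2) : i = 0 \/ i = 1.
  by case: i => -[|[|//]] hi; [left|right]; apply: val_inj.
by move=> i j; case: (h i) => ->; case: (h j) => ->.
Qed.

Section Matrices.
Variable A : comNzRingType.
Implicit Types (a b c d : A).

Lemma mx2_eta (M : 'M[A]_2) : M = mx2 (M 0 0) (M 0 1) (M 1 0) (M 1 1).
Proof.
apply/matrixP => i j; rewrite mxE.
by case: i => -[|[|//]] hi; case: j => -[|[|//]] hj /=; congr (M _ _); apply: val_inj.
Qed.

Lemma mx2_00 a b c d : mx2 a b c d 0 0 = a. Proof. by rewrite mxE. Qed.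
Lemma mx2_01 a b c d : mx2 a b c d 0 1 = b. Proof. by rewrite mxE. Qed.
Lemma mx2_10 a b c d : mx2 a b c d 1 0 = c. Proof. by rewrite mxE. Qed.
Lemma mx2_11 a b c d : mx2 a b c d 1 1 = d. Proof. by rewrite mxE. Qed.
Definition mx2E := (mx2_00, mx2_01, mx2_10, mx2_11).

Lemma mx2_mul a b c d a' b' c' d' :
  mx2 a b c d *m mx2 a' b' c' d' =
  mx2 (a * a' + b * c') (a * b' + b * d') (c * a' + d * c') (c * b' + d * d').
Proof.
rewrite [LHS]mx2_eta; congr mx2; rewrite !mxE !big_ord_recl big_ord0 addr0 !mxE;
  by rewrite /= ?addr0.
Qed.

Lemma mx2_add a b c d a' b' c' d' :
  mx2 a b c d + mx2 a' b' c' d' = mx2 (a + a') (b + b') (c + c') (d + d').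
Proof. by rewrite [LHS]mx2_eta !mxE. Qed.

Lemma mx2_opp a b c d : - mx2 a b c d = mx2 (- a) (- b) (- c) (- d).
Proof. by rewrite [LHS]mx2_eta !mxE. Qed.

Lemma mx2_scale k a b c d : k *: mx2 a b c d = mx2 (k * a) (k * b) (k * c) (k * d).
Proof. by rewrite [LHS]mx2_eta !mxE. Qed.

(* Coordinates in the basis H, X, Y of the fiber at [t : 1], with ti = t^-1. *)
Definition gelt (t ti h x y : A) : mxpair A :=
  (mx2 h (x * t) (y * ti) (- h), mx2 h x y (- h)).

Lemma gelt_lin t ti k h x y h' x' y' :
  k *: gelt t ti h x y + gelt t ti h' x' y' =
  gelt t ti (k * h + h') (k * x + x') (k * y + y').
Proof.
congr pair; rewrite /= !mx2_scale !mx2_add; congr mx2; ring.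
Qed.

Lemma gelt_scale t ti k h x y :
  k *: gelt t ti h x y = gelt t ti (k * h) (k * x) (k * y).
Proof. by congr pair; rewrite /= !mx2_scale; congr mx2; ring. Qed.

Lemma bracket_gelt t ti h x y h' x' y' : t * ti = 1 ->
  bracket (gelt t ti h x y) (gelt t ti h' x' y') =
  gelt t ti (x * y' - y * x') ((h * x' - x * h') *+ 2) ((y * h' - h * y') *+ 2).
Proof.
move=> e; congr pair; rewrite /= !mx2_mul mx2_opp mx2_add; congr mx2; try ring.
all: have e2 u v : u * t * (v * ti) = u * v by rewrite mulrACA e mulr1.
all: have e3 u v : u * ti * (v * t) = u * v by rewrite mulrACA [ti * t]mulrC e mulr1.
all: rewrite ?e2 ?e3; ring.
Qed.

End Matrices.

Lemma map_mx2 (A B : comNzRingType) (f : A -> B) a b c d :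
  map_mx f (mx2 a b c d) = mx2 (f a) (f b) (f c) (f d).
Proof. by rewrite [LHS]mx2_eta !mxE. Qed.

Section Gsec.
Variable C : numClosedFieldType.
Local Notation K := (ratfun C).
Local Notation z := (zfun C).
Local Notation gel := (@gelt K z z^-1).
Implicit Types (U V : zopen C) (h x y : K).

Lemma zzV : z * z^-1 = 1. Proof. by rewrite divff ?zfun_neq0. Qed.

Lemma mpmap_gelt (kk : fieldType) (i : {rmorphism K -> kk}) h x y :
  mpmap i (gel h x y) = gelt (i z) (i z)^-1 (i h) (i x) (i y).
Proof. by rewrite /mpmap /= !map_mx2 !rmorphM rmorphN fmorphV. Qed.

Lemma secH_gelt : secH C = gel 1 0 0.
Proof. by rewrite /secH /gelt !mul0r. Qed.
Lemma secX_gelt : secX C = gel 0 1 0.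
Proof. by rewrite /secX /gelt oppr0 mul0r mul1r. Qed.
Lemma secY_gelt : secY C = gel 0 0 1.
Proof. by rewrite /secY /gelt oppr0 mul0r mul1r. Qed.

Lemma gelt_sum h x y : gel h x y = h *: secH C + (x *: secX C + (y *: secY C + 0)).
Proof.
have e0 : (0 : mxpair K) = gel 0 0 0.
  rewrite /gelt !mul0r oppr0; apply: injective_projections; apply/matrixP => i j;
    by rewrite !mxE; do 2 case: ifP => _.
rewrite e0 secH_gelt secX_gelt secY_gelt 3!gelt_lin.
by congr gelt; rewrite !(mulr0, mulr1, addr0, add0r).
Qed.

(** Regularity of the entries of [gel h x y]; the relations that define the fiber at [p] then hold
    automatically. *)
Definition greg (p : P1 C) h x y : Prop :=
  [/\ reg p h, reg p x, reg p (x * z), reg p y & reg p (y / z)].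

Lemma has_valueN (f : K) p v : has_value f p v -> has_value (- f) p (- v).
Proof.
move=> hf; rewrite -[- f]sub0r -[- v]sub0r; apply: has_valueB => //.
by have := has_value_const 0 p; rewrite rmorph0.
Qed.

Lemma eq_of_values U (f g : K) :
  (forall p, zset U p -> exists v, has_value f p v /\ has_value g p v) -> f = g.
Proof.
move=> fg; apply: contrapT => /eqP ne; have ne0 : f - g != 0 by rewrite subr_eq0.
have fin : finite_set (~` (zset U `&` ~` [set p | has_value (f - g) p 0])).
  by rewrite setCI setCK finite_setU; split; [exact: zset_cofinite|exact: finite_zero].
have [p [Up np]] := zopen_nonempty (ZOpen fin); apply: np.
by have [v [hf hg]] := fg p Up; have := has_valueB hf hg; rewrite subrr.
Qed.

(** The fiber relations at the finite points of [U] are identities between rational functions, so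
    the second matrix determines the first. Conversely the values of regular entries satisfy them:
    at infinity, regularity of x z and of y forces x and y / z to vanish. *)
Lemma gsecP U xi : gsec U xi <->
  exists h x y, xi = gel h x y /\ forall p, zset U p -> greg p h x y.
Proof.
split=> [g|[h [x [y [-> r]]]] p Up].
  have g0 : gsec (capU U (U0 C)) xi by move=> p [Up _]; exact: g.
  pose h := xi.2 0 0; pose x := xi.2 0 1; pose y := xi.2 1 0.
  have vz a : has_value z (Some a) a by have := has_value_fin 'X a; rewrite hornerX.
  (* Two expressions in the entries of [xi] that agree in every fiber over a finite point of [U] are
     equal. *)
  have fin f1 f2 : (forall a eta, gfiber a 1 eta ->
      (forall i j, has_value (xi.1 i j) (Some a) (eta.1 i j) /\
                   has_value (xi.2 i j) (Some a) (eta.2 i j)) ->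
      exists v, has_value f1 (Some a) v /\ has_value f2 (Some a) v) -> f1 = f2.
    move=> H; apply: (@eq_of_values (capU U (U0 C))) => p [Up /U0P[a pa]].
    by rewrite pa in Up *; have [eta he hv] := g (Some a) Up; exact: (H a eta).
  have e100 : xi.1 0 0 = h.
    apply: fin => a _ [u [b [c ->]]] H; exists u.
    by have := H 0 0; rewrite /= !mx2E.
  have e111 : xi.1 1 1 = - h.
    apply: fin => a _ [u [b [c ->]]] H; exists (- u).
    by have [[+ _] [_ /has_valueN]] := (H 1 1, H 0 0); rewrite /= !mx2E.
  have e211 : xi.2 1 1 = - h.
    apply: fin => a _ [u [b [c ->]]] H; exists (- u).
    by have [[_ +] [_ /has_valueN]] := (H 1 1, H 0 0); rewrite /= !mx2E.
  have e101 : xi.1 0 1 = x * z.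
    apply: fin => a _ [u [b [c ->]]] H; exists (b * a).
    have [+ /has_valueM/(_ (vz a))] := H 0 1; rewrite /= !mx2E mul1r mulrC.
    by move=> h1 h2; split; [exact: h1|rewrite mulrC in h2 *; exact: h2].
  have e110 : y = xi.1 1 0 * z.
    apply: fin => a _ [u [b [c ->]]] H; exists (c * a).
    have [/has_valueM/(_ (vz a)) + +] := H 1 0; rewrite /= !mx2E mul1r.
    by move=> h1 h2; split; [rewrite mulrC; exact: h2|exact: h1].
  have e110' : xi.1 1 0 = y / z by rewrite e110 mulfK // zfun_neq0.
  exists h, x, y; split.
    rewrite [xi]surjective_pairing [xi.1]mx2_eta [xi.2]mx2_eta.
    by rewrite e100 e101 e110' e111 e211.
  move=> p Up; have [eta _ H] := g p Up; rewrite /greg -e110' -e101.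
  by split; [exists (eta.2 0 0)|exists (eta.2 0 1)|exists (eta.1 0 1)
            |exists (eta.2 1 0)|exists (eta.1 1 0)]; case: (H 0 0) (H 0 1) (H 1 0) => ? ? [? ?] [].
have [[u hu] [b hb] [b' hb'] [c hc] [c' hc']] := r p Up.
have hNu := has_valueN hu.
case: p Up {r} hu hb hb' hc hc' hNu => [a|] Up hu hb hb' hc hc' hNu.
  exists (mx2 u (a * b) (1 * c') (- u), mx2 u (1 * b) (a * c') (- u)); first by exists u, b, c'.
  have vz : has_value z (Some a) a by have := has_value_fin 'X a; rewrite hornerX.
  have eb : b' = a * b by rewrite mulrC; apply: has_value_uniq hb' _; exact: has_valueM.
  have ec : c = a * c'.
    rewrite mulrC; apply: has_value_uniq hc _.
    by have := has_valueM hc' vz; rewrite divfK // zfun_neq0.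
  by rewrite !mul1r -eb -ec; apply: forall_ord2; rewrite /= !mx2E.
have vz : has_value z^-1 None (0 : C) by rewrite -parinf; exact: par0.
have eb : b = 0.
  apply: has_value_uniq hb _.
  by have := has_valueM hb' vz; rewrite mulfK ?zfun_neq0 // mulr0.
have ec : c' = 0 by apply: has_value_uniq hc' _; have := has_valueM hc vz; rewrite mulr0.
exists (mx2 u b' c' (- u), mx2 u b c (- u)).
  by exists u, b', c; rewrite eb ec !mul1r !mul0r.
by apply: forall_ord2; rewrite /= !mx2E.
Qed.

Lemma gsec_gelt U h x y : (forall p, zset U p -> greg p h x y) -> gsec U (gel h x y).
Proof. by move=> r; apply/gsecP; exists h, x, y. Qed.

Lemma gelt_inj h x y h' x' y' : gel h x y = gel h' x' y' -> [/\ h = h', x = x' & y = y'].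
Proof.
move=> /(congr1 snd)/matrixP e.
by split; [have := e 0 0|have := e 0 1|have := e 1 0]; rewrite !mx2E.
Qed.

Lemma gsecH U : gsec U (secH C).
Proof.
rewrite secH_gelt; apply: gsec_gelt => p _.
by split; rewrite ?mul0r; (exact: reg0 || exact: reg1).
Qed.

Lemma gsec01X U : U `<=` U01 C -> gsec U (secX C).
Proof.
move=> UU; rewrite secX_gelt; apply: gsec_gelt => p /UU/U01P[a a0 ->].
by split; rewrite ?mul0r ?mul1r; (exact: reg0 || exact: reg1 || exact: reg_z).
Qed.

Lemma gsec01Y U : U `<=` U01 C -> gsec U (secY C).
Proof.
move=> UU; rewrite secY_gelt; apply: gsec_gelt => p /UU/U01P[a a0 ->].
split; rewrite ?mul0r ?mul1r; try exact: reg0; try exact: reg1.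
exact/uniat_reg/uniatV/uniat_z.
Qed.

Lemma gsec_sub U V xi : V `<=` U -> gsec U xi -> gsec V xi.
Proof. by move=> VU g p /VU; exact: g. Qed.

Lemma gsec_lin U (f : O U) xi eta : gsec U xi -> gsec U eta -> gsec U (Oval f *: xi + eta).
Proof.
move=> /gsecP[h [x [y [-> r]]]] /gsecP[h' [x' [y' [-> r']]]].
rewrite gelt_lin; apply: gsec_gelt => p Up.
have [r1 r2 r3 r4 r5] := r p Up; have [s1 s2 s3 s4 s5] := r' p Up.
have rf := Oreg f Up.
by split; rewrite ?mulrDl -?mulrA; apply: regD => //; apply: regM.
Qed.

Lemma gsec0 U : gsec U (0 : mxpair K).
Proof.
have := gsec_lin (-1) (@gsecH U) (@gsecH U).
by rewrite OvalN Oval1 scaleN1r addNr.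
Qed.

Lemma gsec_bracket U xi eta : gsec U xi -> gsec U eta -> gsec U (bracket xi eta).
Proof.
move=> /gsecP[h [x [y [-> r]]]] /gsecP[h' [x' [y' [-> r']]]].
rewrite (bracket_gelt _ _ _ _ _ _ zzV); apply: gsec_gelt => p Up.
have [r1 r2 r3 r4 r5] := r p Up; have [s1 s2 s3 s4 s5] := r' p Up.
split; rewrite ?mulr2n ?mulrDl ?mulNr -?mulrA.
- by apply: regB; apply: regM.
- by apply: regD; apply: regB; apply: regM.
- by rewrite ![_ * (h' * z)]mulrCA -?[x * z * _]mulrC; do 2 apply: regD; try apply: regN; apply: regM.
- by apply: regD; apply: regB; apply: regM.
- by rewrite ![_ * (h' / z)]mulrCA; do 2 apply: regD; try apply: regN; apply: regM.
Qed.

Lemma Ad_gelt a h x y : a != 0 ->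
  Ad a (gel h x y) = gel h (constfun (a ^ 2) * x) (constfun (a ^ (-2)) * y).
Proof.
move=> a0; have c0 : constfun a != 0 by rewrite constfun_eq0.
have -> : constfun (a ^ 2) = constfun a * constfun a by rewrite -exprnP expr2 rmorphM.
have -> : constfun (a ^ (-2)) = constfun a^-1 * constfun a^-1.
  by rewrite -invr_expz -exprnP -exprVn expr2 rmorphM.
have e : constfun a * constfun a^-1 = 1 by rewrite -rmorphM divff // rmorph1.
rewrite /Ad /mpmul /kelt /gelt /= !invrK !mx2_mul.
move: (constfun a) (constfun a^-1) e => u v e.
have e2 w : u * w * v = w by rewrite mulrAC e mul1r.
have e3 w : v * w * u = w by rewrite mulrAC [v * u]mulrC e mul1r.
by congr pair; congr mx2; rewrite !(mulr0, mul0r, addr0, add0r) ?e2 ?e3 //; ring.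
Qed.

Lemma gsec_Ad U a xi : a != 0 -> gsec U xi -> gsec U (Ad a xi).
Proof.
move=> a0 /gsecP[h [x [y [-> r]]]]; rewrite Ad_gelt //; apply: gsec_gelt => p Up.
have [r1 r2 r3 r4 r5] := r p Up.
by split; rewrite -?mulrA //; apply: regM => //; exact: regC.
Qed.

End Gsec.

(** * Weight components *)

Section Regroup.
Variable M : nmodType.

Lemma sum_pick (I : eqType) (E : seq I) (w : I -> M) k : uniq E ->
  \sum_(n <- E | n == k) w n = if k \in E then w k else 0.
Proof.
elim: E => [|n E IH] /=; first by rewrite big_nil.
move=> /andP[nE uE]; rewrite big_cons in_cons IH // [k == n]eq_sym.
have [nk|nk] /= := eqVneq n k; last by [].
rewrite -nk in IH *.
by rewrite (negPf nE) addr0.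
Qed.

Lemma big_regroup (I : eqType) (T : Type) (key : T -> I)
    (s : seq T) (E : seq I) (G : T -> M) : uniq E -> all (fun t => key t \in E) s ->
  \sum_(t <- s) G t = \sum_(n <- E) \sum_(t <- s | key t == n) G t.
Proof.
move=> uE; elim: s => [|t s IH] /=.
  by rewrite big_nil big1 // => n _; rewrite big_nil.
move=> /andP[tE sE]; rewrite big_cons IH //.
under [RHS]eq_bigr do rewrite big_cons.
rewrite [RHS](_ : _ = \sum_(n <- E) ((if n == key t then G t else 0)
  + \sum_(u <- s | key u == n) G u)); last first.
  by apply: eq_bigr => n _; rewrite [n == _]eq_sym; case: ifP => _; rewrite ?add0r.
by rewrite big_split -big_mkcond /= (sum_pick (fun=> G t)) // tE.
Qed.

End Regroup.

(** In characteristic 0 the number 2 is not a root of unity, so evaluation at this single point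
    separates the characters of the torus. *)
Lemma expz2_inj (C : numClosedFieldType) (m n : int) : (2 : C) ^ m = 2 ^ n -> m = n.
Proof.
move=> e; have n2 : (2 : C) != 0 by rewrite pnatr_eq0.
have e1 : (2 : C) ^ (m - n) = 1 by rewrite expfzDr // -invr_expz e divff // expfz_neq0.
have pow (k : nat) : (2 : C) ^+ k = 1 -> k = 0%N.
  move=> /eqP; rewrite -natrX -[1]/(1%:R) eqr_nat => /eqP h.
  by case: k h => // k h; have := ltn_expl k.+1 (isT : (1 < 2)%N); rewrite h.
suff : `|m - n|%N = 0%N by lia.
apply: pow; case: (m - n) e1 => k; rewrite ?NegzE /=; first by rewrite -exprnP.
by rewrite -invr_expz -exprnP => /(congr1 GRing.inv); rewrite invrK invr1.
Qed.

(** * Independence of the characters of the torus *)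

Section Laurent.
Variables (C : numClosedFieldType) (A : comNzRingType) (M : lmodType A).
Variable i : {rmorphism C -> A}.

Lemma scale_unit (c : C) (m : M) : c != 0 -> i c *: m = 0 -> m = 0.
Proof.
move=> c0 /(congr1 (fun u => i c^-1 *: u)).
by rewrite scaler0 scalerA -rmorphM mulVf // rmorph1 scale1r.
Qed.

(** Subtracting 2^k times the relation at a from the relation at 2a removes the term of exponent [k]
    and multiplies the term of exponent [n] by the nonzero constant 2^n - 2^k. *)
Lemma laurent_coef_uniq (E : seq int) (w : int -> M) : uniq E ->
  (forall a : C, a != 0 -> \sum_(n <- E) i (a ^ n) *: w n = 0) ->
  forall n, n \in E -> w n = 0.
Proof.
elim: E w => [//|k E IH] w /= /andP[kE uE] h.
have n2 : (2 : C) != 0 by rewrite pnatr_eq0.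
have hE n : n \in E -> w n = 0.
  move=> nE; apply: (@scale_unit (2 ^ n - 2 ^ k)).
    by rewrite subr_eq0; apply: contraNneq kE => /expz2_inj <-.
  apply: (IH (fun n => i (2 ^ n - 2 ^ k) *: w n)) nE => // a a0.
  have : \sum_(n <- k :: E) i ((2 * a) ^ n) *: w n =
      i (2 ^ k) *: \sum_(n <- k :: E) i (a ^ n) *: w n.
    by rewrite h ?mulf_neq0 // h // scaler0.
  rewrite !big_cons scalerDr scalerA exprzMl ?unitfE // rmorphM => /addrI.
  move=> /eqP; rewrite -subr_eq0 => /eqP e; rewrite -[RHS]e scaler_sumr -sumrB.
  apply: eq_bigr => m _; rewrite !scalerA -scalerBl -!rmorphM -rmorphB exprzMl ?unitfE //.
  by rewrite mulrBr [a ^ m * _]mulrC [a ^ m * _]mulrC.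
move=> n; rewrite in_cons => /orP[/eqP->|]; last exact: hE.
have := h 1 (oner_neq0 _); rewrite big_cons exp1rz rmorph1 scale1r.
rewrite big_seq_cond big1 ?addr0 // => m /andP[mE _].
by rewrite hE // scaler0.
Qed.

Lemma laurent_coef (s : seq (int * M)) :
  (forall a : C, a != 0 -> \sum_(t <- s) i (a ^ t.1) *: t.2 = 0) ->
  forall n, \sum_(t <- s | t.1 == n) t.2 = 0.
Proof.
move=> h n; pose E := undup (map fst s); have uE : uniq E by exact: undup_uniq.
have sE : all (fun t => t.1 \in E) s.
  by apply/allP => t ts; rewrite mem_undup; apply: map_f.
have [nE|nE] := boolP (n \in E); last first.
  rewrite big_seq_cond big1 // => t /andP[ts /eqP tn].
  by case/negP: nE; rewrite -tn; exact: (allP sE).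
apply: (laurent_coef_uniq (w := fun n => \sum_(t <- s | t.1 == n) t.2) uE) nE => a a0.
rewrite -[RHS](h a a0) [RHS](big_regroup _ uE sE); apply: eq_bigr => m _.
by rewrite scaler_sumr; apply: eq_bigr => t /eqP->.
Qed.

(** The derivative at a = 1 of a vanishing Laurent polynomial is zero. It makes the differential of
    the torus action independent of the expansion used to compute it. *)
Lemma laurent_moment (s : seq (int * M)) :
  (forall a : C, a != 0 -> \sum_(t <- s) i (a ^ t.1) *: t.2 = 0) ->
  \sum_(t <- s) t.2 *~ t.1 = 0.
Proof.
move=> h; pose E := undup (map fst s); have uE : uniq E by exact: undup_uniq.
have sE : all (fun t => t.1 \in E) s.
  by apply/allP => t ts; rewrite mem_undup; apply: map_f.
rewrite (big_regroup _ uE sE) big1 // => n _.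
rewrite (eq_bigr (fun t => t.2 *~ n)) => [|t /eqP-> //].
by rewrite -mulrz_suml laurent_coef // mul0rz.
Qed.

End Laurent.

Section Components.
Variables (C : numClosedFieldType) (F : hcmodule C).
Implicit Types (U V : zopen C).

Lemma kactD U a (m m' : F U) : a != 0 -> kact a (m + m') = kact a m + kact a m'.
Proof. by move=> a0; have := @kact_linear _ F U a a0 1 m m'; rewrite !scale1r. Qed.

Lemma kact0 U a : a != 0 -> kact a (0 : F U) = 0.
Proof. by move=> a0; have := @kact_linear _ F U a a0 (-1) 0 0; rewrite scaler0 addr0 scaleN1r addNr. Qed.

Lemma kactZ U a f (m : F U) : a != 0 -> kact a (f *: m) = f *: kact a m.
Proof. by move=> a0; have := @kact_linear _ F U a a0 f m 0; rewrite kact0 // !addr0. Qed.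

Lemma kact_sum U a I (s : seq I) (P : pred I) (w : I -> F U) : a != 0 ->
  kact a (\sum_(t <- s | P t) w t) = \sum_(t <- s | P t) kact a (w t).
Proof.
by move=> a0; apply: (big_morph (kact a)) => [m m'|]; [exact: kactD|exact: kact0].
Qed.

Definition wseq U (m : F U) : seq (int * F U) := projT1 (cid (kact_alg m)).

Lemma wseqP U (m : F U) a : a != 0 ->
  kact a m = \sum_(t <- wseq m) Oconst U (a ^ t.1) *: t.2.
Proof. exact: (projT2 (cid (kact_alg m))). Qed.

(** An expansion may repeat an exponent, so all its coefficients there are collected. *)
Definition wcomp U (n : int) (m : F U) : F U := \sum_(t <- wseq m | t.1 == n) t.2.

Definition wts U (m : F U) : seq int := undup (map fst (wseq m)).

Lemma wcomp_sum U (m : F U) : m = \sum_(n <- wts m) wcomp n m.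
Proof.
rewrite -big_regroup ?undup_uniq //; last first.
  by apply/allP => t ts; rewrite mem_undup; apply: map_f.
rewrite -{1}[m]kact1 wseqP ?oner_neq0 //; apply: eq_bigr => t _.
by rewrite exp1rz rmorph1 scale1r.
Qed.

Lemma wcomp_weight U n (m : F U) : weight_space n (wcomp n m).
Proof.
move=> b b0; rewrite /wcomp kact_sum // scaler_sumr; apply/eqP.
rewrite -subr_eq0 -sumrB; apply/eqP.
(* The Laurent polynomial in [a] that expresses k_b k_a m - k_ba m = 0; its coefficient at [n] is
   the claim. *)
pose s := [seq (t.1, kact b t.2 - Oconst U (b ^ t.1) *: t.2) | t <- wseq m].
have := @laurent_coef C _ _ (@Oconst C U) s _ n.
rewrite big_map /=; under eq_bigr => t /eqP-> do over; apply.
move=> a a0; rewrite /s big_map /=; apply/eqP.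
under eq_bigr do rewrite scalerBr.
rewrite sumrB subr_eq0; apply/eqP.
transitivity (kact b (kact a m)).
  by rewrite [in RHS](wseqP m a0) kact_sum //; apply: eq_bigr => t _; rewrite kactZ.
rewrite -kactM // wseqP ?mulf_neq0 //; apply: eq_bigr => t _.
by rewrite scalerA -rmorphM exprzMl ?unitfE // mulrC.
Qed.

(** The chosen expansion of k_a m and the one given by [w] have equal coefficients. *)
Lemma wcomp_uniq U (m : F U) (E : seq int) (w : int -> F U) : uniq E ->
  (forall n, n \in E -> weight_space n (w n)) -> m = \sum_(n <- E) w n ->
  forall n, wcomp n m = if n \in E then w n else 0.
Proof.
move=> uE hw em n; apply/eqP; rewrite -subr_eq0; apply/eqP.
pose s := wseq m ++ [seq (k, - w k) | k <- E].
have := @laurent_coef C _ _ (@Oconst C U) s _ n.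
rewrite big_cat big_map /= sumrN sum_pick //; apply => a a0.
rewrite big_cat big_map /= -wseqP // {1}em kact_sum //; under [X in _ + X]eq_bigr do rewrite scalerN.
rewrite sumrN; apply/eqP; rewrite subr_eq0; apply/eqP.
by rewrite big_seq [RHS]big_seq; apply: eq_bigr => k /hw; exact.
Qed.

Lemma weight0 U n : weight_space n (0 : F U).
Proof. by move=> a a0; rewrite kact0 // scaler0. Qed.

Lemma weight_lin U n f (m m' : F U) : weight_space n m -> weight_space n m' ->
  weight_space n (f *: m + m').
Proof.
move=> h h' a a0; rewrite kactD // kactZ // h // h' // scalerDr !scalerA.
by rewrite [f * _]mulrC.
Qed.

Lemma weightD U n (m m' : F U) : weight_space n m -> weight_space n m' ->
  weight_space n (m + m').
Proof. by rewrite -{2}[m]scale1r; exact: weight_lin. Qed.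

Lemma weightZ U n f (m : F U) : weight_space n m -> weight_space n (f *: m).
Proof. by move=> h; rewrite -[f *: m]addr0; apply: weight_lin => //; exact: weight0. Qed.

Lemma weight_res U V (h : V `<=` U) n (m : F U) : weight_space n m -> weight_space n (res h m).
Proof.
move=> hm a a0; rewrite -kact_res // hm //; exact: res_scale.
Qed.

Lemma wcomp_of_weight U k n (m : F U) : weight_space k m ->
  wcomp n m = if n == k then m else 0.
Proof.
move=> hm; rewrite (@wcomp_uniq U m [:: k] (fun=> m)) ?big_seq1 ?inE //.
by move=> i; rewrite inE => /eqP->.
Qed.

Lemma wcomp_lin U n f (m m' : F U) : wcomp n (f *: m + m') = f *: wcomp n m + wcomp n m'.
Proof.
pose E := undup (wts m ++ wts m').
have comp0 (u : F U) k : k \notin wts u -> wcomp k u = 0.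
  move=> h; rewrite (wcomp_uniq (undup_uniq (map fst (wseq u))) _ (wcomp_sum u)) ?(negPf h) //.
  by move=> i _; exact: wcomp_weight.
have sumE (u : F U) : {subset wts u <= E} -> u = \sum_(k <- E) wcomp k u.
  move=> sE; rewrite {1}(wcomp_sum u).
  rewrite [RHS](bigID (mem (wts u))) /= [X in _ + X]big1 ?addr0; last by move=> k /comp0.
  rewrite -[RHS]big_filter; apply: perm_big; apply: uniq_perm.
  - exact: undup_uniq.
  - exact/filter_uniq/undup_uniq.
  - by move=> k; rewrite mem_filter; case: (boolP (k \in wts u)) => // /sE ->.
have s1 : {subset wts m <= E} by move=> k km; rewrite /E mem_undup mem_cat km.
have s2 : {subset wts m' <= E} by move=> k km; rewrite /E mem_undup mem_cat km orbT.
rewrite (@wcomp_uniq U _ E (fun k => f *: wcomp k m + wcomp k m')) ?undup_uniq //.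
- case: ifP => // /negbT nE; rewrite !comp0 ?scaler0 ?addr0 //; apply: contra nE; [exact: s2|exact: s1].
- by move=> k _; apply: weight_lin; exact: wcomp_weight.
- by rewrite {1}(sumE m s1) {1}(sumE m' s2) scaler_sumr -big_split.
Qed.

Lemma wcomp_res U V (h : V `<=` U) n (m : F U) : wcomp n (res h m) = res h (wcomp n m).
Proof.
rewrite (@wcomp_uniq V _ (wts m) (fun k => res h (wcomp k m))) ?undup_uniq //.
- case: ifP => // nE; rewrite (@wcomp_uniq U m (wts m) (fun k => wcomp k m)) ?undup_uniq ?nE ?res0 //.
  + by move=> k _; exact: wcomp_weight.
  + exact: wcomp_sum.
- by move=> k _; apply: weight_res; exact: wcomp_weight.
- by rewrite -res_sum -wcomp_sum.
Qed.

Lemma wcomp_kact U n a (m : F U) : a != 0 -> wcomp n (kact a m) = Oconst U (a ^ n) *: wcomp n m.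
Proof.
move=> a0; rewrite (@wcomp_uniq U _ (wts m) (fun k => Oconst U (a ^ k) *: wcomp k m)) ?undup_uniq //.
- case: ifP => // nE; rewrite (@wcomp_uniq U m (wts m) (fun k => wcomp k m)) ?undup_uniq ?nE ?scaler0 //.
  + by move=> k _; exact: wcomp_weight.
  + exact: wcomp_sum.
- by move=> k _; apply/weightZ/wcomp_weight.
- rewrite {1}[m]wcomp_sum kact_sum //; apply: eq_bigr => k _; exact: wcomp_weight.
Qed.

Lemma gactD U xi (m m' : F U) : gsec U xi -> gact xi (m + m') = gact xi m + gact xi m'.
Proof. by move=> g; have := @gact_linearr _ F U xi g 1 m m'; rewrite !scale1r. Qed.

Lemma gact0 U xi : gsec U xi -> gact xi (0 : F U) = 0.
Proof.
move=> g; have := @gactD U xi 0 0 g; rewrite addr0 => /eqP.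
by rewrite -subr_eq0 opprD addrA subrr sub0r oppr_eq0 => /eqP.
Qed.

Lemma gactZ U xi f (m : F U) : gsec U xi -> gact xi (f *: m) = f *: gact xi m.
Proof. by move=> g; have := @gact_linearr _ F U xi g f m 0; rewrite gact0 // !addr0. Qed.

Lemma gact_sum U xi I (s : seq I) (P : pred I) (w : I -> F U) : gsec U xi ->
  gact xi (\sum_(t <- s | P t) w t) = \sum_(t <- s | P t) gact xi (w t).
Proof.
by move=> g; apply: (big_morph (gact xi)) => [m m'|]; [exact: gactD|exact: gact0].
Qed.

Lemma gact_zero U (m : F U) : gact 0 m = 0.
Proof.
have := @gact_linearl _ F U (-1) _ _ m (@gsec0 _ U) (@gsec0 _ U).
by rewrite scaler0 addr0 scaleN1r addNr.
Qed.

Lemma gact_weight U xi k n (m : F U) : gsec U xi ->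
  (forall a, a != 0 -> Ad a xi = constfun (a ^ k) *: xi) ->
  weight_space n m -> weight_space (n + k) (gact xi m).
Proof.
move=> g hA hm a a0; rewrite hc_equivariant // hm // hA //.
have := @gact_linearl _ F U (Oconst U (a ^ k)) _ _ (Oconst U (a ^ n) *: m) g (@gsec0 _ U).
rewrite addr0 gact_zero addr0 => ->; rewrite gactZ // scalerA -rmorphM.
by rewrite mulrC expfzDr.
Qed.

Lemma gactX_weight U n (m : F U) : U `<=` U01 C ->
  weight_space n m -> weight_space (n + 2) (gact (secX C) m).
Proof.
move=> UU; apply: gact_weight; first exact: gsec01X.
by move=> a a0; rewrite secX_gelt Ad_gelt // gelt_scale mulr1 !mulr0.
Qed.

Lemma gactY_weight U n (m : F U) : U `<=` U01 C ->
  weight_space n m -> weight_space (n - 2) (gact (secY C) m).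
Proof.
move=> UU; apply: gact_weight; first exact: gsec01Y.
by move=> a a0; rewrite secY_gelt Ad_gelt // gelt_scale mulr1 !mulr0.
Qed.

Lemma gactH_weight U n (m : F U) : weight_space n m -> gact (secH C) m = m *~ n.
Proof.
move=> hm; rewrite (@hc_differential _ F U m [:: (n, m)]) ?big_seq1 // => a a0.
by rewrite big_seq1 hm.
Qed.

End Components.

(** * The generic fiber *)

Lemma clear_denominators (C : numClosedFieldType) k (f : 'I_k -> ratfun C) :
  exists q : {poly C}, q != 0 /\ forall i, exists p : {poly C}, tofrac q * f i = tofrac p.
Proof.
have /choice[pq hpq] : forall i, exists pq : {poly C} * {poly C},
    pq.2 != 0 /\ f i = tofrac pq.1 / tofrac pq.2.
  by move=> i; have [p [q [q0 e]]] := fracP (f i); exists (p, q).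
exists (\prod_i (pq i).2); split; first by apply/prodf_neq0 => i _; case: (hpq i).
move=> i; have [q0 e] := hpq i; exists ((\prod_(j | j != i) (pq j).2) * (pq i).1).
rewrite (bigD1 i) //= e !tofracM [tofrac (pq i).2 * _]mulrC -mulrA [_ / _]mulrC.
by rewrite mulVKf // tofrac_eq0.
Qed.

(** * Bases of the weight parts at the generic point *)

Section GenericBasis.
Variables (C : numClosedFieldType) (F : hcmodule C).
Local Notation K := (ratfun C).
Local Notation U1 := (U01 C).
Implicit Types (U V W : zopen C).

Lemma mkO_poly U (p : {poly C}) : U `<=` U0 C ->
  exists f : O U, Oval f = tofrac p.
Proof.
move=> UU; have r x : zset U x -> reg x (tofrac p).
  by move=> /UU/U0P[a ->]; exact: reg_poly.
by exists (mkO r).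
Qed.

(** A basis over the function field of the generic stalk of the weight [n] part, with the
    denominators moved to the left-hand side. *)
Definition generic_basis n k (s : 'I_k -> F U1) : Prop :=
  [/\ forall i, weight_space n (s i),
      forall c : 'I_k -> O U1, \sum_i c i *: s i = 0 -> forall i, c i = 0 &
      forall m, weight_space n m ->
        exists (b : O U1) (f : 'I_k -> O U1), Oval b != 0 /\ b *: m = \sum_i f i *: s i].

(** A subfamily of the generators that is minimal among those spanning up to denominators is
    independent, since a relation would eliminate one of its members. *)
Lemma exists_generic_basis n : coherent (@weight_space C F n) ->
  exists k (s : 'I_k -> F U1), generic_basis n s.
Proof.
move=> /(_ U1 (affine_U01 C))[k [s [sw sp]]].
pose P (A : {set 'I_k}) := `[< forall m, weight_space n m ->
  exists (b : O U1) (f : 'I_k -> O U1), Oval b != 0 /\ b *: m = \sum_(i in A) f i *: s i >].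
have PT : exists A, P A.
  exists [set: 'I_k]%SET; apply/asboolP => m /sp[f ->]; exists 1, f.
  rewrite Oval1 oner_neq0 scale1r; split => //.
  by apply: eq_bigl => i; rewrite inE.
have [A /minsetP[/asboolP PA minA]] := ex_minset PT.
have enum (f : 'I_k -> O U1) :
    \sum_(i in A) f i *: s i = \sum_(i < #|A|) f (enum_val i) *: s (enum_val i).
  exact: big_enum_val.
exists #|A|, (fun i => s (enum_val i)); split => [i|c c0 i|m /PA[b [f [b0 e]]]].
- exact: sw.
- apply: contrapT => /eqP ci; pose j : 'I_k := enum_val i.
  have jA : j \in A by exact: enum_valP.
  (* Extension of the coefficients by zero to the original index set. *)
  pose c' (t : 'I_k) : O U1 := if t \in A =P true is ReflectT h then c (enum_rank_in h t) else 0.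
  have ec (t : 'I_#|A|) : c' (enum_val t) = c t.
    rewrite /c'; case: eqP => [h|]; last by rewrite enum_valP.
    by rewrite enum_valK_in.
  have ecj : c' j = c i := ec i.
  have c'0 : \sum_(t in A) c' t *: s t = 0.
    by rewrite enum -[RHS]c0; apply: eq_bigr => t _; rewrite ec.
  (* Multiplying an expansion by [c' j] and subtracting [f j] times the relation eliminates
     [s j]. *)
  have PD : P (A :\ j)%SET.
    apply/asboolP => m /PA[b [f [b0 e]]].
    exists (c' j * b), (fun t => c' j * f t - f j * c' t); split.
      rewrite OvalM; apply: mulf_neq0; last exact: b0.
      by rewrite ecj -O_eq0; exact: ci.
    have : c' j *: (b *: m) - f j *: \sum_(t in A) c' t *: s t = (c' j * b) *: m.
      by rewrite c'0 scaler0 subr0 scalerA.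
    move=> <-; rewrite e !scaler_sumr -sumrB (bigD1 j jA) /= !scalerA [f j * _]mulrC subrr add0r.
    rewrite [RHS](eq_bigl (fun t => (t \in A) && (t != j))); last first.
      by move=> t; rewrite !inE andbC.
    by apply: eq_bigr => t _; rewrite !scalerA scalerBl.
  have := minA _ PD (subsetDl _ _) => /setP/(_ j).
  by rewrite !inE eqxx jA.
- by exists b, (fun i => f (enum_val i)); rewrite b0 e enum.
Qed.

Section Coordinates.
Variables (n : int) (k : nat) (s : 'I_k -> F U1).
Hypothesis gb : generic_basis n s.

(** Coefficients over [W] may have poles elsewhere in [U01]; a common polynomial denominator makes
    them regular there, and restriction is injective. *)
Lemma basis_indep W (h : W `<=` U1) (c : 'I_k -> O W) :
  \sum_i c i *: res h (s i) = 0 -> forall i, c i = 0.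
Proof.
move=> c0 i; have [q [q0 qp]] := clear_denominators (fun i => Oval (c i)).
have U10 : U1 `<=` U0 C by exact: U01_sub0.
have [g eg] := mkO_poly q U10.
have /choice[d hd] : forall i, exists d : O U1, Oval d = tofrac q * Oval (c i).
  by move=> j; have [p ->] := qp j; exact: mkO_poly.
have d0 : \sum_i d i *: s i = 0.
  apply: (res_inj (@hc_qc _ F) (@hc_flat _ F) (h := h)).
  rewrite res_sum -[RHS](scaler0 _ (Ores h g)) -{2}c0 scaler_sumr.
  apply: eq_bigr => j _; rewrite resZ scalerA; congr (_ *: _).
  by apply: OvalE; rewrite OvalM /= hd eg.
have [_ indep _] := gb; have := indep d d0 i => /(congr1 (@Oval _ _))/eqP.
rewrite hd mulf_eq0 tofrac_eq0 (negPf q0) /= => /eqP e; apply: OvalE; exact: e.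
Qed.

Definition coordinates U (m : F U) (w : 'I_k -> K) : Prop :=
  exists (V : zopen C) (hU : V `<=` U) (h1 : V `<=` U1) (f : 'I_k -> O V),
    (forall i, Oval (f i) = w i) /\
    res hU (wcomp n m) = \sum_i f i *: res h1 (s i).

(** The part over the intersection with [U01] extends to [U01] after multiplication by [g], is
    expanded there, and both denominators are divided out on an open set where their inverse is
    regular. *)
Lemma coordinates_ex U (m : F U) : exists w, coordinates m w.
Proof.
pose V := capU U U1; pose hU := @capUl C U U1 : V `<=` U.
pose h1 := @capUr C U U1 : V `<=` U1; pose m0 := res hU (wcomp n m).
have wm0 : weight_space n m0 by apply: weight_res; exact: wcomp_weight.
have [g [m1 [g0 gu e1]]] := extend_section (@hc_qc _ F) h1 m0 (affine_U01 C).
have e2 : res h1 (wcomp n m1) = Ores h1 g *: m0.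
  rewrite -wcomp_res e1 (wcomp_of_weight n (k := n)) ?eqxx //; exact: weightZ.
have [_ _ /(_ _ (wcomp_weight n m1))[b [f [b0 e3]]]] := gb.
have bg0 : Oval b * Oval g != 0 by exact: (mulf_neq0 b0 g0).
have [W WV rW] := regular_open1 (Oval b * Oval g)^-1 V.
have hWU : W `<=` U by move=> x /WV/hU.
have hW1 : W `<=` U1 by move=> x /WV/h1.
pose i0 : O W := mkO rW.
exists (fun i => Oval (f i) / (Oval b * Oval g)), W, hWU, hW1,
  (fun i => Ores hW1 (f i) * i0); split; first by move=> i.
have e4 : (Ores hW1 b * Ores hW1 g) *: res WV m0 = \sum_i Ores hW1 (f i) *: res hW1 (s i).
  have := congr1 (res hW1) e3; rewrite resZ [in X in _ = X]res_sum.
  under [X in _ = X]eq_bigr do rewrite resZ.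
  move=> <-; rewrite -scalerA; congr (_ *: _).
  by rewrite -(resK h1 WV hW1) e2 resZ; congr (_ *: _); apply: OvalE.
have e5 : i0 * (Ores hW1 b * Ores hW1 g) = 1.
  by apply: OvalE; rewrite OvalM OvalM Oval1 /= mulVf //; exact: bg0.
rewrite -(resK hU WV hWU) -[LHS]scale1r -e5 -scalerA e4 scaler_sumr.
by apply: eq_bigr => i _; rewrite scalerA mulrC.
Qed.

Lemma coordinates_uniq U (m : F U) w w' : coordinates m w -> coordinates m w' -> w = w'.
Proof.
move=> [V [hU [h1 [f [ef e]]]]] [V' [hU' [h1' [f' [ef' e']]]]].
pose W := capU V V'; pose hV := @capUl C V V'; pose hV' := @capUr C V V'.
have hW1 : W `<=` U1 by move=> x /hV/h1.
have hWU : W `<=` U by move=> x /hV/hU.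
apply: funext => i; rewrite -ef -ef'; apply/eqP; rewrite -subr_eq0; apply/eqP.
have /(_ i)/(congr1 (@Oval _ _)) : forall i, Ores hV (f i) - Ores hV' (f' i) = 0.
  apply: (@basis_indep W hW1); under eq_bigr do rewrite scalerBl.
  rewrite sumrB; apply/eqP; rewrite subr_eq0; apply/eqP.
  transitivity (res hWU (wcomp n m)).
    rewrite -(resK hU hV hWU) e res_sum; apply: eq_bigr => j _.
    by rewrite resZ (resK _ _ hW1).
  rewrite -(resK hU' hV' hWU) e' res_sum; apply: eq_bigr => j _.
  by rewrite resZ (resK _ _ hW1).
by rewrite OvalB Oval0.
Qed.

Definition wcoord U (m : F U) : 'I_k -> K := projT1 (cid (coordinates_ex m)).

Lemma wcoordP U (m : F U) : coordinates m (wcoord m).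
Proof. exact: (projT2 (cid (coordinates_ex m))). Qed.

Lemma wcoordE U (m : F U) w : coordinates m w -> wcoord m = w.
Proof. exact: coordinates_uniq (wcoordP m). Qed.

Lemma wcoord_res U V (h : V `<=` U) (m : F U) : wcoord (res h m) = wcoord m.
Proof.
apply/esym/wcoordE; have [W [hW [h1 [f [ef e]]]]] := wcoordP (res h m).
have hWU : W `<=` U by move=> x /hW/h.
by exists W, hWU, h1, f; split => //; rewrite -e wcomp_res (resK _ _ hWU).
Qed.

Lemma wcoord_comp U (m : F U) : wcoord (wcomp n m) = wcoord m.
Proof.
apply: wcoordE; have [W [hW [h1 [f [ef e]]]]] := wcoordP m.
exists W, hW, h1, f; split => //.
by rewrite (wcomp_of_weight n (wcomp_weight n m)) eqxx.
Qed.

Lemma wcoord_lin U f (m m' : F U) i :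
  wcoord (f *: m + m') i = Oval f * wcoord m i + wcoord m' i.
Proof.
have [V [hU [h1 [g [eg e]]]]] := wcoordP m.
have [V' [hU' [h1' [g' [eg' e']]]]] := wcoordP m'.
pose W := capU V V'; pose hV := @capUl C V V'; pose hV' := @capUr C V V'.
have hW1 : W `<=` U1 by move=> x /hV/h1.
have hWU : W `<=` U by move=> x /hV/hU.
suff -> : wcoord (f *: m + m') = (fun i => Oval f * wcoord m i + wcoord m' i) by [].
apply: wcoordE; exists W, hWU, hW1, (fun i => Ores hWU f * Ores hV (g i) + Ores hV' (g' i)).
split=> [j|]; first by rewrite OvalD OvalM /= eg eg'.
rewrite wcomp_lin res_add resZ -(resK hU hV hWU) e -(resK hU' hV' hWU) e' !res_sum.
rewrite scaler_sumr -big_split; apply: eq_bigr => j _ /=.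
by rewrite !resZ !(resK _ _ hW1) scalerA scalerDl.
Qed.

Lemma wcoord_eq0 U (m : F U) : (forall i, wcoord m i = 0) -> wcomp n m = 0.
Proof.
move=> c0; have [V [hU [h1 [g [eg e]]]]] := wcoordP m.
apply: (res_inj (@hc_qc _ F) (@hc_flat _ F) (h := hU)).
rewrite e big1 // => i _; have -> : g i = 0 by apply: OvalE; rewrite eg c0.
by rewrite scale0r.
Qed.

Lemma wcoord_basis i j : wcoord (s i) j = (i == j)%:R.
Proof.
suff -> : wcoord (s i) = (fun j => (i == j)%:R) by [].
apply: wcoordE; exists U1, (fun x h => h), (fun x h => h), (fun j => (i == j)%:R).
split; first by move=> t; case: (i == t).
have [sw _ _] := gb.
rewrite (wcomp_of_weight n (sw i)) eqxx (bigD1 i) //= eqxx scale1r big1 ?addr0 //.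
by move=> t /negPf ti; rewrite eq_sym ti scale0r.
Qed.

Lemma wcoord_other U l (m : F U) i : weight_space l m -> l != n -> wcoord m i = 0.
Proof.
move=> wm ln; rewrite -wcoord_comp (wcomp_of_weight n wm) eq_sym (negPf ln).
have := @wcoord_lin U (-1) 0 0 i.
by rewrite scaler0 addr0 OvalN Oval1 mulN1r addNr.
Qed.

End Coordinates.
End GenericBasis.

Section LinearMaps.
Variables (A : comNzRingType) (M N : lmodType A) (f : M -> N).
Hypothesis lf : linear f.

Lemma lin_0 : f 0 = 0.
Proof. by have := lf (-1) 0 0; rewrite scaler0 addr0 scaleN1r addNr. Qed.
Lemma lin_D u v : f (u + v) = f u + f v.
Proof. by have := lf 1 u v; rewrite !scale1r. Qed.
Lemma lin_Z a u : f (a *: u) = a *: f u.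
Proof. by have := lf a u 0; rewrite lin_0 !addr0. Qed.
Lemma lin_B u v : f (u - v) = f u - f v.
Proof. by rewrite lin_D -scaleN1r lin_Z scaleN1r. Qed.
Lemma lin_sum I (s : seq I) (P : pred I) (w : I -> M) :
  f (\sum_(t <- s | P t) w t) = \sum_(t <- s | P t) f (w t).
Proof. by apply: (big_morph f) => [u v|]; [exact: lin_D|exact: lin_0]. Qed.
End LinearMaps.

(* Coordinates of F at the generic point: fe n spans the generic stalk of the
   weight n part for n in fS, and fk m n is the coordinate of m along fe n. *)
Record frame (C : numClosedFieldType) (F : hcmodule C) := Frame {
  fS : set int;
  fk : forall U : zopen C, F U -> int -> ratfun C;
  fe : int -> F (U01 C);
  fk_lin : forall (U : zopen C) f (m m' : F U) n,
    fk (f *: m + m') n = Oval f * fk m n + fk m' n;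
  fk_res : forall (U V : zopen C) (h : V `<=` U) (m : F U), fk (res h m) = fk m;
  fk_wcomp : forall (U : zopen C) (m : F U) n, fk (wcomp n m) n = fk m n;
  fk_other : forall (U : zopen C) (m : F U) l n, weight_space l m -> l != n -> fk m n = 0;
  fk_eq0 : forall (U : zopen C) (m : F U), (forall n, fk m n = 0) -> m = 0;
  fe_weight : forall n, weight_space n (fe n);
  fe_in : forall n, fS n -> fk (fe n) n = 1;
  fk_out : forall (U : zopen C) (m : F U) n, ~ fS n -> fk m n = 0;
  fk_expand : forall (U : zopen C) (m : F U) n, weight_space n m ->
    exists (W : zopen C) (hU : W `<=` U) (h1 : W `<=` U01 C) (f : O W),
      Oval f = fk m n /\ res hU m = f *: res h1 (fe n) }.

Section Frames.
Variables (C : numClosedFieldType) (F : hcmodule C) (fr : frame F).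
Local Notation U1 := (U01 C).
Local Notation K := (ratfun C).
Implicit Types (U W : zopen C).

Definition fa n : K := fk fr (gact (secX C) (fe fr n)) (n + 2).
Definition fb n : K := fk fr (gact (secY C) (fe fr n)) (n - 2).

Lemma fk0 U n : fk fr (0 : F U) n = 0.
Proof.
have := fk_lin fr (-1) (0 : F U) 0 n.
by rewrite scaler0 addr0 OvalN Oval1 mulN1r addNr.
Qed.
Lemma fkD U (m m' : F U) n : fk fr (m + m') n = fk fr m n + fk fr m' n.
Proof. by have := fk_lin fr 1 m m' n; rewrite scale1r Oval1 mul1r. Qed.
Lemma fkZ U f (m : F U) n : fk fr (f *: m) n = Oval f * fk fr m n.
Proof. by rewrite -[f *: m]addr0 fk_lin fk0 addr0. Qed.
Lemma fkB U (m m' : F U) n : fk fr (m - m') n = fk fr m n - fk fr m' n.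
Proof. by rewrite addrC -scaleN1r fk_lin OvalN Oval1 mulN1r addrC. Qed.
Lemma fk_sum U I (s : seq I) (P : pred I) (w : I -> F U) n :
  fk fr (\sum_(t <- s | P t) w t) n = \sum_(t <- s | P t) fk fr (w t) n.
Proof. by apply: (big_morph (fun m => fk fr m n)) => [u v|]; [exact: fkD|exact: fk0]. Qed.

Lemma fk_inj U (m m' : F U) : (forall n, fk fr m n = fk fr m' n) -> m = m'.
Proof.
move=> e; apply/eqP; rewrite -subr_eq0; apply/eqP/(@fk_eq0 _ _ fr) => n.
by rewrite fkB e subrr.
Qed.

(** Only the weight [n] component of [m] contributes, and near the generic point it is a multiple of
    [fe n]. *)
Lemma fk_shift xi k W (m : F W) n : gsec U1 xi -> W `<=` U1 ->
  (forall U l (m' : F U), U `<=` U1 -> weight_space l m' -> weight_space (l + k) (gact xi m')) ->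
  fk fr (gact xi m) (n + k) = fk fr (gact xi (fe fr n)) (n + k) * fk fr m n.
Proof.
move=> g hW hw; have gW : gsec W xi by exact: gsec_sub hW g.
have -> : fk fr (gact xi m) (n + k) = fk fr (gact xi (wcomp n m)) (n + k).
  have key l : fk fr (gact xi (wcomp l m)) (n + k) =
      if l == n then fk fr (gact xi (wcomp n m)) (n + k) else 0.
    case: eqP => [->//|/eqP ln].
    by apply: fk_other (hw _ _ _ hW (wcomp_weight l m)) _; rewrite (inj_eq (addIr k)).
  rewrite {1}[m]wcomp_sum gact_sum // fk_sum.
  rewrite (eq_bigr _ (fun l _ => key l)) -big_mkcond /= (sum_pick (fun=> _)) ?undup_uniq //.
  case: ifP => // /negbT nw; rewrite (wcomp_uniq (undup_uniq (map fst (wseq m))) _ (wcomp_sum m)).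
    by rewrite ifN // gact0 // fk0.
  by move=> i _; exact: wcomp_weight.
have [W' [hU [h1 [f [ef e]]]]] := fk_expand fr (wcomp_weight n m).
rewrite -(fk_res fr hU) gact_res // e gactZ; last exact: gsec_sub h1 g.
rewrite fkZ -gact_res // fk_res mulrC; congr (_ * _).
by rewrite ef fk_wcomp.
Qed.

Lemma fk_gactX W (m : F W) n : W `<=` U1 ->
  fk fr (gact (secX C) m) (n + 2) = fa n * fk fr m n.
Proof.
move=> hW; apply: fk_shift => //; first exact: gsec01X.
by move=> U l m' hU; exact: gactX_weight.
Qed.

Lemma fk_gactY W (m : F W) n : W `<=` U1 ->
  fk fr (gact (secY C) m) (n - 2) = fb n * fk fr m n.
Proof.
move=> hW; apply: fk_shift => //; first exact: gsec01Y.
by move=> U l m' hU; exact: gactY_weight.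
Qed.

Lemma fk_gactH U (m : F U) n : fk fr (gact (secH C) m) n = n%:~R * fk fr m n.
Proof.
have key l : fk fr (gact (secH C) (wcomp l m)) n =
    if l == n then n%:~R * fk fr m n else 0.
  rewrite (gactH_weight (wcomp_weight l m)).
  rewrite -scaler_int; have -> : (l%:~R : O U) = Oconst U l%:~R by rewrite rmorph_int.
  rewrite fkZ /= rmorph_int; case: eqP => [->|/eqP ln]; first by rewrite fk_wcomp.
  by rewrite (fk_other _ (wcomp_weight l m) ln) mulr0.
rewrite {1}[m]wcomp_sum gact_sum; last exact: gsecH.
rewrite fk_sum (eq_bigr _ (fun l _ => key l)) -big_mkcond /= (sum_pick (fun=> _)) ?undup_uniq //.
case: ifP => // /negbT nw; rewrite -fk_wcomp.
rewrite (wcomp_uniq (undup_uniq (map fst (wseq m))) _ (wcomp_sum m)).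
  by rewrite ifN // fk0 mulr0.
by move=> i _; exact: wcomp_weight.
Qed.

Definition arrow_closed (A : set int) : Prop :=
  (forall n, A n -> fa n <> 0 -> A (n + 2)) /\ (forall n, A n -> fb n <> 0 -> A (n - 2)).

(** The graph on the weights whose arrows are the nonzero matrix coefficients of X and Y is nonempty
    and strongly connected. *)
Definition frame_irreducible : Prop :=
  (exists n, fS fr n) /\
  forall A, arrow_closed A -> (exists2 n, fS fr n & A n) -> forall n, fS fr n -> A n.

End Frames.

Lemma sum_ord_le1 (M : nmodType) r (f : 'I_r -> M) i : (r <= 1)%N -> \sum_l f l = f i.
Proof.
move=> r1; rewrite (bigD1 i) //= big1 ?addr0 // => l; rewrite -val_eqE /= => li.
by have := ltn_ord l; have := ltn_ord i; lia.
Qed.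

Section GenericFiber.
Variables (C : numClosedFieldType) (kk : closedFieldType).
Variables (iota : {rmorphism ratfun C -> kk}) (F : hcmodule C).
Hypothesis qa : quasi_admissible F.
Local Notation K := (ratfun C).
Local Notation z := (zfun C).
Local Notation U1 := (U01 C).
Variables (V : lmodType kk) (j : forall U : zopen C, F U -> V).
Variable rho : mxpair kk -> V -> V.
Hypotheses (fib : is_generic_fiber iota j) (rep : lie_rep (generic_lie iota) rho).
Hypothesis compat : forall (U : zopen C) xi (m : F U), gsec U xi ->
  rho (mpmap iota xi) (j m) = j (gact xi m).
Hypothesis irr : irreducible_rep (generic_lie iota) rho.
Implicit Types (U W : zopen C).

Definition basis_data n : {k : nat & {s : 'I_k -> F U1 | generic_basis n s}}.
Proof.
have /cid[k /cid[s gs]] := exists_generic_basis (qa n).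
by exists k, s.
Qed.

Definition rk n := projT1 (basis_data n).
Definition bas n : 'I_(rk n) -> F U1 := sval (projT2 (basis_data n)).
Lemma basP n : generic_basis n (@bas n). Proof. exact: (svalP (projT2 (basis_data n))). Qed.
Definition crd n U (m : F U) : 'I_(rk n) -> K := wcoord (basP n) m.

Arguments crd n {U} m.

Lemma j_lin U (f : O U) (m m' : F U) : j (f *: m + m') = iota (Oval f) *: j m + j m'.
Proof. by case: fib => -[h _] _; exact: h. Qed.
Lemma j_res U W (h : W `<=` U) (m : F U) : j (res h m) = j m.
Proof. by case: fib => -[_ h1] _; exact: h1. Qed.
Lemma j0 U : j (0 : F U) = 0.
Proof. by have := @j_lin U (-1) 0 0; rewrite scaler0 addr0 OvalN Oval1 rmorphN rmorph1 scaleN1r addNr. Qed.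
Lemma jD U (m m' : F U) : j (m + m') = j m + j m'.
Proof. by have := j_lin 1 m m'; rewrite Oval1 rmorph1 !scale1r. Qed.
Lemma jZ U (f : O U) (m : F U) : j (f *: m) = iota (Oval f) *: j m.
Proof. by rewrite -[f *: m]addr0 j_lin j0 addr0. Qed.
Lemma j_sum U I (s : seq I) (P : pred I) (w : I -> F U) :
  j (\sum_(t <- s | P t) w t) = \sum_(t <- s | P t) j (w t).
Proof. by apply: (big_morph (@j U)) => [u v|]; [exact: jD|exact: j0]. Qed.

(** The uniqueness half of the universal property: the vectors [j m] determine a linear map. *)
Lemma lin_ext (W : lmodType kk) (f g : V -> W) : linear f -> linear g ->
  (forall U (m : F U), f (j m) = g (j m)) -> f = g.
Proof.
move=> lf lg fg; case: fib => _ /(_ W (fun U m => f (j m))) [].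
  split=> [U a m m'|U U' h m]; last by rewrite j_res.
  by rewrite j_lin lf.
move=> h [_ hu]; rewrite -[LHS]hu; last by split.
by apply: hu; split.
Qed.

(** The existence half of the universal property, applied to a coordinate at the generic point. *)
Lemma functional_ex n i : exists h : V -> kk^o,
  linear h /\ forall U (m : F U), h (j m) = iota (crd n m i).
Proof.
case: fib => _ /(_ kk^o (fun U m => iota (crd n m i))) [].
  split=> [U f m m'|U W h m]; last by rewrite /crd wcoord_res.
  by rewrite /crd wcoord_lin rmorphD rmorphM.
by move=> h [[lh hj] _]; exists h.
Qed.

Definition fct n (i : 'I_(rk n)) : V -> kk^o := projT1 (cid (functional_ex i)).
Lemma fct_lin n i : linear (@fct n i).
Proof. by case: (projT2 (cid (functional_ex i))). Qed.
Lemma fctE n i U (m : F U) : fct i (j m) = iota (crd n m i).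
Proof. by case: (projT2 (cid (functional_ex i))) => _; exact. Qed.

Local Notation t := (iota z).
Local Notation gelk := (@gelt kk t t^-1).

Lemma t_neq0 : t != 0.
Proof. by rewrite fmorph_eq0 zfun_neq0. Qed.

Lemma generic_lieP xi : generic_lie iota xi <-> exists h x y, xi = gelk h x y.
Proof.
split=> [[a [b [c ->]]]|[h [x [y ->]]]].
  exists a, b, (t * c); rewrite /gelt !mul1r [t * c]mulrC mulfK ?t_neq0 //.
  by rewrite [b * t]mulrC.
exists h, x, (y / t); rewrite !mul1r [t * (y / t)]mulrC divfK ?t_neq0 //.
by rewrite /gelt [x * t]mulrC.
Qed.

Lemma generic_gelt h x y : generic_lie iota (gelk h x y).
Proof. by apply/generic_lieP; exists h, x, y. Qed.

Definition rH := rho (gelk 1 0 0).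
Definition rX := rho (gelk 0 1 0).
Definition rY := rho (gelk 0 0 1).

Lemma rho_lin xi : generic_lie iota xi -> linear (rho xi).
Proof. by case: rep => h _ _; exact: h. Qed.
Lemma rH_lin : linear rH. Proof. exact/rho_lin/generic_gelt. Qed.
Lemma rX_lin : linear rX. Proof. exact/rho_lin/generic_gelt. Qed.
Lemma rY_lin : linear rY. Proof. exact/rho_lin/generic_gelt. Qed.

Lemma rho_gelt h x y v : rho (gelk h x y) v = h *: rH v + (x *: rX v + y *: rY v).
Proof.
case: rep => _ hl _.
have e0 : rho (gelk 0 0 0) v = 0.
  have := hl (-1) _ _ v (generic_gelt 0 0 0) (generic_gelt 0 0 0).
  by rewrite gelt_lin mulr0 addr0 scaleN1r addNr.
have -> : gelk h x y = h *: gelk 1 0 0 + gelk 0 x y.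
  by rewrite gelt_lin; congr gelt; rewrite ?mulr1 ?mulr0 ?addr0 ?add0r.
rewrite hl; try exact: generic_gelt; congr (_ + _).
have -> : gelk 0 x y = x *: gelk 0 1 0 + gelk 0 0 y.
  by rewrite gelt_lin; congr gelt; rewrite ?mulr1 ?mulr0 ?addr0 ?add0r.
rewrite hl; try exact: generic_gelt; congr (_ + _).
have -> : gelk 0 0 y = y *: gelk 0 0 1 + gelk 0 0 0.
  by rewrite gelt_lin; congr gelt; rewrite ?mulr1 ?mulr0 ?addr0 ?add0r.
by rewrite hl ?e0 ?addr0 //; exact: generic_gelt.
Qed.

Lemma ttV : t * t^-1 = 1. Proof. by rewrite divff ?t_neq0. Qed.

Lemma rHX v : rH (rX v) = rX (rH v) + rX v *+ 2.
Proof.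
case: rep => _ _ hb; have := hb _ _ v (generic_gelt 1 0 0) (generic_gelt 0 1 0).
rewrite (bracket_gelt _ _ _ _ _ _ ttV) !(mul0r, mulr0, mul1r, mulr1, subr0, sub0r, mul0rn).
rewrite rho_gelt !scale0r add0r addr0 scaler_nat -[rho (gelk 1 0 0)]/rH -[rho (gelk 0 1 0)]/rX.
by move=> ->; rewrite addrC subrK.
Qed.

Lemma rHY v : rH (rY v) = rY (rH v) - rY v *+ 2.
Proof.
case: rep => _ _ hb; have := hb _ _ v (generic_gelt 1 0 0) (generic_gelt 0 0 1).
rewrite (bracket_gelt _ _ _ _ _ _ ttV) !(mul0r, mulr0, mul1r, mulr1, subr0, sub0r, mul0rn).
rewrite oppr0 mul0rn rho_gelt !scale0r !add0r mulNrn scaleNr scaler_nat -[rho (gelk 1 0 0)]/rH -[rho (gelk 0 0 1)]/rY.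
by move=> ->; rewrite addrC subrK.
Qed.

Lemma rXY v : rX (rY v) = rY (rX v) + rH v.
Proof.
case: rep => _ _ hb; have := hb _ _ v (generic_gelt 0 1 0) (generic_gelt 0 0 1).
rewrite (bracket_gelt _ _ _ _ _ _ ttV) !(mul0r, mulr0, mul1r, mulr1, subr0, sub0r, mul0rn, oppr0).
rewrite rho_gelt !scale0r !addr0 scale1r -[rho (gelk 0 1 0)]/rX -[rho (gelk 0 0 1)]/rY.
by move=> ->; rewrite addrC subrK.
Qed.

Lemma rXj U (m : F U) : U `<=` U1 -> rX (j m) = j (gact (secX C) m).
Proof.
by move=> h; rewrite -compat; [rewrite secX_gelt mpmap_gelt !rmorph0 rmorph1|exact: gsec01X].
Qed.
Lemma rYj U (m : F U) : U `<=` U1 -> rY (j m) = j (gact (secY C) m).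
Proof.
by move=> h; rewrite -compat; [rewrite secY_gelt mpmap_gelt !rmorph0 rmorph1|exact: gsec01Y].
Qed.
Lemma rHj U (m : F U) : rH (j m) = j (gact (secH C) m).
Proof.
by rewrite -compat; [rewrite secH_gelt mpmap_gelt !rmorph0 rmorph1|exact: gsecH].
Qed.

Definition stable (P : set V) := [/\ forall v, P v -> P (rH v), forall v, P v -> P (rX v) &
  forall v, P v -> P (rY v)].

Lemma irr_stable P : subspace P -> stable P -> (exists2 v, P v & v <> 0) -> forall v, P v.
Proof.
move=> sP [PH PX PY] [v0 Pv0 v00]; case: irr => _ /(_ P sP)[].
- move=> xi v /generic_lieP[h [x [y ->]]] Pv; rewrite rho_gelt.
  have [P0 Pl] := sP; apply: (Pl); first exact: PH.
  apply: (Pl); first exact: PX.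
  by rewrite -[_ *: _]addr0; apply: Pl => //; exact: PY.
- by move=> e; case: v00; move: Pv0; rewrite e.
- by move=> -> v.
Qed.

Lemma j_coord U n (m : F U) : weight_space n m -> j m = \sum_i iota (crd n m i) *: j (bas i).
Proof.
move=> wm; have [W [hU [h1 [f [ef e]]]]] := wcoordP (basP n) m.
rewrite -(j_res hU) -[m in LHS](_ : wcomp n m = m); last by rewrite (wcomp_of_weight n wm) eqxx.
by rewrite e j_sum; apply: eq_bigr => i _; rewrite jZ j_res ef.
Qed.

(** * Multiplicity one of the weights *)

Section RankOne.
Variable n : int.
Hypothesis rk0 : (0 < rk n)%N.

Let A : 'M[kk]_(rk n) :=
  \matrix_(i, l) iota (crd n (gact (secY C) (gact (secX C) (bas i))) l).

(** The positive rank makes the characteristic polynomial nonconstant, and [kk] is algebraically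
    closed. *)
Lemma YX_eigen : exists (w : 'rV[kk]_(rk n)) (c : kk), w != 0 /\ w *m A = c *: w.
Proof.
have /closed_rootP[c rc] : size (char_poly A) != 1%N by rewrite size_char_poly eqSS -lt0n.
have /eigenvalueP[w e w0] : eigenvalue A c by rewrite eigenvalue_root_char.
by exists w, c.
Qed.

Variables (w : 'rV[kk]_(rk n)) (c : kk).
Hypotheses (w0 : w != 0) (wA : w *m A = c *: w).

Definition v0 : V := \sum_i w 0 i *: j (bas i).

Lemma rH_v0 : rH v0 = n%:~R *: v0.
Proof.
rewrite /v0 (lin_sum rH_lin) scaler_sumr; apply: eq_bigr => i _.
have [sw _ _] := basP n.
rewrite (lin_Z rH_lin) rHj (gactH_weight (sw i)) !scalerA mulrC -scalerA; congr (_ *: _).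
rewrite -scaler_int; have -> : (n%:~R : O U1) = Oconst U1 n%:~R by rewrite rmorph_int.
by rewrite jZ /= !rmorph_int.
Qed.

Lemma rYX_v0 : rY (rX v0) = c *: v0.
Proof.
rewrite /v0 (lin_sum rX_lin) (lin_sum rY_lin).
have [sw _ _] := basP n.
have h1 : U1 `<=` U1 by [].
transitivity (\sum_i \sum_l (w 0 i * A i l) *: j (@bas n l)).
  apply: eq_bigr => i _; rewrite (lin_Z rX_lin) (lin_Z rY_lin) rXj // rYj //.
  rewrite (@j_coord _ n); last first.
    have := gactY_weight h1 (gactX_weight h1 (sw i)).
    by rewrite addrK.
  by rewrite scaler_sumr; apply: eq_bigr => l _; rewrite scalerA mxE.
rewrite exchange_big scaler_sumr; apply: eq_bigr => l _ /=.
rewrite -scaler_suml scalerA; congr (_ *: _).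
by have /rowP/(_ l) := wA; rewrite !mxE.
Qed.

Lemma rH_X k : rH (iter k rX v0) = (n + 2 * k%:Z)%:~R *: iter k rX v0.
Proof.
elim: k => [|k IH] /=; first by rewrite mulr0 addr0 rH_v0.
rewrite rHX IH (lin_Z rX_lin) -scaler_nat -scalerDl; congr (_ *: _).
transitivity ((n + 2 * k%:Z)%:~R + 2%:~R : kk); first by [].
by rewrite -intrD; congr _%:~R; lia.
Qed.

Lemma rH_Y k : rH (iter k rY v0) = (n - 2 * k%:Z)%:~R *: iter k rY v0.
Proof.
elim: k => [|k IH] /=; first by rewrite mulr0 subr0 rH_v0.
rewrite rHY IH (lin_Z rY_lin) -scaler_nat -scalerBl; congr (_ *: _).
transitivity ((n - 2 * k%:Z)%:~R - 2%:~R : kk); first by [].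
by rewrite -intrB; congr _%:~R; lia.
Qed.

(** By [X, Y] = H, moving Y past one more X changes the scalar by the eigenvalue of H. *)
Lemma rY_X k : exists d, rY (iter k.+1 rX v0) = d *: iter k rX v0.
Proof.
elim: k => [|k [d IH]]; first by exists c; rewrite /= rYX_v0.
exists (d - (n + 2 * k.+1%:Z)%:~R); rewrite (iterS k.+1).
have := rXY (iter k.+1 rX v0); rewrite IH rH_X (lin_Z rX_lin) -iterS => /eqP.
by rewrite -subr_eq -scalerBl => /eqP <-.
Qed.

Lemma rX_Y k : exists d, rX (iter k.+1 rY v0) = d *: iter k rY v0.
Proof.
elim: k => [|k [d IH]]; first by exists (c + n%:~R); rewrite /= rXY rYX_v0 rH_v0 scalerDl.
exists (d + (n - 2 * k.+1%:Z)%:~R); rewrite (iterS k.+1).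
by rewrite rXY IH rH_Y (lin_Z rY_lin) -iterS scalerDl.
Qed.

(** The span of all X^k v0 and Y^k v0, encoded as the intersection of the subspaces containing
    them. *)
Definition cyc : set V := [set v | forall Q : set V, subspace Q ->
  (forall k, Q (iter k rX v0)) -> (forall k, Q (iter k rY v0)) -> Q v].

Lemma cyc_sub : subspace cyc.
Proof.
split=> [Q [Q0 _] _ _ //|a u v hu hv Q sQ QX QY].
by case: (sQ) => _; apply; [exact: hu|exact: hv].
Qed.

Lemma preim_sub (f : V -> V) P : linear f -> subspace P -> subspace [set v | P (f v)].
Proof.
move=> lf [P0 Pl]; split=> [|a u v /= hu hv]; first by rewrite /= (lin_0 lf).
by rewrite lf; exact: Pl.
Qed.

Lemma cyc_Z a v : cyc v -> cyc (a *: v).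
Proof. by move=> h; have [c0 cl] := cyc_sub; rewrite -[_ *: _]addr0; exact: cl. Qed.

Lemma cyc_stable : stable cyc.
Proof.
have gX k : cyc (iter k rX v0) by move=> Q _ h _; exact: h.
have gY k : cyc (iter k rY v0) by move=> Q _ _; exact.
split=> v cv.
- apply: (cv [set v | cyc (rH v)]); first exact: preim_sub rH_lin cyc_sub.
    by move=> k; rewrite /= rH_X; exact: cyc_Z.
  by move=> k; rewrite /= rH_Y; exact: cyc_Z.
- apply: (cv [set v | cyc (rX v)]); first exact: preim_sub rX_lin cyc_sub.
    by move=> k; exact: (gX k.+1).
  case=> [|k]; first exact: (gX 1%N).
  by have [d e] := rX_Y k; rewrite /mkset e; exact: cyc_Z.
- apply: (cv [set v | cyc (rY v)]); first exact: preim_sub rY_lin cyc_sub.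
    case=> [|k]; first exact: (gY 1%N).
    by have [d e] := rY_X k; rewrite /mkset e; exact: cyc_Z.
  by move=> k; exact: (gY k.+1).
Qed.

Lemma fct_v0 i : fct i v0 = w 0 i.
Proof.
rewrite /v0 (lin_sum (fct_lin i)) (bigD1 i) //= big1 ?addr0 => [|l li].
  by rewrite (lin_Z (fct_lin i)) fctE /crd wcoord_basis eqxx rmorph1 /= [LHS]mulr1.
by rewrite (lin_Z (fct_lin i)) fctE /crd wcoord_basis (negPf li) rmorph0 scaler0.
Qed.

Lemma v0_neq0 : v0 <> 0.
Proof.
move=> e; case/eqP: w0; apply/rowP => i; rewrite mxE -fct_v0 e.
exact: (lin_0 (fct_lin i)).
Qed.

Lemma fct_X k i : fct (n := n) i (iter k.+1 rX v0) = 0.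
Proof.
have h1 : U1 `<=` U1 by [].
have [sw _ _] := basP n.
pose m l := iter k.+1 (gact (secX C)) (@bas n l).
have wm l p : weight_space (n + 2 * p%:Z) (iter p (gact (secX C)) (@bas n l)).
  elim: p => [|p IH] /=; first by rewrite mulr0 addr0.
  by rewrite (_ : n + _ = n + 2 * p%:Z + 2); [exact: gactX_weight|lia].
have -> : iter k.+1 rX v0 = \sum_l w 0 l *: j (m l).
  rewrite /m; elim: k.+1 => [//|p IH]; rewrite iterS IH (lin_sum rX_lin).
  by apply: eq_bigr => l _; rewrite (lin_Z rX_lin) rXj.
rewrite (lin_sum (fct_lin i)) big1 // => l _.
rewrite (lin_Z (fct_lin i)) fctE /crd (wcoord_other _ _ (wm l k.+1)) ?rmorph0 ?scaler0 //.
by lia.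
Qed.

Lemma fct_Y k i : fct (n := n) i (iter k.+1 rY v0) = 0.
Proof.
have h1 : U1 `<=` U1 by [].
have [sw _ _] := basP n.
pose m l := iter k.+1 (gact (secY C)) (@bas n l).
have wm l p : weight_space (n - 2 * p%:Z) (iter p (gact (secY C)) (@bas n l)).
  elim: p => [|p IH] /=; first by rewrite mulr0 subr0.
  by rewrite (_ : n - _ = n - 2 * p%:Z - 2); [exact: gactY_weight|lia].
have -> : iter k.+1 rY v0 = \sum_l w 0 l *: j (m l).
  rewrite /m; elim: k.+1 => [//|p IH]; rewrite iterS IH (lin_sum rY_lin).
  by apply: eq_bigr => l _; rewrite (lin_Z rY_lin) rYj.
rewrite (lin_sum (fct_lin i)) big1 // => l _.
rewrite (lin_Z (fct_lin i)) fctE /crd (wcoord_other _ _ (wm l k.+1)) ?rmorph0 ?scaler0 //.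
by lia.
Qed.

(** By irreducibility [cyc] is everything, and its spanning vectors other than [v0] have no
    coordinates in weight [n]. So the weight [n] coordinates of every vector are proportional to
    [w]; with two basis vectors this would force w = 0. *)
Lemma rk_le1_aux : (rk n <= 1)%N.
Proof.
rewrite leqNgt; apply/negP => rk2.
have all_cyc : forall v, cyc v.
  apply: irr_stable cyc_sub cyc_stable _; exists v0; last exact: v0_neq0.
  by move=> Q _ /(_ 0%N).
have key a b : a != b -> w 0 b = 0.
  (* [Q] is proportionality of the coordinates [a] and [b] to those of [w]; on the basis vector [a]
     it reads w b = 0. *)
  move=> ab; pose Q : set V := [set v | w 0 b * fct (n := n) a v = w 0 a * fct b v].
  have sQ : subspace Q.
    split=> [|e u v /= hu hv]; first by rewrite /Q /= !(lin_0 (fct_lin _)) !mulr0.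
    rewrite /Q /= (fct_lin a e u v) (fct_lin b e u v) !mulrDr hv; congr (_ + _).
    by rewrite [LHS]mulrCA [RHS]mulrCA; congr (_ * _); exact: hu.
  have : Q (j (bas a)).
    apply: all_cyc => // -[|k]; rewrite /Q /= ?fct_v0; try by rewrite mulrC.
      by rewrite -iterS !fct_X !mulr0.
    by rewrite -iterS !fct_Y !mulr0.
  rewrite /Q /= !fctE /crd !wcoord_basis eqxx (negPf ab) rmorph1 rmorph0.
  by rewrite mulr1 mulr0.
case/eqP: w0; apply/rowP => b; rewrite mxE.
have [a ab] : exists a : 'I_(rk n), a != b.
  have [e|ne] := eqVneq b (Ordinal rk0); last by exists (Ordinal rk0); rewrite eq_sym.
  by exists (Ordinal rk2); rewrite e -val_eqE.
exact: key ab.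
Qed.

End RankOne.

Lemma rk_le1 n : (rk n <= 1)%N.
Proof.
case: (posnP (rk n)) => [->//|rk0].
have [w [c [w0 wA]]] := YX_eigen rk0.
exact: rk_le1_aux w0 wA.
Qed.

(** The index set has at most one element, so the sum is the coordinate, or 0 in rank zero, without
    a case distinction. *)
Definition kap U (m : F U) n : K := \sum_i crd n m i.
Definition eps n : F U1 := \sum_i @bas n i.

Lemma kapE U (m : F U) n i : kap m n = crd n m i.
Proof. exact: sum_ord_le1 (rk_le1 n). Qed.

Lemma epsE n i : eps n = @bas n i.
Proof. exact: sum_ord_le1 (rk_le1 n). Qed.

Lemma eps_weight n : weight_space n (eps n).
Proof.
have [sw _ _] := basP n; rewrite /eps; elim/big_ind : _ => //; first exact: weight0.
by move=> u v; exact: weightD.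
Qed.

Lemma kap_eq0 U (m : F U) : (forall n, kap m n = 0) -> m = 0.
Proof.
move=> m0; rewrite [m]wcomp_sum big1 // => n _.
by apply: (wcoord_eq0 (gb := basP n)) => i; rewrite -(m0 n) (kapE m i).
Qed.

Lemma kap_expand U (m : F U) n : weight_space n m ->
  exists (W : zopen C) (hU : W `<=` U) (h1 : W `<=` U01 C) (f : O W),
      Oval f = kap m n /\ res hU m = f *: res h1 (eps n).
Proof.
move=> wm; have [W [hU [h1 [f [ef e]]]]] := wcoordP (basP n) m.
exists W, hU, h1, (\sum_i f i); split.
  have [e0|/card_gt0P[i _]] := posnP #|'I_(rk n)|.
    have nil i : i \notin 'I_(rk n) by rewrite (card0_eq e0).
    by rewrite /kap !big1 // => i; have := nil i.
  by rewrite (kapE m i) (sum_ord_le1 _ i (rk_le1 n)) ef.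
rewrite (wcomp_of_weight n wm) eqxx in e; rewrite e.
have [e0|/card_gt0P[i _]] := posnP #|'I_(rk n)|.
  have nil i : i \notin 'I_(rk n) by rewrite (card0_eq e0).
  by rewrite !big1 ?scale0r // => i; have := nil i.
by rewrite !(sum_ord_le1 _ i (rk_le1 n)) -(epsE i).
Qed.

Definition generic_frame : frame F.
Proof.
refine (@Frame _ F [set n | rk n = 1%N] kap eps _ _ _ _ kap_eq0 eps_weight _ _ kap_expand).
- move=> U f m m' n; rewrite /kap mulr_sumr -big_split; apply: eq_bigr => i _.
  exact: wcoord_lin.
- move=> U W h m; apply: funext => n; apply: eq_bigr => i _; by rewrite /crd wcoord_res.
- by move=> U m n; apply: eq_bigr => i _; rewrite /crd wcoord_comp.
- by move=> U m l n wm ln; rewrite /kap big1 // => i _; exact: wcoord_other wm ln.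
- move=> n /= rn; have i : 'I_(rk n) by rewrite rn; exact: ord0.
  by rewrite (kapE _ i) (epsE i) /crd wcoord_basis eqxx.
- move=> U m n /= rn; rewrite /kap big1 // => i _; case: rn.
  by apply/eqP; rewrite eqn_leq rk_le1 (leq_ltn_trans _ (ltn_ord i)).
Defined.

Definition kapfct n : V -> kk^o := fun v => \sum_i @fct n i v.

Lemma kapfct_lin n : linear (kapfct n).
Proof.
move=> a u v; rewrite /kapfct scaler_sumr -big_split; apply: eq_bigr => i _.
exact: fct_lin.
Qed.

Lemma kapfctE n U (m : F U) : kapfct n (j m) = iota (kap m n).
Proof. by rewrite /kapfct /kap rmorph_sum; apply: eq_bigr => i _; rewrite fctE. Qed.

Lemma kapfct_rX n v : kapfct (n + 2) (rX v) = iota (fa generic_frame n) * kapfct n v.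
Proof.
have l1 : linear (fun v => kapfct (n + 2) (rX v)).
  by move=> a u w; rewrite rX_lin kapfct_lin.
have l2 : linear (fun v => iota (fa generic_frame n) * kapfct n v : kk^o).
  by move=> a u w; rewrite kapfct_lin mulrDr [LHS]/(_ * (a * _) + _) mulrCA.
have := lin_ext l1 l2; move=> /(_ _)/(congr1 (fun f => f v)); apply => U m.
have h1 := @capUr C U U1.
rewrite -(j_res (@capUl C U U1)) rXj // !kapfctE -rmorphM; congr (iota _).
exact: (fk_gactX generic_frame).
Qed.

Lemma kapfct_rY n v : kapfct (n - 2) (rY v) = iota (fb generic_frame n) * kapfct n v.
Proof.
have l1 : linear (fun v => kapfct (n - 2) (rY v)).
  by move=> a u w; rewrite rY_lin kapfct_lin.
have l2 : linear (fun v => iota (fb generic_frame n) * kapfct n v : kk^o).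
  by move=> a u w; rewrite kapfct_lin mulrDr [LHS]/(_ * (a * _) + _) mulrCA.
have := lin_ext l1 l2; move=> /(_ _)/(congr1 (fun f => f v)); apply => U m.
have h1 := @capUr C U U1.
rewrite -(j_res (@capUl C U U1)) rYj // !kapfctE -rmorphM; congr (iota _).
exact: (fk_gactY generic_frame).
Qed.

Lemma kapfct_rH n v : kapfct n (rH v) = n%:~R * kapfct n v.
Proof.
have l1 : linear (fun v => kapfct n (rH v)).
  by move=> a u w; rewrite rH_lin kapfct_lin.
have l2 : linear (fun v => n%:~R * kapfct n v : kk^o).
  by move=> a u w; rewrite kapfct_lin mulrDr [LHS]/(_ * (a * _) + _) mulrCA.
have := lin_ext l1 l2; move=> /(_ _)/(congr1 (fun f => f v)); apply => U m.
rewrite rHj !kapfctE -(rmorph_int iota) -rmorphM; congr (iota _).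
exact: (fk_gactH generic_frame).
Qed.

(** For a set [A] of weights closed under the arrows, the vectors with coordinates vanishing outside
    [A] form a stable subspace. *)
Lemma generic_frame_irreducible : frame_irreducible generic_frame.
Proof.
split.
  (* Without weights every section is zero; the identity and the zero map of [V] then agree on all
     [j m]. *)
  apply: contrapT => nS; case: irr => -[v v0] _; apply: v0.
  have k0 U (m : F U) : m = 0.
    by apply: kap_eq0 => n; rewrite -[LHS]/(fk generic_frame m n) fk_out // => Sn; apply: nS; exists n.
  have lid : linear (fun v : V => v) by [].
  have l0 : linear (fun v : V => 0 : V) by move=> a u w; rewrite scaler0 addr0.
  have := lin_ext lid l0; move=> /(_ _)/(congr1 (fun f => f v)); apply => U m.
  by rewrite (k0 U m) j0.
move=> A [AX AY] [n0 Sn0 An0] n Sn; apply: contrapT => nAn.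
pose P : set V := [set v | forall l, ~ A l -> kapfct l v = 0].
have k_eps l : fS generic_frame l -> kapfct l (j (eps l)) = 1.
  by move=> Sl; rewrite kapfctE -[kap _ _]/(fk generic_frame (fe generic_frame l) l) fe_in // rmorph1.
have P1 : forall v, P v.
  apply: irr_stable.
  - split=> [l _|a u v hu hv l nA]; first exact: (lin_0 (kapfct_lin l)).
    by rewrite kapfct_lin hu // hv // scaler0 addr0.
  - split=> v hv l nA.
    + by rewrite kapfct_rH hv // mulr0.
    + have := kapfct_rX (l - 2) v; rewrite subrK => ->.
      have [Al|nAl] := pselect (A (l - 2)); last by rewrite hv // mulr0.
      have -> : fa generic_frame (l - 2) = 0.
        by apply: contrapT => /(AX _ Al); rewrite subrK.
      by rewrite rmorph0 mul0r.
    + have := kapfct_rY (l + 2) v; rewrite addrK => ->.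
      have [Al|nAl] := pselect (A (l + 2)); last by rewrite hv // mulr0.
      have -> : fb generic_frame (l + 2) = 0.
        by apply: contrapT => /(AY _ Al); rewrite addrK.
      by rewrite rmorph0 mul0r.
  - exists (j (eps n0)).
      move=> l nA; rewrite kapfctE -[kap _ _]/(fk generic_frame (eps n0) l).
      rewrite (@fk_other _ _ generic_frame _ _ n0) ?rmorph0 //.
        exact: eps_weight.
      by apply/eqP => e; apply: nA; rewrite -e.
    move=> e; have := k_eps _ Sn0; rewrite e (lin_0 (kapfct_lin n0)) => /esym/eqP.
    by rewrite oner_eq0.
by have /eqP := P1 (j (eps n)) n nAn; rewrite k_eps // oner_eq0.
Qed.

End GenericFiber.

Lemma giqa_frame (C : numClosedFieldType) (kk : closedFieldType)
    (iota : {rmorphism ratfun C -> kk}) (F : hcmodule C) :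
  giqa iota F -> exists fr : frame F, frame_irreducible fr.
Proof.
move=> [[V [j [rho [fib rep compat irr]]]] qa].
by exists (generic_frame qa fib rep compat irr); exact: generic_frame_irreducible.
Qed.

Lemma div_neq0 (K : fieldType) (a b : K) : a != 0 -> b != 0 -> a / b != 0.
Proof. by move=> a0 b0; rewrite mulf_neq0 ?invr_eq0. Qed.

(** * Weight sheaves on the two affine lines *)

Section Bezout.
Variable C : numClosedFieldType.
Local Notation K := (ratfun C).
Local Notation z := (zfun C).
Variables (U : zopen C) (ev : {poly C} -> K).
Hypotheses (evD : {morph ev : p q / p + q}) (evM : {morph ev : p q / p * q}).
Hypothesis ev_reg : forall p x, zset U x -> reg x (ev p).
Hypothesis ev_frac : forall f : K, exists p q, [/\ q != 0, ev q != 0 & f = ev p / ev q].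

(** [ev] substitutes z or 1/z into polynomials. With g1 / g2 = p / q through [ev], the fractional
    ideal of [g1] and [g2] is generated by g2 gcd(p, q) / q. *)
Lemma bezout2 (g1 g2 : K) : exists u1 u2 v1 v2 : O U,
  let g := Oval u1 * g1 + Oval u2 * g2 in g1 = Oval v1 * g /\ g2 = Oval v2 * g.
Proof.
have [->|g20] := eqVneq g2 0.
  by exists 1, 0, 1, 0; cbv zeta; rewrite Oval0 Oval1 !mul0r !mul1r addr0.
have [p [q [q0 eq0 e]]] := ev_frac (g1 / g2).
have [[u1 u2] /= ud] := Bezoutp p q; set d := u1 * p + u2 * q in ud.
have /dvdpP[p' ep] : d %| p by rewrite (eqp_dvdl _ ud) dvdp_gcdl.
have /dvdpP[q' eq] : d %| q by rewrite (eqp_dvdl _ ud) dvdp_gcdr.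
exists (mkO (ev_reg u1)), (mkO (ev_reg u2)), (mkO (ev_reg p')), (mkO (ev_reg q')) => /=.
have eg1 : g1 = ev p / ev q * g2 by rewrite -e divfK.
have -> : ev u1 * g1 + ev u2 * g2 = ev d / ev q * g2.
  rewrite evD !evM eg1 !mulrA -mulrDl; congr (_ * _); rewrite mulrDl; congr (_ + _).
  by rewrite mulfK.
rewrite !mulrA -!evM -ep -eq; split; first exact: eg1.
by rewrite divff ?mul1r.
Qed.

Lemma bezout k (g : 'I_k -> K) : exists u v : 'I_k -> O U,
  forall i, g i = Oval (v i) * \sum_l Oval (u l) * g l.
Proof.
elim: k g => [|k IH] g; first by exists (fun=> 0), (fun=> 0) => -[].
have [u [v uv]] := IH (fun i => g (lift ord0 i)).
have [a [b [c [d [e1 e2]]]]] := bezout2 (g ord0) (\sum_l Oval (u l) * g (lift ord0 l)).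
exists (fun i => if unlift ord0 i is Some l then b * u l else a),
  (fun i => if unlift ord0 i is Some l then v l * d else c) => i.
rewrite big_ord_recl unlift_none.
under eq_bigr do rewrite liftK OvalM -mulrA; rewrite -mulr_sumr.
case: unliftP => [l ->|->]; last exact: e1.
by rewrite OvalM -mulrA -e2 -uv.
Qed.

End Bezout.

Section BezoutCharts.
Variable C : numClosedFieldType.
Local Notation K := (ratfun C).
Local Notation z := (zfun C).

Lemma bezout0 k (g : 'I_k -> K) : exists u v : 'I_k -> O (U0 C),
  forall i, g i = Oval (v i) * \sum_l Oval (u l) * g l.
Proof.
apply: (@bezout _ _ (@tofrac {poly C})).
- exact: tofracD.
- exact: tofracM.
- by move=> p x /U0P[a ->]; exact: reg_poly.
- move=> f; have [p [q [q0 ->]]] := fracP f.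
  by exists p, q; split => //; rewrite tofrac_eq0.
Qed.

Definition evinf (p : {poly C}) : K := (map_poly (@constfun C) p).[z^-1].

(** Reversing the coefficients turns p / z^N into a polynomial in 1/z. *)
Lemma evinf_rev (p : {poly C}) N : (size p <= N.+1)%N ->
  exists p', evinf p' = tofrac p / z ^+ N.
Proof.
move=> sp; exists (\sum_(i < N.+1) p`_i *: 'X^(N - i)).
rewrite /evinf rmorph_sum horner_sum /=.
have -> : tofrac p = \sum_(i < N.+1) constfun p`_i * z ^+ i.
  rewrite -{1}[p](coefK) (poly_def (size p)) rmorph_sum /=.
  rewrite (big_ord_widen _ (fun i => tofrac (p`_i *: 'X^i)) sp) big_mkcond /=.
  apply: eq_bigr => i _; rewrite -tofracXn; case: ltnP => [_|pi].
    by rewrite -mul_polyC tofracM.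
  by rewrite nth_default // rmorph0 mul0r.
rewrite mulr_suml; apply: eq_bigr => i _.
rewrite linearZ /= map_polyXn hornerZ hornerXn -mulrA; congr (_ * _).
have iN : (i <= N)%N by rewrite -ltnS.
rewrite exprVn -[in z ^+ N](subnKC iN) exprD invfM mulVKf //.
by rewrite expf_neq0 ?zfun_neq0.
Qed.

Lemma bezoutinf k (g : 'I_k -> K) : exists u v : 'I_k -> O (Uinf C),
  forall i, g i = Oval (v i) * \sum_l Oval (u l) * g l.
Proof.
apply: (@bezout _ _ evinf).
- by move=> p q; rewrite /evinf rmorphD hornerD.
- by move=> p q; rewrite /evinf rmorphM hornerM.
- move=> p x /UinfP x0; rewrite /evinf horner_coef; apply: reg_sum => i.
  rewrite coef_map /= exprVn; apply: regM; first exact: regC.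
  rewrite -exprVn; apply: regX; case: x x0 => [a|_]; last exact: reg_zV.
  by move=> a0; apply/uniat_reg/uniatV/uniat_z; apply: contra_neq a0 => ->.
- move=> f; have [p [q [q0 ->]]] := fracP f.
  pose N := maxn (size p) (size q).
  have [p' ep] := @evinf_rev p N (leqW (leq_maxl _ _)).
  have [q' eq] := @evinf_rev q N (leqW (leq_maxr _ _)).
  have zN : z ^+ N != 0 by rewrite expf_neq0 // zfun_neq0.
  have evq : evinf q' != 0 by rewrite eq mulf_eq0 invr_eq0 (negPf zN) orbF tofrac_eq0.
  exists p', q'; split; last by rewrite ep eq invf_div mulrA divfK; [|exact: zN].
    by apply: contra_neq evq => ->; rewrite /evinf rmorph0 horner0.
  exact: evq.
Qed.

(* A section f of O(d) is given by its value in the trivialisation over the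
   finite line, so near infinity the regular function is z^-d f. *)
Definition twreg (d : int) (p : P1 C) (f : K) : Prop :=
  if p is Some _ then reg p f else reg p (f * z ^ (- d)).

End BezoutCharts.

(* F presented as the sum of the sheaves O(cd n), n in cS: ck m n is the section
   of O(cd n) given by the weight n part of m, X acts by ca n from weight n to
   n + 2, and Y by cb n from n to n - 2. *)
Record chart (C : numClosedFieldType) (F : hcmodule C) := Chart {
  cS : set int;
  cd : int -> int;
  ca : int -> ratfun C;
  cb : int -> ratfun C;
  ck : forall U : zopen C, F U -> int -> ratfun C;
  ck_lin : forall (U : zopen C) f (m m' : F U) n,
    ck (f *: m + m') n = Oval f * ck m n + ck m' n;
  ck_res : forall (U V : zopen C) (h : V `<=` U) (m : F U), ck (res h m) = ck m;
  ck_eq0 : forall (U : zopen C) (m : F U), (forall n, ck m n = 0) -> m = 0;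
  ck_fin : forall (U : zopen C) (m : F U), exists E : seq int, forall n, n \notin E -> ck m n = 0;
  ck_kact : forall (U : zopen C) a (m : F U) n, a != 0 ->
    ck (kact a m) n = constfun (a ^ n) * ck m n;
  ck_gact : forall (U : zopen C) h x y (m : F U) n,
    gsec U (gelt (zfun C) (zfun C)^-1 h x y) ->
    ck (gact (gelt (zfun C) (zfun C)^-1 h x y) m) n =
      h * n%:~R * ck m n + x * ca (n - 2) * ck m (n - 2) + y * cb (n + 2) * ck m (n + 2);
  ck_out : forall (U : zopen C) (m : F U) n, ~ cS n -> ck m n = 0;
  ck_reg : forall (U : zopen C) (m : F U) n p, zset U p -> twreg (cd n) p (ck m n);
  ck_surj : forall (U : zopen C) (w : int -> ratfun C),
    (exists E : seq int, forall n, n \notin E -> w n = 0) ->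
    (forall n, ~ cS n -> w n = 0) ->
    (forall n p, zset U p -> twreg (cd n) p (w n)) -> exists m : F U, ck m = w;
  ca_supp : forall n, ca n <> 0 -> cS n /\ cS (n + 2);
  cb_supp : forall n, cb n <> 0 -> cS n /\ cS (n - 2) }.

Definition chart_irreducible (C : numClosedFieldType) (F : hcmodule C) (c : chart F) : Prop :=
  (exists n, cS c n) /\
  forall A : set int, (forall n, A n -> ca c n <> 0 -> A (n + 2)) ->
    (forall n, A n -> cb c n <> 0 -> A (n - 2)) ->
    (exists2 n, cS c n & A n) -> forall n, cS c n -> A n.

(** * Splitting of the module into line bundles *)

Section Lattices.
Variables (C : numClosedFieldType) (F : hcmodule C) (fr : frame F).
Hypothesis qa : quasi_admissible F.
Local Notation K := (ratfun C).
Local Notation z := (zfun C).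
Local Notation U1 := (U01 C).
Implicit Types (U W : zopen C).

Lemma fk_inj_weight U n (m m' : F U) : weight_space n m -> weight_space n m' ->
  fk fr m n = fk fr m' n -> m = m'.
Proof.
move=> wm wm' e; apply: (fk_inj (fr := fr)) => l.
have [<-|ln] := eqVneq n l; first exact: e.
by rewrite (fk_other _ wm ln) (fk_other _ wm' ln).
Qed.

Lemma weight_sum U n I (s : seq I) (w : I -> F U) :
  (forall i, weight_space n (w i)) -> weight_space n (\sum_(i <- s) w i).
Proof.
by move=> h; elim/big_ind : _ => //; [exact: weight0|move=> u v; exact: weightD].
Qed.

Lemma principal U n : affine U ->
  (forall k (g : 'I_k -> K), exists u v : 'I_k -> O U,
     forall i, g i = Oval (v i) * \sum_l Oval (u l) * g l) ->
  exists e : F U, weight_space n e /\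
    forall m : F U, weight_space n m -> exists f : O U, m = f *: e.
Proof.
move=> aU bez; have [k [s [sw sp]]] := qa n aU.
have [u [v uv]] := bez k (fun i => fk fr (s i) n).
have we : weight_space n (\sum_l u l *: s l).
  by apply: weight_sum => l; apply: weightZ; exact: sw.
exists (\sum_l u l *: s l); split => // m wm; have [f ->] := sp m wm.
exists (\sum_l f l * v l); apply: (@fk_inj_weight _ n).
- by apply: weight_sum => l; apply: weightZ; exact: sw.
- exact: weightZ.
rewrite fkZ !fk_sum (big_morph (@Oval C U) (@OvalD C U) (Oval0 U)) mulr_suml.
apply: eq_bigr => l _; rewrite fkZ uv OvalM -mulrA; congr (_ * (_ * _)).
by apply: eq_bigr => i _; rewrite fkZ.
Qed.

(** A section over the part of [U] in [W] extends to [W] after multiplication by [G], which is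
    invertible on that part and can be divided out again. *)
Lemma generator_cap U W n (e : F W) (m : F U) : affine W -> weight_space n e ->
  (forall m : F W, weight_space n m -> exists f : O W, m = f *: e) ->
  exists f : O (capU U W), fk fr m n = Oval f * fk fr e n.
Proof.
move=> aW we ge; pose hW := @capUr C U W; pose hU := @capUl C U W.
have [G [m1 [G0 Gu e1]]] := extend_section (@hc_qc _ F) hW (res hU m) aW.
have [f ef] := ge _ (wcomp_weight n m1).
have r x : zset (capU U W) x -> reg x (Oval f / Oval G).
  by move=> Wx; apply: regM; [apply: Oreg (hW _ Wx)|apply/uniat_reg/uniatV/Gu].
exists (mkO r) => /=.
have : fk fr m1 n = Oval G * fk fr m n.
  by rewrite -(fk_res fr hW) e1 fkZ fk_res.
rewrite -fk_wcomp ef fkZ => e2.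
by rewrite mulrAC e2 mulrAC divff ?mul1r.
Qed.

(** The generators over the two affine lines differ by a unit on the punctured line, that is by a
    constant times a power of z; the constant is absorbed in [e1]. *)
Lemma lattice n : fS fr n -> exists (e0 : F (U0 C)) (e1 : F (Uinf C)) (d : int),
  [/\ weight_space n e0 /\ weight_space n e1,
      fk fr e0 n <> 0, fk fr e1 n = z ^ d * fk fr e0 n &
      (forall m : F (U0 C), weight_space n m -> exists f : O (U0 C), m = f *: e0) /\
      (forall m : F (Uinf C), weight_space n m -> exists f : O (Uinf C), m = f *: e1)].
Proof.
move=> Sn; have [e0 [w0 g0]] := principal n (affine_U0 C) (@bezout0 C).
have [e1 [w1 g1]] := principal n (affine_Uinf C) (@bezoutinf C).
have nz W (e : F W) : affine W -> weight_space n e ->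
    (forall m : F W, weight_space n m -> exists f : O W, m = f *: e) -> fk fr e n != 0.
  move=> aW we ge; apply/eqP => k0.
  have [f] := generator_cap (fe fr n) aW we ge.
  by rewrite fe_in // k0 mulr0 => /eqP; rewrite oner_eq0.
have nz0 := nz _ _ (affine_U0 C) w0 g0; have nz1 := nz _ _ (affine_Uinf C) w1 g1.
have [f ef] := generator_cap e1 (affine_U0 C) w0 g0.
have [f' ef'] := generator_cap e0 (affine_Uinf C) w1 g1.
have [a a0|c [d [c0 ew]]] := @monomial_of_uniat C (fk fr e1 n / fk fr e0 n).
  apply: uniat_inv; first exact: (div_neq0 nz1 nz0).
    rewrite ef mulfK //; apply: Oreg; split; last by apply/U0P; exists a.
    by apply/UinfP; apply/eqP => -[]; exact/eqP.
  rewrite invf_div ef' mulfK //; apply: Oreg; split; first by apply/U0P; exists a.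
  by apply/UinfP; apply/eqP => -[]; exact/eqP.
have cV0 : c^-1 != 0 by rewrite invr_eq0.
exists e0, (Oconst _ c^-1 *: e1), d; split.
- by split => //; exact: weightZ.
- exact/eqP.
- rewrite fkZ /= -[fk fr e1 n](divfK nz0) ew !mulrA -rmorphM mulVf //.
  by rewrite rmorph1 mul1r.
- split => // m wm; have [h ->] := g1 m wm; exists (h * Oconst _ c).
  by rewrite scalerA -mulrA -rmorphM divff // rmorph1 mulr1.
Qed.

(** An implication, so that a choice exists for every integer and not only for the weights. *)
Definition lat_spec n (t : F (U0 C) * F (Uinf C) * int) : Prop :=
  fS fr n ->
  [/\ weight_space n t.1.1 /\ weight_space n t.1.2,
      fk fr t.1.1 n <> 0, fk fr t.1.2 n = z ^ t.2 * fk fr t.1.1 n &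
      (forall m : F (U0 C), weight_space n m -> exists f : O (U0 C), m = f *: t.1.1) /\
      (forall m : F (Uinf C), weight_space n m -> exists f : O (Uinf C), m = f *: t.1.2)].

Lemma lat_ex n : exists t, lat_spec n t.
Proof.
have [Sn|nS] := pselect (fS fr n); last by exists (0, 0, 0) => /nS.
by have [e0 [e1 [d h]]] := lattice Sn; exists (e0, e1, d).
Qed.

Definition lat n := projT1 (cid (lat_ex n)).
Lemma latP n : lat_spec n (lat n). Proof. exact: (projT2 (cid (lat_ex n))). Qed.

Definition lg n : K := fk fr (lat n).1.1 n.
Definition ld n : int := (lat n).2.

Lemma lg_neq0 n : fS fr n -> lg n != 0.
Proof. by move=> /latP[_ /eqP h _ _]. Qed.

(** Coordinates measured against the generator over the finite line, so that sections there have
    regular coordinates. *)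
Definition lk U (m : F U) n : K := fk fr m n / lg n.
Definition la n : K := fa fr n * lg n / lg (n + 2).
Definition lb n : K := fb fr n * lg n / lg (n - 2).

Lemma fe_out n : ~ fS fr n -> fe fr n = 0.
Proof.
move=> nS; apply: (@fk_eq0 _ _ fr) => l.
have [<-|nl] := eqVneq n l; first exact: fk_out.
exact: fk_other (fe_weight fr n) nl.
Qed.

Lemma fa_supp n : fa fr n <> 0 -> fS fr n /\ fS fr (n + 2).
Proof.
move=> h; split; apply: contrapT => nS; apply: h; last exact: fk_out.
rewrite /fa fe_out // gact0 ?fk0 //; exact: gsec01X.
Qed.

Lemma fb_supp n : fb fr n <> 0 -> fS fr n /\ fS fr (n - 2).
Proof.
move=> h; split; apply: contrapT => nS; apply: h; last exact: fk_out.
rewrite /fb fe_out // gact0 ?fk0 //; exact: gsec01Y.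
Qed.

Lemma la_supp n : la n <> 0 -> fS fr n /\ fS fr (n + 2).
Proof. by move=> h; apply: fa_supp => e; apply: h; rewrite /la e !mul0r. Qed.

Lemma lb_supp n : lb n <> 0 -> fS fr n /\ fS fr (n - 2).
Proof. by move=> h; apply: fb_supp => e; apply: h; rewrite /lb e !mul0r. Qed.

Lemma la_fa n : fa fr n <> 0 -> la n <> 0.
Proof.
move=> /[dup]/eqP h /fa_supp[S1 S2]; apply/eqP.
exact: (div_neq0 (mulf_neq0 h (lg_neq0 S1)) (lg_neq0 S2)).
Qed.

Lemma lb_fb n : fb fr n <> 0 -> lb n <> 0.
Proof.
move=> /[dup]/eqP h /fb_supp[S1 S2]; apply/eqP.
exact: (div_neq0 (mulf_neq0 h (lg_neq0 S1)) (lg_neq0 S2)).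
Qed.

Lemma lk_lin U f (m m' : F U) n : lk (f *: m + m') n = Oval f * lk m n + lk m' n.
Proof. by rewrite /lk fk_lin mulrDl mulrA. Qed.

Lemma lkZ U f (m : F U) n : lk (f *: m) n = Oval f * lk m n.
Proof. by rewrite /lk fkZ mulrA. Qed.

Lemma lk_sum U I (s : seq I) (w : I -> F U) n :
  lk (\sum_(t <- s) w t) n = \sum_(t <- s) lk (w t) n.
Proof. by rewrite /lk fk_sum mulr_suml. Qed.

Lemma lk_res U W (h : W `<=` U) (m : F U) : lk (res h m) = lk m.
Proof. by rewrite /lk fk_res. Qed.

Lemma lk_out U (m : F U) n : ~ fS fr n -> lk m n = 0.
Proof. by move=> nS; rewrite /lk fk_out // mul0r. Qed.

Lemma lk_eq0 U (m : F U) : (forall n, lk m n = 0) -> m = 0.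
Proof.
move=> h; apply: (@fk_eq0 _ _ fr) => n.
have [Sn|] := pselect (fS fr n); last exact: fk_out.
have /eqP := h n; rewrite /lk mulf_eq0 invr_eq0 (negPf (lg_neq0 Sn)) orbF.
by move/eqP.
Qed.

Lemma lk_inj U (m m' : F U) : lk m = lk m' -> m = m'.
Proof.
move=> e; apply/eqP; rewrite -subr_eq0; apply/eqP/lk_eq0 => n.
by rewrite addrC -scaleN1r lk_lin OvalN Oval1 mulN1r e addNr.
Qed.

Lemma lk_fin U (m : F U) : exists E : seq int, forall n, n \notin E -> lk m n = 0.
Proof.
exists (wts m) => n nE; rewrite /lk -fk_wcomp.
rewrite (wcomp_uniq (undup_uniq (map fst (wseq m))) _ (wcomp_sum m)).
  by rewrite ifN // fk0 mul0r.
by move=> i _; exact: wcomp_weight.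
Qed.

Lemma lk_kact U a (m : F U) n : a != 0 -> lk (kact a m) n = constfun (a ^ n) * lk m n.
Proof. by move=> a0; rewrite /lk -fk_wcomp wcomp_kact // fkZ fk_wcomp mulrA. Qed.

Lemma lk_gactX W (m : F W) n : W `<=` U1 -> lk (gact (secX C) m) n = la (n - 2) * lk m (n - 2).
Proof.
move=> hW; have := fk_gactX fr m (n - 2) hW; rewrite /lk /la subrK => ->.
have [Sn|nS] := pselect (fS fr (n - 2)); last by rewrite fk_out // !(mul0r, mulr0).
have := lg_neq0 Sn; move: (lg _) (lg n) (fa _ _) (fk _ _ _) => b c a k b0.
have -> : a * b / c * (k / b) = a * k / c * (b / b) by ring.
by rewrite divff ?mulr1.
Qed.

Lemma lk_gactY W (m : F W) n : W `<=` U1 -> lk (gact (secY C) m) n = lb (n + 2) * lk m (n + 2).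
Proof.
move=> hW; have := fk_gactY fr m (n + 2) hW; rewrite /lk /lb addrK => ->.
have [Sn|nS] := pselect (fS fr (n + 2)); last by rewrite fk_out // !(mul0r, mulr0).
have := lg_neq0 Sn; move: (lg _) (lg n) (fb _ _) (fk _ _ _) => b c a k b0.
have -> : a * b / c * (k / b) = a * k / c * (b / b) by ring.
by rewrite divff ?mulr1.
Qed.

Lemma lk_gactH U (m : F U) n : lk (gact (secH C) m) n = n%:~R * lk m n.
Proof. by rewrite /lk fk_gactH mulrA. Qed.

Lemma lk_gact U h x y (m : F U) n : gsec U (gelt z z^-1 h x y) ->
  lk (gact (gelt z z^-1 h x y) m) n =
    h * n%:~R * lk m n + x * la (n - 2) * lk m (n - 2) + y * lb (n + 2) * lk m (n + 2).
Proof.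
move=> g; have /gsecP[h' [x' [y' [e r]]]] := g.
have [eh ex ey] := gelt_inj e; rewrite -eh -ex -ey in r.
(* Over [W] each of H, X and Y is a section of the family, and coordinates do not change under
   restriction. *)
pose W := capU U U1; pose hU := @capUl C U U1; pose h1 : W `<=` U1 := @capUr C U U1.
rewrite -(lk_res hU) gact_res // -(lk_res hU m); set m' := res hU m.
have rh p : zset W p -> reg p h by move=> /hU/r[].
have rx p : zset W p -> reg p x by move=> /hU/r[].
have ry p : zset W p -> reg p y by move=> /hU/r[].
rewrite gelt_sum.
have gH : gsec W (secH C) by exact: gsecH.
have gX : gsec W (secX C) by exact: gsec01X.
have gY : gsec W (secY C) by exact: gsec01Y.
have gy0 := gsec_lin (mkO ry) gY (@gsec0 C W).
have gxy := gsec_lin (mkO rx) gX gy0.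
rewrite (gact_linearl (mkO rh) m' gH gxy) (gact_linearl (mkO rx) m' gX gy0).
rewrite (gact_linearl (mkO ry) m' gY (@gsec0 C W)) gact_zero addr0.
rewrite lk_lin lk_lin lkZ lk_gactH lk_gactX // lk_gactY //=.
by rewrite !mulrA addrA.
Qed.

Lemma lk_reg U (m : F U) n p : zset U p -> twreg (ld n) p (lk m n).
Proof.
move=> Up; have [Sn|nS] := pselect (fS fr n); last first.
  by rewrite lk_out // /twreg mul0r; case: p Up => *; exact: reg0.
have [[w0 w1] k0 k1 [g0 g1]] := latP Sn; rewrite /lk /twreg.
case: p Up => [a|] Up.
  have [f ->] := generator_cap m (affine_U0 C) w0 g0.
  by rewrite mulfK ?lg_neq0 //; apply: Oreg; split => //; apply/U0P; exists a.
have [f ->] := generator_cap m (affine_Uinf C) w1 g1.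
rewrite k1 -/(lg n) mulrA mulfK ?lg_neq0 // -/(ld n) -mulrA -expfzDr ?zfun_neq0 //.
by rewrite subrr expr0z mulr1; apply: Oreg; split.
Qed.

(** Multiples of the two generators on the charts glue, because coordinates determine sections. *)
Lemma lk_surj1 U n (f : K) : fS fr n -> (forall p, zset U p -> twreg (ld n) p f) ->
  exists m : F U, lk m = (fun k => if k == n then f else 0).
Proof.
move=> Sn r; have [[w0 w1] k0 k1 _] := latP Sn.
pose Vb (b : bool) := capU U (if b then U0 C else Uinf C).
have lkw W k (m : F W) : weight_space n m -> lk m k = if k == n then lk m n else 0.
  move=> wm; case: eqP => [->//|/eqP kn].
  by rewrite /lk (fk_other _ wm) ?mul0r // eq_sym.
have ex b : exists s : F (Vb b), lk s = (fun k => if k == n then f else 0).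
  case: b.
    have rf p : zset (Vb true) p -> reg p f.
      by move=> [Up /U0P[a pa]]; rewrite pa in Up *; exact: r Up.
    exists (mkO rf *: res (@capUr C U (U0 C)) (lat n).1.1); apply: funext => k.
    rewrite lkw; last by apply/weightZ/weight_res.
    rewrite lkZ lk_res /= {1}/lk -/(lg n) divff ?mulr1 //; exact: lg_neq0.
  have rf p : zset (Vb false) p -> reg p (f * z ^ (- ld n)).
    case: p => [a|] [Up Ip]; last exact: r Up.
    move/UinfP : Ip => Ip; apply: regM; first exact: r Up.
    by apply/uniat_reg/uniatX/uniat_z; apply: contra_neq Ip => ->.
  exists (mkO rf *: res (@capUr C U (Uinf C)) (lat n).1.2); apply: funext => k.
  rewrite lkw; last by apply/weightZ/weight_res.
  rewrite lkZ lk_res /= {1}/lk k1 -/(lg n) -/(ld n) mulfK; last exact: lg_neq0.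
  by rewrite -mulrA -expfzDr ?zfun_neq0 // addNr expr0z mulr1.
pose s b := projT1 (cid (ex b)).
have sE b : lk (s b) = (fun k => if k == n then f else 0) := projT2 (cid (ex b)).
have [m hm] := @sheaf_glue _ F U bool Vb (fun b => @capUl C U _) (@cover01 C U) s
  (fun b b' W hi hj => lk_inj (etrans (etrans (lk_res hi (s b)) (sE b))
     (esym (etrans (lk_res hj (s b')) (sE b'))))).
exists m; transitivity (lk (res (@capUl C U (if true then U0 C else Uinf C)) m)).
  by rewrite lk_res.
by rewrite (hm true); exact: (sE true).
Qed.

Lemma lk_surj U (w : int -> K) : (exists E : seq int, forall n, n \notin E -> w n = 0) ->
  (forall n, ~ fS fr n -> w n = 0) ->
  (forall n p, zset U p -> twreg (ld n) p (w n)) -> exists m : F U, lk m = w.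
Proof.
move=> [E wE] wS r.
have ex n : exists m : F U, lk m = (fun k => if k == n then w n else 0).
  have [Sn|nS] := pselect (fS fr n); first exact: lk_surj1 Sn (r n).
  exists 0; apply: funext => k; rewrite wS // if_same.
  by rewrite /lk fk0 mul0r.
have [s hs] := choice ex; exists (\sum_(n <- undup E) s n); apply: funext => k.
rewrite lk_sum (eq_bigr (fun n => if n == k then w n else 0)) => [|n _]; last first.
  by rewrite hs eq_sym.
rewrite -big_mkcond sum_pick ?undup_uniq // mem_undup.
by case: ifP => // /negbT/wE.
Qed.

Definition lattice_chart : chart F :=
  Chart lk_lin lk_res lk_eq0 lk_fin lk_kact lk_gact lk_out lk_reg lk_surj la_supp lb_supp.

Lemma lattice_chart_irreducible : frame_irreducible fr -> chart_irreducible lattice_chart.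
Proof.
move=> [S0 h]; split => // A AX AY; apply: h; split=> n An /=.
  by move=> /la_fa; exact: AX.
by move=> /lb_fb; exact: AY.
Qed.

End Lattices.

Lemma giqa_chart (C : numClosedFieldType) (kk : closedFieldType)
    (iota : {rmorphism ratfun C -> kk}) (F : hcmodule C) :
  giqa iota F -> exists c : chart F, chart_irreducible c.
Proof.
move=> gF; have [fr ifr] := giqa_frame gF; have [_ qa] := gF.
by exists (lattice_chart fr qa); exact: lattice_chart_irreducible.
Qed.

(** * Degrees, Casimir section and weights in coordinates *)

Section ChartFacts.
Variables (C : numClosedFieldType) (F : hcmodule C) (c : chart F).
Local Notation K := (ratfun C).
Local Notation z := (zfun C).
Local Notation U1 := (U01 C).
Local Notation S := (cS c).
Local Notation d := (cd c).
Local Notation a := (ca c).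
Local Notation b := (cb c).
Local Notation gel := (@gelt K z z^-1).
Implicit Types (U W : zopen C) (n : int).

Lemma ck0 U n : ck c (0 : F U) n = 0.
Proof.
have := ck_lin c (-1) (0 : F U) 0 n.
by rewrite scaler0 addr0 OvalN Oval1 mulN1r addNr.
Qed.
Lemma ckD U (m m' : F U) n : ck c (m + m') n = ck c m n + ck c m' n.
Proof. by have := ck_lin c 1 m m' n; rewrite scale1r Oval1 mul1r. Qed.
Lemma ckZ U f (m : F U) n : ck c (f *: m) n = Oval f * ck c m n.
Proof. by rewrite -[f *: m]addr0 ck_lin ck0 addr0. Qed.
Lemma ckB U (m m' : F U) n : ck c (m - m') n = ck c m n - ck c m' n.
Proof. by rewrite addrC -scaleN1r ck_lin OvalN Oval1 mulN1r addrC. Qed.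
Lemma ckMn U (m : F U) k n : ck c (m *+ k) n = ck c m n *+ k.
Proof. by elim: k => [|k IH]; rewrite ?mulr0n ?ck0 // !mulrS ckD IH. Qed.
Lemma ck_inj U (m m' : F U) : ck c m = ck c m' -> m = m'.
Proof.
move=> e; apply/eqP; rewrite -subr_eq0; apply/eqP/(@ck_eq0 _ _ c) => n.
by rewrite ckB e subrr.
Qed.

Lemma constfun_pow_inj k n (f : K) : (forall t : C, t != 0 ->
  constfun (t ^ k) * f = constfun (t ^ n) * f) -> k != n -> f = 0.
Proof.
move=> h kn; have n2 : (2 : C) != 0 by rewrite pnatr_eq0.
have /eqP := h 2 n2; rewrite -subr_eq0 -mulrBl -rmorphB mulf_eq0 constfun_eq0 subr_eq0.
by case/orP => [/eqP/expz2_inj|/eqP//] kn'; case/eqP: kn.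
Qed.

Lemma ck_weight U n (m : F U) : weight_space n m <-> (forall k, k != n -> ck c m k = 0).
Proof.
split=> [wm k kn|h t t0]; last first.
  apply: ck_inj; apply: funext => k; rewrite ck_kact // ckZ /=.
  by have [->//|kn] := eqVneq k n; rewrite h // !mulr0.
apply: constfun_pow_inj kn => t t0.
by rewrite -ck_kact // wm // ckZ.
Qed.

Lemma ck_delta U n (f : K) : S n -> (forall p, zset U p -> twreg (d n) p f) ->
  exists m : F U, weight_space n m /\ ck c m = (fun k => if k == n then f else 0).
Proof.
move=> Sn r; have [m em] : exists m : F U, ck c m = (fun k => if k == n then f else 0).
  apply: ck_surj => [|k nS|k p Up].
  - by exists [:: n] => k; rewrite inE => /negPf->.
  - by case: eqP => // e; case: nS; rewrite e.
  - case: eqP => [->|_]; first exact: r.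
    by rewrite /twreg mul0r; case: p {Up} => *; exact: reg0.
by exists m; split=> //; apply/ck_weight => k /negPf kn; rewrite em kn.
Qed.

Lemma weights_chart : weights F = S.
Proof.
apply/seteqP; split=> n.
  move=> [U [m [wm m0]]]; apply: contrapT => nS; apply: m0.
  apply: (@ck_eq0 _ _ c) => k; have [->|kn] := eqVneq k n; first exact: ck_out.
  by move/ck_weight: wm; apply.
move=> Sn; have [|m [wm em]] := @ck_delta (U0 C) n 1 Sn.
  by move=> p /U0P[t ->]; exact: reg1.
exists (U0 C), m; split => // m0; have := congr1 (fun w => w n) em.
by rewrite m0 ck0 eqxx => /esym/eqP; rewrite oner_eq0.
Qed.

Lemma trivializes_chart U n (e : F U) : weight_space n e -> ck c e n <> 0 ->
  (forall W (m : F W) p, W `<=` U -> zset W p -> reg p (ck c m n / ck c e n)) ->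
  trivializes (@weight_space C F n) e.
Proof.
move=> we /eqP e0 r; split=> // W h; split=> [f|m wm]; first exact/weightZ/weight_res.
exists (mkO (fun p Wp => r W m p h Wp)); split.
  apply: ck_inj; apply: funext => k; rewrite ckZ ck_res /=.
  have [->|kn] := eqVneq k n; first by rewrite divfK.
  move/ck_weight: wm => /(_ k kn) ->; move/ck_weight: we => /(_ k kn) ->.
  by rewrite mulr0.
move=> f ef; apply: OvalE => /=.
have := congr1 (fun u => ck c u n) ef; rewrite ckZ ck_res => ->.
by rewrite mulfK.
Qed.

Lemma twreg_Uinf (n : int) (f : K) p : zset (Uinf C) p -> twreg n p f -> reg p (f / z ^ n).
Proof.
case: p => [t|] /UinfP tp; last by rewrite /twreg invr_expz.
move=> /= rf; apply: regM => //; apply/uniat_reg/uniatV/uniatX/uniat_z.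
by apply: contra_neq tp => ->.
Qed.

Lemma sections01 n : S n -> exists (e0 : F (U0 C)) (e1 : F (Uinf C)),
  [/\ weight_space n e0 /\ weight_space n e1,
      ck c e0 = (fun k => if k == n then 1 else 0),
      ck c e1 = (fun k => if k == n then z ^ d n else 0),
      trivializes (@weight_space C F n) e0 &
      trivializes (@weight_space C F n) e1].
Proof.
move=> Sn; have [p /U0P[t ->]|e0 [w0 k0]] := @ck_delta (U0 C) n 1 Sn; first exact: reg1.
have [|e1 [w1 k1]] := @ck_delta (Uinf C) n (z ^ d n) Sn.
  move=> [t|] /UinfP tp /=; last by rewrite -expfzDr ?zfun_neq0 // subrr expr0z; exact: reg1.
  by apply/uniat_reg/uniatX/uniat_z; apply: contra_neq tp => ->.
exists e0, e1; split => //.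
- apply: trivializes_chart => //.
    by rewrite k0 eqxx; apply/eqP; exact: oner_neq0.
  move=> W m p hW Wp; rewrite k0 eqxx divr1; have /U0P[t pt] := hW _ Wp.
  by have := ck_reg c m n Wp; rewrite pt.
- apply: trivializes_chart => //.
    by rewrite k1 eqxx; apply/eqP; rewrite expfz_neq0 ?zfun_neq0.
  move=> W m p hW Wp; rewrite k1 eqxx; apply: twreg_Uinf; first exact: hW.
  exact: ck_reg Wp.
Qed.

(** Another pair of trivializations differs from the standard one by a nonzero constant over the
    finite line and by a unit near infinity, so z^(d' - d) is a unit at infinity. *)
Lemma wdegree_chart n : S n -> wdegree F n = d n.
Proof.
move=> Sn; have [e0 [e1 [[w0 w1] k0 k1 t0 t1]]] := sections01 Sn.
have rz x : zset U1 x -> reg x (z ^ d n).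
  by move=> /U01P[t tn ->]; apply/uniat_reg/uniatX/uniat_z.
have hd : has_degree (@weight_space C F n) (d n).
  exists e0, e1, (mkO rz); split => //.
  apply: ck_inj; apply: funext => k; rewrite ckZ !ck_res k0 k1 /=.
  by case: eqP => _; rewrite ?mulr1 ?mulr0.
apply: xget_unique => // d' [e0' [e1' [f [t0' t1' ef e]]]].
have same W (u v : F W) : trivializes (@weight_space C F n) u ->
    trivializes (@weight_space C F n) v -> exists h h' : O W,
    ck c u n = Oval h * ck c v n /\ ck c v n = Oval h' * ck c u n.
  move=> [wu tu] [wv tv]; have id : W `<=` W by [].
  have [_ /(_ _ wu)[h [hu _]]] := tv W id; have [_ /(_ _ wv)[h' [hv _]]] := tu W id.
  rewrite res_id in hu; rewrite res_id in hv.
  by exists h, h'; rewrite {1}hu {3}hv !ckZ.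
have [h [h' [eh eh']]] := same _ _ _ t0' t0.
have [g [g' [eg eg']]] := same _ _ _ t1' t1.
rewrite k0 eqxx mulr1 in eh eh'; rewrite k1 eqxx in eg eg'.
set w0' := ck c e0' n in eh eh'; set w1' := ck c e1' n in eg eg'.
have ew : w1' = z ^ d' * w0'.
  by have := congr1 (fun u => ck c u n) e; rewrite ckZ !ck_res ef.
have w0n : w0' != 0.
  by apply/eqP => e00; move/eqP: eh'; rewrite e00 mulr0 oner_eq0.
have [t|cc cc0 ec] := @const_of_uniat C w0'.
  have Ut : zset (U0 C) (Some t) by apply/U0P; exists t.
  apply: uniat_inv; first exact: w0n.
    by rewrite eh; exact: Oreg.
  have -> : w0'^-1 = Oval h' by rewrite -[LHS]mul1r eh' mulfK.
  exact: Oreg.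
have zd : z ^ d n != 0 by rewrite expfz_neq0 ?zfun_neq0.
have ug : uniat None (Oval g).
  have g0 : Oval g * Oval g' = 1.
    apply: (mulIf zd); rewrite mul1r mulrAC -eg mulrC; exact: esym.
  have gn : Oval g != 0.
    by apply/eqP => e00; move/eqP: g0; rewrite e00 mul0r eq_sym oner_eq0.
  apply: uniat_inv; [exact: gn|exact: Oreg|].
  have -> : (Oval g)^-1 = Oval g' by rewrite -[RHS](mulKf gn) g0 mulr1.
  exact: Oreg.
have : d' - d n = 0; last by move/eqP; rewrite subr_eq0 => /eqP.
apply: (@zpow_uniat_inf C _ w0'); first by rewrite ec; exact: uniatC.
rewrite expfzDr ?zfun_neq0 // mulrA [w0' * _]mulrC -ew eg -invr_expz mulfK //.
Qed.

(** X and zY are sections over the finite line, as X/z and Y are near infinity; applying them to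
    generators bounds the poles of [a] and [b]. *)
Lemma gel_reg0 : (forall p, zset (U0 C) p -> greg p 0 1 (0 : K)) /\
  (forall p, zset (U0 C) p -> greg p 0 0 z).
Proof.
split=> p /U0P[t ->]; split; rewrite ?mul0r ?mul1r ?divff ?zfun_neq0 //;
  (exact: reg0 || exact: reg1 || exact: reg_z).
Qed.

Lemma gel_reginf : (forall p, zset (Uinf C) p -> greg p 0 z^-1 (0 : K)) /\
  (forall p, zset (Uinf C) p -> greg p 0 0 (1 : K)).
Proof.
have rz p : zset (Uinf C) p -> reg p z^-1.
  case: p => [t|] /UinfP tp; last exact: reg_zV.
  by apply/uniat_reg/uniatV/uniat_z; apply: contra_neq tp => ->.
split=> p Up; split; rewrite ?mul0r ?mul1r ?mulVf ?zfun_neq0 //;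
  (exact: reg0 || exact: reg1 || exact: rz).
Qed.

Lemma ck_gactX U (x : K) (m : F U) n : (forall p, zset U p -> greg p 0 x 0) ->
  ck c (gact (gel 0 x 0) m) n = x * a (n - 2) * ck c m (n - 2).
Proof. by move=> /gsec_gelt g; rewrite ck_gact // !mul0r add0r addr0. Qed.

Lemma ck_gactY U (y : K) (m : F U) n : (forall p, zset U p -> greg p 0 0 y) ->
  ck c (gact (gel 0 0 y) m) n = y * b (n + 2) * ck c m (n + 2).
Proof. by move=> /gsec_gelt g; rewrite ck_gact // !mul0r !add0r. Qed.

Lemma ca_out n : ~ S n -> a n = 0.
Proof. by move=> nS; apply: contrapT => /ca_supp[]. Qed.
Lemma cb_out n : ~ S n -> b n = 0.
Proof. by move=> nS; apply: contrapT => /cb_supp[]. Qed.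

Lemma ca_reg0 n t : reg (Some t) (a n).
Proof.
have [Sn|/ca_out->] := pselect (S n); last exact: reg0.
have [e0 [_ [_ k0 _ _ _]]] := sections01 Sn.
have [g _] := gel_reg0; have Ut : zset (U0 C) (Some t) by apply/U0P; exists t.
have := ck_reg c (gact (gel 0 1 0) e0) (n + 2) Ut.
by rewrite ck_gactX // addrK k0 eqxx mul1r mulr1.
Qed.

Lemma cb_reg0 n t : reg (Some t) (z * b n).
Proof.
have [Sn|/cb_out->] := pselect (S n); last by rewrite mulr0; exact: reg0.
have [e0 [_ [_ k0 _ _ _]]] := sections01 Sn.
have [_ g] := gel_reg0; have Ut : zset (U0 C) (Some t) by apply/U0P; exists t.
have := ck_reg c (gact (gel 0 0 z) e0) (n - 2) Ut.
by rewrite ck_gactY // subrK k0 eqxx mulr1.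
Qed.

(** The -1 in the exponent comes from X/z, the section of the family near infinity. *)
Lemma ca_reginf n : reg None (a n * z ^ (d n - d (n + 2) - 1)).
Proof.
have [Sn|/ca_out->] := pselect (S n); last by rewrite mul0r; exact: reg0.
have [_ [e1 [_ _ k1 _ _]]] := sections01 Sn.
have [g _] := gel_reginf.
have := ck_reg c (gact (gel 0 z^-1 0) e1) (n + 2) (@Uinf_None C).
rewrite ck_gactX // addrK k1 eqxx /twreg; congr (reg _ _).
rewrite !expfzDr ?zfun_neq0 // exprN1.
by rewrite [z^-1 * _]mulrC -!mulrA; congr (_ * _); rewrite mulrC mulrA.
Qed.

Lemma cb_reginf n : reg None (b n * z ^ (d n - d (n - 2))).
Proof.
have [Sn|/cb_out->] := pselect (S n); last by rewrite mul0r; exact: reg0.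
have [_ [e1 [_ _ k1 _ _]]] := sections01 Sn.
have [_ g] := gel_reginf.
have := ck_reg c (gact (gel 0 0 1) e1) (n - 2) (@Uinf_None C).
rewrite ck_gactY // subrK k1 eqxx /twreg mul1r; congr (reg _ _).
by rewrite expfzDr ?zfun_neq0 // mulrA.
Qed.

Definition yx n : K := a n * b (n + 2).

Lemma yx_reg0 n t : reg (Some t) (z * yx n).
Proof. by rewrite /yx mulrCA; apply: regM; [exact: ca_reg0|exact: cb_reg0]. Qed.

(** The degrees cancel between the exponents of [ca_reginf] and [cb_reginf], whose sum is -1; hence
    z yx has a pole of order at most 2. *)
Lemma yx_reginf n : reg None (z * yx n / z ^+ 2).
Proof.
have := regM (ca_reginf n) (cb_reginf (n + 2)); rewrite addrK.
congr (reg _ _); rewrite mulrACA -/(yx n) -expfzDr ?zfun_neq0 //.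
rewrite (_ : _ + _ = -1); last by ring.
by rewrite expr2 invfM [z * _]mulrC mulrA mulfK ?zfun_neq0.
Qed.

Lemma yx_form n : exists c1 c0 cm1 : C, yx n = casimir_fun c1 c0 cm1.
Proof.
have [p sp e] := poly_bounded (yx_reg0 n) (yx_reginf n).
exists p`_2, p`_1, p`_0.
have -> : yx n = tofrac p / z by rewrite -e mulrC mulKf // zfun_neq0.
have -> : tofrac p = constfun p`_2 * (z * z) + constfun p`_1 * z + constfun p`_0.
  rewrite /constfun /zfun -!tofracM -!tofracD; congr tofrac.
  rewrite !mul_polyC -expr2.
  apply/polyP => -[|[|[|i]]]; rewrite !coefE /= ?(mulr0, mulr1, addr0, add0r) //.
  by rewrite nth_default // (leq_trans sp).
rewrite /casimir_fun !mulrDl; congr (_ + _ + _).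
  by rewrite mulrA mulfK ?zfun_neq0.
by rewrite mulfK ?zfun_neq0.
Qed.

(** The relation [X, Y] = H on a vector of weight [n]. *)
Lemma yx_comm n : S n -> yx (n - 2) - yx n = n%:~R.
Proof.
move=> Sn; have [t /U01P[t' _ ->]|m [_ km]] := @ck_delta U1 n 1 Sn; first exact: reg1.
have id1 : U1 `<=` U1 by [].
have gX := @gsec01X C U1 id1; have gY := @gsec01Y C U1 id1; have gH := @gsecH C U1.
have := congr1 (fun u => ck c u n) (gact_bracket m gX gY).
rewrite secX_gelt secY_gelt (bracket_gelt _ _ _ _ _ _ (zzV C)).
rewrite !(mul0r, mulr0, mul1r, mulr1, subr0, sub0r, mul0rn, oppr0) ckB.
have rX p : zset U1 p -> greg p 0 1 0.
  move: gX; rewrite secX_gelt => /gsecP[h' [x' [y' [/gelt_inj[<- <- <-] r]]]]; exact: r.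
have rY p : zset U1 p -> greg p 0 0 1.
  move: gY; rewrite secY_gelt => /gsecP[h' [x' [y' [/gelt_inj[<- <- <-] r]]]]; exact: r.
rewrite ck_gactX // ck_gactY // ck_gactY // ck_gactX //.
rewrite ck_gact -?secH_gelt // !mul0r !addr0 subrK addrK km eqxx !mulr1 !mul1r.
by rewrite /yx subrK [b (n + 2) * _]mulrC.
Qed.

Lemma intrK_inj (k l : int) : k%:~R = l%:~R :> K -> k = l.
Proof.
move=> e; apply: (@intr_inj C); apply: (fmorph_inj (@constfun C)).
by rewrite !rmorph_int.
Qed.

Hypothesis irr : chart_irreducible c.

Lemma chart_closed (A : set int) n0 : (forall n, A n -> S n -> S (n + 2) -> A (n + 2)) ->
  (forall n, A n -> S n -> S (n - 2) -> A (n - 2)) -> S n0 -> A n0 -> forall n, S n -> A n.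
Proof.
case: irr => _ h AX AY Sn0 An0; apply: h; last by exists n0.
  by move=> n An /ca_supp[]; exact: AX.
by move=> n An /cb_supp[]; exact: AY.
Qed.

(** C = H^2 + 2H + 4YX on a vector of weight [n]. *)
Definition casimir_value n : K := (n * (n + 2))%:~R + 4 * yx n.

Lemma casimir_value_step n : S n -> casimir_value n = casimir_value (n - 2).
Proof.
move=> Sn; rewrite /casimir_value; have := yx_comm Sn => /eqP.
rewrite subr_eq => /eqP->; rewrite !(intrM, intrB, intrD); ring.
Qed.

(** The second equation keeps the value available just below a lowest weight, where n - 2 is not a
    weight. *)
Lemma chart_casimir : exists q : K,
  forall n, S n -> q = casimir_value n /\ q = casimir_value (n - 2).
Proof.
case: irr => -[n0 Sn0] _; exists (casimir_value n0).
suff h n : S n -> casimir_value n0 = casimir_value n.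
  by move=> n Sn; split; [exact: h|rewrite -casimir_value_step //; exact: h].
move: n; apply: (@chart_closed [set n | casimir_value n0 = casimir_value n] n0) => //= n -> S1 S2.
  by rewrite (casimir_value_step S2) addrK.
by rewrite (casimir_value_step S1).
Qed.

Lemma yx_out_up n : ~ S (n + 2) -> yx n = 0.
Proof. by move=> h; rewrite /yx (@cb_out (n + 2)) // mulr0. Qed.

Lemma yx_out n : ~ S n -> yx n = 0.
Proof. by move=> h; rewrite /yx ca_out // mul0r. Qed.

Lemma casimir_chart q : (forall n, S n -> q = casimir_value n /\ q = casimir_value (n - 2)) ->
  casimir_acts_by F q.
Proof.
move=> hq U f m U01U ef; have gX := gsec01X U01U; have gY := gsec01Y U01U.
have rX p : zset U p -> greg p 0 1 0.
  move: gX; rewrite secX_gelt => /gsecP[h' [x' [y' [/gelt_inj[<- <- <-] r]]]]; exact: r.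
have rY p : zset U p -> greg p 0 0 1.
  move: gY; rewrite secY_gelt => /gsecP[h' [x' [y' [/gelt_inj[<- <- <-] r]]]]; exact: r.
apply: ck_inj; apply: funext => n; rewrite /casimir ckD [X in X + _]ckD !ckMn ckZ ef.
have [Sn|nS] := pselect (S n); last by rewrite !(ck_out _ nS) !mul0rn mulr0 !addr0.
have gH (m' : F U) : ck c (gact (secH C) m') n = n%:~R * ck c m' n.
  have := @gsecH C U; rewrite secH_gelt => g.
  by rewrite ck_gact // !mul0r !addr0 mul1r.
rewrite !gH secX_gelt secY_gelt ck_gactX // ck_gactY // ck_gactY // ck_gactX //.
rewrite subrK addrK !mul1r; have := yx_comm Sn; have [-> _] := hq n Sn.
rewrite /casimir_value /yx subrK intrM intrD.
move: (ck c m n) (a _) (b n) (a n) (b (n + 2)) => k a1 b1 a2 b2 /eqP.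
rewrite subr_eq => /eqP e.
have -> : a1 * (b1 * k) = (a1 * b1) * k by rewrite mulrA.
rewrite e; ring.
Qed.

Lemma casimir_unique q q' : casimir_acts_by F q -> casimir_acts_by F q' -> q = q'.
Proof.
case: irr => -[n Sn] _ h h'.
have [W WU r] := regular_open (fun i : 'I_2 => if i == 0 then q else q') U1.
have rq p : zset W p -> reg p q by exact: (r 0).
have rq' p : zset W p -> reg p q' by exact: (r 1).
have [p /WU/U01P[t _ ->]|m [_ km]] := @ck_delta W n 1 Sn; first exact: reg1.
have := h W (mkO rq) m WU erefl; rewrite (h' W (mkO rq') m WU erefl).
by move=> /(congr1 (fun u => ck c u n)); rewrite !ckZ km eqxx !mulr1.
Qed.

Lemma even_class n : S n -> forall k, S k -> exists j : int, k = n + 2 * j.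
Proof.
move=> Sn; apply: (@chart_closed [set k | exists j : int, k = n + 2 * j] n) => //=.
- by move=> k [j ->] _ _; exists (j + 1); ring.
- by move=> k [j ->] _ _; exists (j - 1); ring.
- by exists 0; ring.
Qed.

(** If X kills weight [n], the weights n + 2i with i <= 0 are closed under both kinds of arrows. *)
Lemma top_max n : S n -> a n = 0 -> forall k, S k -> k <= n.
Proof.
move=> Sn an k Sk; have [j e] := even_class Sn Sk.
suff [i [ei i0]] : exists i : int, k = n + 2 * i /\ i <= 0 by lia.
case: irr => _ /(_ [set k | exists i : int, k = n + 2 * i /\ i <= 0]) h.
apply: (h) => // [l [i [-> i0]] ai|l [i [-> i0]] _|].
- exists (i + 1); split; first by ring.
  have : i <> 0 by move=> i00; apply: ai; rewrite i00 mulr0 addr0.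
  by lia.
- by exists (i - 1); split; [ring|lia].
- by exists n => //; exists 0; split; [ring|].
Qed.

Lemma bot_min n : S n -> b n = 0 -> forall k, S k -> n <= k.
Proof.
move=> Sn an k Sk; have [j e] := even_class Sn Sk.
suff [i [ei i0]] : exists i : int, k = n + 2 * i /\ 0 <= i by lia.
case: irr => _ /(_ [set k | exists i : int, k = n + 2 * i /\ 0 <= i]) h.
apply: (h) => // [l [i [-> i0]] _|l [i [-> i0]] ai|].
- by exists (i + 1); split; [ring|lia].
- exists (i - 1); split; first by ring.
  have : i <> 0 by move=> i00; apply: ai; rewrite i00 mulr0 addr0.
  by lia.
- by exists n => //; exists 0; split; [ring|].
Qed.

Lemma ca_neq0 n : S n -> S (n + 2) -> a n <> 0.
Proof. by move=> Sn S2 a0; have := top_max Sn a0 S2; lia. Qed.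

Lemma cb_neq0 n : S n -> S (n + 2) -> b (n + 2) <> 0.
Proof. by move=> Sn S2 b0; have := bot_min S2 b0 Sn; lia. Qed.

(** A vanishing arrow would make [n] the highest or n + 2 the lowest weight. *)
Lemma yx_neq0 n : S n -> S (n + 2) -> yx n <> 0.
Proof.
move=> Sn S2; apply/eqP; rewrite mulf_eq0 negb_or; apply/andP; split; apply/eqP.
  exact: ca_neq0.
exact: cb_neq0.
Qed.

Variable q : K.
Hypothesis hq : forall n, S n -> q = casimir_value n /\ q = casimir_value (n - 2).

Lemma casimir_top n : S n -> ~ S (n + 2) -> q = (n * (n + 2))%:~R.
Proof. by move=> Sn nS; have [-> _] := hq Sn; rewrite /casimir_value yx_out_up // mulr0 addr0. Qed.

Lemma casimir_bot n : S n -> ~ S (n - 2) -> q = (n * (n - 2))%:~R.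
Proof.
move=> Sn nS; have [_ ->] := hq Sn; rewrite /casimir_value yx_out // mulr0 addr0.
by rewrite subrK mulrC.
Qed.

Lemma casimir_inner n : S n -> S (n + 2) -> q <> (n * (n + 2))%:~R.
Proof.
move=> Sn S2; have [-> _] := hq Sn => /eqP.
rewrite -subr_eq0 /casimir_value addrC addKr mulf_eq0.
have -> : (4 == 0 :> K) = false by apply/eqP => /(@intrK_inj 4 0).
by move/eqP; exact: yx_neq0.
Qed.

(** The Casimir value at an end must differ from n (n + 2) for every adjacent pair of weights n, n +
    2. With two ends, the values at both agree and make the ends opposite. *)
Lemma chart_weights : [\/ S = parity_weights false, S = parity_weights true,
  exists2 l : int, 1 <= l & S = weights_from l |
  (exists2 l : int, l <= -1 & S = weights_upto l) \/ (exists k : nat, S = weights_between k)].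
Proof.
have [n0 Sn0] := irr.1.
have updir n j : (forall k, S k -> S (k + 2)) -> S n -> S (n + 2 * j%:Z).
  move=> h Sn; elim: j => [|j IH]; first by rewrite mulr0 addr0.
  by rewrite (_ : _ + _ = n + 2 * j%:Z + 2); [exact: h|lia].
have downdir n j : (forall k, S k -> S (k - 2)) -> S n -> S (n - 2 * j%:Z).
  move=> h Sn; elim: j => [|j IH]; first by rewrite mulr0 subr0.
  by rewrite (_ : _ - _ = n - 2 * j%:Z - 2); [exact: h|lia].
have [[u [Su nSu]]|notop] := pselect (exists n, S n /\ ~ S (n + 2));
  have [[l [Sl nSl]]|nobot] := pselect (exists n, S n /\ ~ S (n - 2)).
- have au : a u = 0 by apply: contrapT => /ca_supp[].
  have bl : b l = 0 by apply: contrapT => /cb_supp[].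
  have lu := top_max Su au Sl.
  have e : l * (l - 2) = u * (u + 2).
    by apply: intrK_inj; rewrite -(casimir_top Su nSu) -(casimir_bot Sl nSl).
  (* The equality factors as (u + l)(u - l + 2) = 0, and the second factor is positive. *)
  have eu : l = - u.
    have /eqP : (u + l) * (u - l + 2) = 0 by move: e; nia.
    by rewrite mulf_eq0 => /orP[]/eqP; lia.
  apply: Or44; right; exists `|u|%N.
  have eabs : `|u|%N%:Z = u by lia.
  have inS i : (i <= `|u|)%N -> S (u - 2 * i%:Z).
    elim: i => [|i IH] iu; first by rewrite mulr0 subr0.
    have Si := IH (ltnW iu); apply: contrapT => nS.
    have nSi : ~ S (u - 2 * i%:Z - 2) by rewrite (_ : _ - _ = u - 2 * i.+1%:Z); [|lia].
    have bi : b (u - 2 * i%:Z) = 0 by apply: contrapT => /cb_supp[].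
    by have := bot_min Si bi Sl; lia.
  apply/seteqP; split=> n.
    move=> Sn; have [j ej] := even_class Su Sn.
    have := top_max Su au Sn; have := bot_min Sl bl Sn.
    by exists `|j|%N; lia.
  by move=> [i iu ->]; rewrite eabs; exact: inS.
- have au : a u = 0 by apply: contrapT => /ca_supp[].
  have down k : S k -> S (k - 2).
    by move=> Sk; apply: contrapT => nS; apply: nobot; exists k.
  apply: Or44; left; exists u.
    (* For u >= 0 the weights -u - 2 and -u lie below the top, and their excluded value (-u - 2)(-u)
       is the Casimir value u (u + 2). *)
    rewrite leNgt; apply/negP => u0.
    have S1 : S (- u - 2).
      have := downdir u (absz (u + 1)) down Su.
      by rewrite (_ : _ - _ = - u - 2) //; lia.
    have S2 : S (- u - 2 + 2).
      have := downdir u `|u|%N down Su.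
      by rewrite (_ : _ - _ = - u - 2 + 2) //; lia.
    case: (casimir_inner S1 S2); rewrite (casimir_top Su nSu); congr _%:~R; ring.
  apply/seteqP; split=> n.
    move=> Sn; have [j ej] := even_class Su Sn.
    by have := top_max Su au Sn; exists `|j|%N; lia.
  by move=> [i ->]; exact: downdir.
- have bl : b l = 0 by apply: contrapT => /cb_supp[].
  have up k : S k -> S (k + 2).
    by move=> Sk; apply: contrapT => nS; apply: notop; exists k.
  apply: Or43; exists l.
    (* For l <= 0 the excluded value of the pair -l, -l + 2 is l (l - 2), the Casimir value at the
       bottom. *)
    rewrite leNgt; apply/negP => l1.
    have S1 : S (- l).
      have := updir l `|l|%N up Sl.
      by rewrite (_ : _ + _ = - l) //; lia.
    case: (casimir_inner S1 (up _ S1)); rewrite (casimir_bot Sl nSl); congr _%:~R; ring.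
  apply/seteqP; split=> n.
    move=> Sn; have [j ej] := even_class Sl Sn.
    by have := bot_min Sl bl Sn; exists `|j|%N; lia.
  by move=> [i ->]; exact: updir.
- have up k : S k -> S (k + 2).
    by move=> Sk; apply: contrapT => nS; apply: notop; exists k.
  have down k : S k -> S (k - 2).
    by move=> Sk; apply: contrapT => nS; apply: nobot; exists k.
  have SE : S = parity_weights (odd `|n0|).
    apply/seteqP; split=> n; rewrite /parity_weights /=.
      by move=> Sn; have [j ej] := even_class Sn0 Sn; lia.
    move=> on; have [j [ej|ej]] : exists j : nat, n = n0 + 2 * j%:Z \/ n = n0 - 2 * j%:Z.
        by exists (`|n - n0|./2)%N; lia.
      by rewrite ej; exact: updir.
    by rewrite ej; exact: downdir.
  by case: (odd _) SE => SE; [apply: Or42|apply: Or41].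
Qed.

End ChartFacts.

(** * Tensor products with invertible sheaves *)

(* A subsheaf of a constant sheaf of K-vector spaces, given by its stalks. *)
Record stalks (C : numClosedFieldType) := Stalks {
  stE : lmodType (ratfun C);
  stQ : P1 C -> set stE;
  stQ0 : forall x, stQ x 0;
  stQlin : forall x f m m', reg x f -> stQ x m -> stQ x m' -> stQ x (f *: m + m') }.

Definition st_pred (C : numClosedFieldType) (s : stalks C) (U : zopen C) : {pred stE s} :=
  fun m => `[< forall x, zset U x -> stQ x m >].

Arguments st_pred {C} s U.

Lemma st_pred_zmod (C : numClosedFieldType) (s : stalks C) (U : zopen C) :
  zmod_closed (st_pred s U).
Proof.
split=> [|m m' /asboolP h /asboolP h']; apply/asboolP => x Ux; first exact: stQ0.
by rewrite addrC -scaleN1r; apply: stQlin; [exact/regN/reg1|exact: h'|exact: h].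
Qed.

HB.instance Definition _ (C : numClosedFieldType) (s : stalks C) (U : zopen C) :=
  GRing.isZmodClosed.Build (stE s) (st_pred s U) (st_pred_zmod s U).

Record st_sec (C : numClosedFieldType) (s : stalks C) (U : zopen C) := StSec {
  st_val :> stE s;
  st_valP : st_val \in st_pred s U }.

HB.instance Definition _ (C : numClosedFieldType) (s : stalks C) (U : zopen C) :=
  [isSub for @st_val C s U].
HB.instance Definition _ (C : numClosedFieldType) (s : stalks C) (U : zopen C) :=
  [Choice of st_sec s U by <:].
HB.instance Definition _ (C : numClosedFieldType) (s : stalks C) (U : zopen C) :=
  [SubChoice_isSubZmodule of st_sec s U by <:].

Section StalkSheaf.
Variables (C : numClosedFieldType) (s : stalks C).
Implicit Types (U V W : zopen C).

Lemma st_reg U (m : st_sec s U) x : zset U x -> stQ x (st_val m).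
Proof. by move=> Ux; have /asboolP := st_valP m; apply. Qed.

Lemma st_val_inj U (m m' : st_sec s U) : st_val m = st_val m' -> m = m'.
Proof. exact: val_inj. Qed.

Definition st_mk U (m : stE s) (H : forall x, zset U x -> stQ x m) : st_sec s U :=
  StSec (introT (asboolP _) H : m \in st_pred s U).

Lemma st_scaleP U (f : O U) (m : st_sec s U) x : zset U x -> stQ x (Oval f *: st_val m).
Proof.
move=> Ux; rewrite -[_ *: _]addr0.
by apply: stQlin; [exact: Oreg|exact: st_reg|exact: stQ0].
Qed.

Definition st_scale U (f : O U) (m : st_sec s U) : st_sec s U := st_mk (@st_scaleP U f m).

Lemma st_valD U (m m' : st_sec s U) : st_val (m + m') = st_val m + st_val m'.
Proof. by []. Qed.

Lemma st_scaleA U (f g : O U) (m : st_sec s U) :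
  st_scale f (st_scale g m) = st_scale (f * g) m.
Proof. by apply: st_val_inj; rewrite /= scalerA. Qed.
Lemma st_scale1 U : left_id 1 (@st_scale U).
Proof. by move=> m; apply: st_val_inj; rewrite /= scale1r. Qed.
Lemma st_scaleDr U : right_distributive (@st_scale U) +%R.
Proof. by move=> f m m'; apply: st_val_inj; rewrite /= scalerDr. Qed.
Lemma st_scaleDl U (m : st_sec s U) : {morph (@st_scale U)^~ m : f g / f + g}.
Proof. by move=> f g; apply: st_val_inj; rewrite st_valD /= scalerDl. Qed.

HB.instance Definition _ U := GRing.Zmodule_isLmodule.Build (O U) (st_sec s U)
  (@st_scaleA U) (@st_scale1 U) (@st_scaleDr U) (@st_scaleDl U).

Definition st_res U V (h : V `<=` U) (m : st_sec s U) : st_sec s V :=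
  st_mk (fun x Vx => st_reg m (h x Vx)).

Lemma st_sep U (I : Type) (V : I -> zopen C) (hV : forall i, V i `<=` U) :
  (forall x, zset U x -> exists i, zset (V i) x) ->
  forall m m' : st_sec s U, (forall i, st_res (hV i) m = st_res (hV i) m') -> m = m'.
Proof.
move=> cov m m' e; have [x Ux] := zopen_nonempty U; have [i _] := cov x Ux.
by apply: st_val_inj; have /(congr1 (@st_val _ _ _)) := e i.
Qed.

Lemma st_glue U (I : Type) (V : I -> zopen C) (hV : forall i, V i `<=` U) :
  (forall x, zset U x -> exists i, zset (V i) x) ->
  forall t : forall i, st_sec s (V i),
  (forall i j W (hi : W `<=` V i) (hj : W `<=` V j), st_res hi (t i) = st_res hj (t j)) ->
  exists m : st_sec s U, forall i, st_res (hV i) m = t i.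
Proof.
move=> cov t compat.
have same i j : st_val (t i) = st_val (t j).
  have := compat i j (capU (V i) (V j)) (@capUl C _ _) (@capUr C _ _).
  by move/(congr1 (@st_val _ _ _)).
have [x0 Ux0] := zopen_nonempty U; have [i0 _] := cov x0 Ux0.
have H x : zset U x -> stQ x (st_val (t i0)).
  by move=> /cov[i Vx]; rewrite (same i0 i); exact: st_reg.
by exists (st_mk H) => i; apply: st_val_inj; exact: same.
Qed.

Definition st_sheaf : sheaf C.
Proof.
refine (@Sheaf C (fun U => st_sec s U) st_res _ _ _ _ st_sep st_glue).
- by move=> U h m; apply: st_val_inj.
- by move=> U V W hVU hWV hWU m; apply: st_val_inj.
- by move=> U V h m m'; apply: st_val_inj.
- by move=> U V h f f' m e; apply: st_val_inj; rewrite /= e.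
Defined.

End StalkSheaf.

(** * A local criterion for tensor products of sheaves *)

Section TensorCriterion.
Variables (C : numClosedFieldType) (F L T : sheaf C).
Variable b : forall U : zopen C, F U -> L U -> T U.
Implicit Types (U V W : zopen C).
Hypothesis bb : bilinear_sheaf_map b.

Lemma bil_l U f (m m' : F U) l : b (f *: m + m') l = f *: b m l + b m' l.
Proof. by case: bb => /(_ U)[_ h] _; exact: h. Qed.
Lemma bil_res U V (h : V `<=` U) (m : F U) l : res h (b m l) = b (res h m) (res h l).
Proof. by case: bb => _; exact. Qed.

(** Over such an open set elements of [T] can be divided by [e], which is how maps out of [T] are
    defined. *)
Definition good U (e : L U) : Prop :=
  trivializes (fun V => [set: L V]) e /\
  forall V (h : V `<=` U),
    (forall m m' : F V, b m (res h e) = b m' (res h e) -> m = m') /\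
    (forall t : T V, exists m : F V, b m (res h e) = t).

Hypothesis good_cover : forall x : P1 C, exists U (e : L U), zset U x /\ good e.

Lemma good_res U V (h : V `<=` U) (e : L U) : good e -> good (res h e).
Proof.
move=> [[_ tr] bij]; split=> [|W hW]; last first.
  have hWU : W `<=` U by move=> x /hW/h.
  by rewrite (resK h hW hWU); exact: bij.
split=> // W hW; have hWU : W `<=` U by move=> x /hW/h.
by rewrite (resK h hW hWU); exact: tr.
Qed.

Record local U := Local { loU : zopen C; loe : L loU; lo_sub : loU `<=` U; lo_good : good loe }.

Lemma local_cover U x : zset U x -> exists i : local U, zset (loU i) x.
Proof.
move=> Ux; have [V [e [Vx ge]]] := good_cover x.
by exists (Local (@capUl C U V) (good_res (@capUr C U V) ge)).
Qed.

Lemma local_inj U (e : L U) (m m' : F U) : good e -> b m e = b m' e -> m = m'.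
Proof. by move=> [_ bij]; have [+ _] := bij U (fun x h => h); rewrite res_id; exact. Qed.

Lemma local_surj U (e : L U) (t : T U) : good e -> exists m : F U, b m e = t.
Proof. by move=> [_ bij]; have [_] := bij U (fun x h => h); rewrite res_id; exact. Qed.

Lemma local_gen U (e l : L U) : good e -> exists f : O U, l = f *: e.
Proof.
move=> [[_ tr] _]; have [_ /(_ l I)[f [h _]]] := tr U (fun x h => h).
by rewrite res_id in h; exists f.
Qed.

Definition divide U (e : L U) (t : T U) (ge : good e) : F U :=
  projT1 (cid (local_surj t ge)).
Lemma divideK U (e : L U) (t : T U) (ge : good e) : b (divide t ge) e = t.
Proof. exact: (projT2 (cid (local_surj t ge))). Qed.

Lemma divideE U (e : L U) (t : T U) (ge : good e) m : b m e = t -> divide t ge = m.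
Proof. by move=> h; apply: (local_inj ge); rewrite divideK. Qed.

Variables (G : sheaf C) (c : forall U : zopen C, F U -> L U -> G U).
Hypothesis cc : bilinear_sheaf_map c.

Lemma cil_l U f (m m' : F U) l : c (f *: m + m') l = f *: c m l + c m' l.
Proof. by case: cc => /(_ U)[_ h] _; exact: h. Qed.
Lemma cil_res U V (h : V `<=` U) (m : F U) l : res h (c m l) = c (res h m) (res h l).
Proof. by case: cc => _; exact. Qed.

Lemma bil_swap U f (m : F U) l : b (f *: m) l = b m (f *: l).
Proof.
case: bb => /(_ U)[hl hr] _; rewrite (lin_Z (hl m)).
exact: (lin_Z (hr l)).
Qed.
Lemma cil_swap U f (m : F U) l : c (f *: m) l = c m (f *: l).
Proof.
case: cc => /(_ U)[hl hr] _; rewrite (lin_Z (hl m)).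
exact: (lin_Z (hr l)).
Qed.

(** The only possible value at [t], which is the product of [divide t ge] and [e]. *)
Definition induced U (e : L U) (ge : good e) (t : T U) : G U := c (divide t ge) e.

(** Another generator is a multiple of [e], and the factor moves across both bilinear maps. *)
Lemma induced_indep U (e e' : L U) (ge : good e) (ge' : good e') t :
  induced ge t = induced ge' t.
Proof.
have [f ef] := local_gen e' ge; rewrite /induced.
rewrite (@divideE _ _ _ _ (f *: divide t ge')); first by rewrite cil_swap -ef.
by rewrite bil_swap -ef divideK.
Qed.

Lemma induced_res U V (h : V `<=` U) (e : L U) (ge : good e) (ge' : good (res h e)) t :
  res h (induced ge t) = induced ge' (res h t).
Proof.
rewrite /induced cil_res; congr c; apply/esym/divideE.
by rewrite -bil_res divideK.
Qed.

Lemma induced_lin U (e : L U) (ge : good e) : linear (induced ge).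
Proof.
move=> f t t'; rewrite /induced -cil_l; congr c; apply: divideE.
by rewrite bil_l !divideK.
Qed.

Lemma induced_glue U (t : T U) : exists g : G U, forall i : local U,
  res (@lo_sub U i) g = induced (lo_good i) (res (@lo_sub U i) t).
Proof.
apply: (@sheaf_glue _ G U (local U) (@loU U) (@lo_sub U) (@local_cover U)) => i j W hi hj.
have gi := good_res hi (lo_good i); have gj := good_res hj (lo_good j).
have hWU : W `<=` U by move=> x /hi/(@lo_sub _ i).
rewrite (induced_res _ gi) (induced_res _ gj) (induced_indep gi gj).
by rewrite !(resK _ _ hWU).
Qed.

Definition tmap U (t : T U) : G U := projT1 (cid (induced_glue t)).
Lemma tmapE U (t : T U) (i : local U) :
  res (@lo_sub U i) (tmap t) = induced (lo_good i) (res (@lo_sub U i) t).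
Proof. exact: (projT2 (cid (induced_glue t))). Qed.

Lemma local_sep U (g g' : G U) :
  (forall i : local U, res (@lo_sub U i) g = res (@lo_sub U i) g') -> g = g'.
Proof. exact: (sheaf_sep (@local_cover U)). Qed.

Lemma tmap_unique : exists! h : forall U : zopen C, T U -> G U,
  sheaf_map h /\ forall U m l, h U (b m l) = c m l.
Proof.
exists tmap; split.
  split; first split.
  - move=> U f t t'; apply: local_sep => i; rewrite tmapE res_add resZ.
    by rewrite induced_lin res_add resZ !tmapE.
  - move=> U V h t; apply: local_sep => i; rewrite tmapE.
    have hU : loU i `<=` U by move=> x /(@lo_sub _ i)/h.
    rewrite (resK h _ hU) (resK h _ hU).
    exact: (@tmapE U t (Local hU (lo_good i))).
  - move=> U m l; apply: local_sep => i; rewrite tmapE cil_res bil_res.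
    have [f ->] := local_gen (res (@lo_sub U i) l) (lo_good i).
    rewrite -bil_swap -cil_swap /induced; congr c.
    exact: divideE.
move=> h [[hl hr] hb]; apply: functional_extensionality_dep => U; apply: funext => t.
apply: local_sep => i; rewrite tmapE hr.
by rewrite -[in RHS](divideK (res (@lo_sub U i) t) (lo_good i)) hb.
Qed.

End TensorCriterion.

Lemma tensor_criterion (C : numClosedFieldType) (F L T : sheaf C)
    (b : forall U : zopen C, F U -> L U -> T U) : bilinear_sheaf_map b ->
  (forall x : P1 C, exists U (e : L U), zset U x /\ good b e) -> is_sheaf_tensor b.
Proof. by move=> bb gc; split=> // G c cc; exact: tmap_unique. Qed.

(** * The line bundles O(e) *)

Section Twist.
Variable C : numClosedFieldType.
Local Notation K := (ratfun C).
Local Notation z := (zfun C).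
Implicit Types (U V W : zopen C).

Lemma twreg0 (e : int) p : twreg e p (0 : K).
Proof. by rewrite /twreg mul0r; case: p => *; exact: reg0. Qed.

Lemma twreg_lin (e : int) p (f g h : K) : reg p f -> twreg e p g -> twreg e p h ->
  twreg e p (f * g + h).
Proof.
rewrite /twreg; case: p => [t|] rf rg rh; last rewrite mulrDl -mulrA;
  by apply: regD => //; exact: regM.
Qed.

Lemma twregM (e e' : int) p (f g : K) : twreg e p f -> twreg e' p g -> twreg (e + e') p (f * g).
Proof.
rewrite /twreg; case: p => [t|] rf rg; first exact: regM.
by rewrite opprD expfzDr ?zfun_neq0 // mulrACA; exact: regM.
Qed.

(** O(e) as a subsheaf of the constant sheaf of rational functions. *)
Definition twist_stalks (e : int) : stalks C :=
  @Stalks C (K^o) (fun p => [set f | twreg e p f]) (fun p => twreg0 e p)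
    (fun p f g h => @twreg_lin e p f g h).

Definition twist (e : int) : sheaf C := st_sheaf (twist_stalks e).

Definition tval (e : int) U (l : twist e U) : K := st_val l.

Lemma tval_reg e U (l : twist e U) p : zset U p -> twreg e p (tval l).
Proof. exact: (@st_reg _ (twist_stalks e) U l p). Qed.

Lemma tval_inj e U (l l' : twist e U) : tval l = tval l' -> l = l'.
Proof. exact: (@st_val_inj _ (twist_stalks e) U l l'). Qed.

(** The generator is 1 over the finite line and z^e near infinity. *)
Lemma twist_gen e (x : P1 C) : exists (U : zopen C) (l : twist e U),
  [/\ zset U x, tval l != 0 &
      forall p (f : K), zset U p -> twreg e p f <-> reg p (f / tval l)].
Proof.
case: x => [t|].
  have H p : zset (U0 C) p -> twreg e p (1 : K) by move=> /U0P[s ->]; exact: reg1.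
  exists (U0 C), (st_mk (s := twist_stalks e) H); split.
  - by apply/U0P; exists t.
  - exact: oner_neq0.
  - by move=> p f /U0P[s ->]; rewrite /tval /= divr1.
have zu p : zset (Uinf C) p -> forall k : int, p != None -> uniat p (z ^ k).
  case: p => [s|//] /UinfP sp k _; apply/uniatX/uniat_z.
  by apply: contra_neq sp => ->.
have H p : zset (Uinf C) p -> twreg e p (z ^ e).
  move=> Up; rewrite /twreg; case: p Up => [s|] Up; first exact/uniat_reg/zu.
  by rewrite -expfzDr ?zfun_neq0 // subrr expr0z; exact: reg1.
exists (Uinf C), (st_mk (s := twist_stalks e) H); split => //.
  by rewrite /tval /= expfz_neq0 ?zfun_neq0.
move=> p f Up; rewrite /tval /= /twreg; case: p Up => [s|] Up; last by rewrite invr_expz.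
split=> r; first by apply: regM => //; exact/uniat_reg/uniatV/zu.
by apply: reg_uniatM r; apply/uniatV/zu.
Qed.

Lemma twist_trivializes e U (l : twist e U) : tval l != 0 ->
  (forall p (f : K), zset U p -> twreg e p f <-> reg p (f / tval l)) ->
  trivializes (fun V => [set: twist e V]) l.
Proof.
move=> l0 hl; split=> // V h; split=> // m _.
have r p : zset V p -> reg p (tval m / tval l).
  by move=> Vp; apply/hl; [exact: h|exact: tval_reg].
exists (mkO r); split.
  by apply: tval_inj; rewrite /tval /= -[RHS]/(tval m / tval l * tval l) divfK.
move=> f ef; apply: OvalE; rewrite /= ef /tval /=.
by rewrite -[X in X / _]/(Oval f * tval l) mulfK.
Qed.

Lemma twist_invertible e : invertible (twist e).
Proof.
move=> x; have [U [l [Ux l0 hl]]] := twist_gen e x.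
by exists U, l; split => //; exact: twist_trivializes.
Qed.

End Twist.

Section Picard.
Variables (C : numClosedFieldType) (F F' : hcmodule C) (c : chart F) (c' : chart F').
Local Notation K := (ratfun C).
Local Notation z := (zfun C).
Variables (e : int) (psi : int -> C).
Hypothesis psi0 : forall n, psi n != 0.
Hypothesis eS : cS c' = cS c.
Hypothesis ed : forall n, cS c n -> cd c' n = cd c n + e.
Hypothesis ea : forall n, ca c' n * constfun (psi n) = constfun (psi (n + 2)) * ca c n.
Hypothesis eb : forall n, cb c' n * constfun (psi n) = constfun (psi (n - 2)) * cb c n.
Implicit Types (U V W : zopen C).

(** Coordinates are multiplied by the section of O(e) and, weight by weight, by the constants [psi],
    which intertwine the arrows of the two modules. *)
Lemma pairing_ex U (m : F U) (l : twist C e U) :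
  exists m' : F' U, ck c' m' = (fun n => constfun (psi n) * ck c m n * tval l).
Proof.
apply: ck_surj.
- by have [E hE] := ck_fin c m; exists E => n nE; rewrite hE // mulr0 mul0r.
- by move=> n; rewrite eS => nS; rewrite (ck_out _ nS) mulr0 mul0r.
- move=> n p Up; have [Sn|nS] := pselect (cS c n); last first.
    by rewrite (ck_out _ nS) mulr0 mul0r; exact: twreg0.
  rewrite ed // -mulrA -[_ * _]addr0.
  apply: twreg_lin; [exact: regC| |exact: twreg0].
  by apply: twregM; [exact: ck_reg|exact: tval_reg].
Qed.

Definition pairing U (m : F U) (l : twist C e U) : F' U := projT1 (cid (pairing_ex m l)).
Lemma pairingE U (m : F U) (l : twist C e U) n :
  ck c' (pairing m l) n = constfun (psi n) * ck c m n * tval l.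
Proof. by rewrite /pairing (projT2 (cid (pairing_ex m l))). Qed.

Lemma pairing_bilinear : bilinear_sheaf_map pairing.
Proof.
split=> [U|U V h m l]; last first.
  by apply: (@ck_inj _ _ c'); apply: funext => n; rewrite ck_res !pairingE ck_res.
split=> [m f l l'|l f m m']; apply: (@ck_inj _ _ c'); apply: funext => n.
  rewrite ck_lin !pairingE /tval /= -/(tval l) -/(tval l').
  rewrite -[X in _ * X = _]/(Oval f * tval l + tval l') mulrDr.
  by congr (_ + _); rewrite mulrCA.
rewrite ck_lin !pairingE ck_lin mulrDr mulrDl !mulrA; congr (_ + _).
by congr (_ * _ * _); rewrite mulrC.
Qed.

Lemma pairing_picard : picard_equiv F F'.
Proof.
exists (twist C e), pairing; split.
- exact: twist_invertible.
- apply: tensor_criterion; first exact: pairing_bilinear.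
  move=> x; have [U [l [Ux l0 hl]]] := twist_gen e x.
  exists U, l; split=> //; split; first exact: twist_trivializes.
  move=> V h; have pE (m : F V) n : ck c' (pairing m (res h l)) n =
      constfun (psi n) * ck c m n * tval l by rewrite pairingE.
  have p0 n : constfun (psi n) != 0 by rewrite constfun_eq0.
  split=> [m m' em|t].
    apply: (@ck_inj _ _ c); apply: funext => n.
    have := congr1 (fun u => ck c' u n) em; rewrite !pE => /(mulIf l0).
    exact: (mulfI (p0 n)).
  have [||n p Vp|m em] := @ck_surj _ _ c V (fun n => constfun (psi n)^-1 * (ck c' t n / tval l)).
  - by have [E hE] := ck_fin c' t; exists E => n nE; rewrite hE // mul0r mulr0.
  - by move=> n nS; rewrite ck_out ?eS // mul0r mulr0.
  - have [Sn|nS] := pselect (cS c n); last first.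
      by rewrite ck_out ?eS // mul0r mulr0; exact: twreg0.
    rewrite -[_ * _]addr0; apply: twreg_lin; [exact: regC| |exact: twreg0].
    have := ck_reg c' t n Vp; rewrite ed // => r.
    case: p Vp r => [s|] Vp r; first by have [+ _] := hl _ (ck c' t n) (h _ Vp); exact.
    rewrite /twreg mulrAC; have [+ _] := hl _ (ck c' t n * z ^ (- cd c n)) (h _ Vp); apply.
    by rewrite /twreg -mulrA -expfzDr ?zfun_neq0 // -opprD.
  - exists m; apply: (@ck_inj _ _ c'); apply: funext => n; rewrite pE em.
    by rewrite mulrA -rmorphM divff // rmorph1 mul1r divfK.
- move=> U t m l t0; apply: (@ck_inj _ _ c'); apply: funext => n.
  rewrite ck_kact // !pairingE ck_kact // !mulrA; congr (_ * _ * _).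
  by rewrite mulrC.
- move=> U xi m l /[dup] g /gsecP[h [x [y [exi _]]]]; rewrite exi in g *.
  apply: (@ck_inj _ _ c'); apply: funext => n.
  rewrite ck_gact // !pairingE ck_gact //.
  have := ea (n - 2); have := eb (n + 2); rewrite addrK subrK.
  move: (ck c m n) (ck c m (n - 2)) (ck c m (n + 2)) (n%:~R : K) => k0 k1 k2 nn.
  move: (ca c _) (ca c' _) (cb c _) (cb c' _) => a a' b b'.
  move: (constfun _) (constfun _) (constfun _) (tval l) => p0 p1 p2 t e1 e2.
  rewrite [y * b' * _](_ : _ = y * (b' * p2) * k2 * t); last by ring.
  rewrite [x * a' * _](_ : _ = x * (a' * p0) * k1 * t); last by ring.
  rewrite e1 e2; ring.
Qed.

End Picard.

(** * Uniqueness *)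

(** The solution with G 0 = 1: a product upwards, the inverse of a product downwards. *)
Lemma solve_rec1 (K : fieldType) (g : int -> K) : (forall n, g n != 0) ->
  exists G : int -> K, (forall n, G n != 0) /\ forall n, G (n + 1) = g n * G n.
Proof.
move=> g0.
exists (fun n => match n with
  | Posz k => \prod_(i < k) g i%:Z | Negz k => (\prod_(i < k.+1) g (- i.+1%:Z))^-1 end).
split=> [[k|k]|[k|[|k]]].
- by apply/prodf_neq0 => i _; exact: g0.
- by rewrite invr_eq0; apply/prodf_neq0 => i _; exact: g0.
- by rewrite addrC -[1 + _]/(Posz (1 + k)) add1n big_ord_recr mulrC.
- by rewrite (_ : Negz 0 + 1 = 0%:Z) //= big_ord0 big_ord1 divff.
- have -> : Negz k.+1 + 1 = Negz k by lia.
  rewrite [\prod_(i < k.+2) _]big_ord_recr /= invfM mulrCA NegzE divff ?mulr1 //.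
Qed.

(** The two parities give independent recurrences with step 1. *)
Lemma solve_rec2 (K : fieldType) (g : int -> K) : (forall n, g n != 0) ->
  exists G : int -> K, (forall n, G n != 0) /\ forall n, G (n + 2) = g n * G n.
Proof.
move=> g0; have [G0 [G00 h0]] := @solve_rec1 K (fun k => g (2 * k)) (fun k => g0 _).
have [G1 [G10 h1]] := @solve_rec1 K (fun k => g (2 * k + 1)) (fun k => g0 _).
exists (fun n => if (2 %| n)%Z then G0 (n %/ 2)%Z else G1 (n %/ 2)%Z).
split=> [n|n]; first by case: ifP.
have -> : (2 %| n + 2)%Z = (2 %| n)%Z by lia.
have -> : ((n + 2) %/ 2)%Z = (n %/ 2)%Z + 1 by lia.
by case: ifP => h; rewrite ?h0 ?h1; congr (g _ * _); lia.
Qed.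

Section Uniqueness.
Variables (C : numClosedFieldType) (F F' : hcmodule C) (c : chart F) (c' : chart F').
Local Notation K := (ratfun C).
Local Notation z := (zfun C).
Hypotheses (irr : chart_irreducible c) (irr' : chart_irreducible c').
Hypothesis eS : cS c' = cS c.
Hypothesis eyx : forall n, cS c n -> yx c' n = yx c n.
Hypothesis step : forall n, cS c n -> cS c (n + 2) -> exists s : int, (s = 1 \/ s = -1) /\
  cd c (n + 2) = cd c n + s /\ cd c' (n + 2) = cd c' n + s.

(** This jump of the degree cancels the twist in the regularity condition at infinity. *)
Lemma ca_const G (k : chart G) n : cd k (n + 2) = cd k n - 1 -> exists t : C, ca k n = constfun t.
Proof.
move=> e; apply: const_of_reg => -[s|]; first exact: ca_reg0.
have := ca_reginf k n; rewrite e opprD opprK addrA subrr add0r subrr.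
by rewrite expr0z mulr1.
Qed.

Lemma cb_const G (k : chart G) n : cd k (n + 2) = cd k n + 1 ->
  exists t : C, z * cb k (n + 2) = constfun t.
Proof.
move=> e; apply: const_of_reg => -[s|]; first exact: cb_reg0.
have := cb_reginf k (n + 2); rewrite addrK e addrAC subrr add0r.
by rewrite expr1z mulrC.
Qed.

(** The jump of the degree makes either the X arrows or z times the Y arrows constant in both
    modules, so their ratio is a constant. Equal products [yx] make the ratio of the other arrows
    its inverse. *)
Lemma ratio n : exists r : C, r != 0 /\ ca c' n = constfun r * ca c n /\
  cb c' (n + 2) = constfun r^-1 * cb c (n + 2).
Proof.
(* Unless [n] and n + 2 are both weights, all four coefficients vanish and r = 1 serves. *)
have [[Sn S2]|nS] := pselect (cS c n /\ cS c (n + 2)); last first.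
  have a0 : ca c n = 0 by apply: contrapT => /ca_supp.
  have a0' : ca c' n = 0 by apply: contrapT => /ca_supp; rewrite eS.
  have b0 : cb c (n + 2) = 0.
    by apply: contrapT => /cb_supp; rewrite addrK => -[S2 Sn]; apply: nS.
  have b0' : cb c' (n + 2) = 0.
    by apply: contrapT => /cb_supp; rewrite eS addrK => -[S2 Sn]; apply: nS.
  by exists 1; rewrite oner_neq0 a0 a0' b0 b0' !mulr0.
have /eqP an := ca_neq0 irr Sn S2; have /eqP bn := cb_neq0 irr Sn S2.
have /eqP an' : ca c' n <> 0 by apply: ca_neq0; rewrite ?eS.
have /eqP bn' : cb c' (n + 2) <> 0 by apply: cb_neq0; rewrite ?eS.
have ey : ca c' n * cb c' (n + 2) = ca c n * cb c (n + 2) := eyx Sn.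
have [s [[->|->] [e e']]] := step Sn S2.
- have [t et] := cb_const e; have [t' et'] := cb_const e'.
  have z0 := zfun_neq0 C.
  have t0 : t != 0 by rewrite -constfun_eq0 -et; exact: (mulf_neq0 z0 bn).
  have t0' : t' != 0 by rewrite -constfun_eq0 -et'; exact: (mulf_neq0 z0 bn').
  have eb : cb c' (n + 2) = constfun (t' / t) * cb c (n + 2).
    apply: (mulfI z0); rewrite et' mulrCA et -rmorphM divfK //.
  exists (t / t'); split; first exact: (div_neq0 t0 t0').
  split; last by rewrite invf_div.
  have tt : t / t' * (t' / t) = 1 by rewrite mulrA divfK ?divff.
  by apply: (mulIf bn'); rewrite ey eb mulrACA -rmorphM tt rmorph1 mul1r.
- have [t et] := ca_const e; have [t' et'] := ca_const e'.
  have t0 : t != 0 by rewrite -constfun_eq0 -et; exact: an.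
  have t0' : t' != 0 by rewrite -constfun_eq0 -et'; exact: an'.
  have ea : ca c' n = constfun (t' / t) * ca c n by rewrite et et' -rmorphM divfK.
  exists (t' / t); split; first exact: (div_neq0 t0' t0).
  split; first exact: ea.
  apply: (mulfI an'); rewrite ey ea mulrACA -rmorphM divff ?rmorph1 ?mul1r //.
  exact: (div_neq0 t0' t0).
Qed.

Lemma chart_unique : picard_equiv F F'.
Proof.
have [r hr] := choice ratio.
have [psi [psi0 hpsi]] := solve_rec2 (fun n => (hr n).1).
have [n0 Sn0] := irr.1.
(* The degrees jump alike in both modules, so the twist can be read off at any one weight. *)
apply: (@pairing_picard C F F' c c' (cd c' n0 - cd c n0) psi) => //.
- move=> n Sn; suff : cd c' n - cd c n = cd c' n0 - cd c n0 by lia.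
  move: n Sn; apply: (@chart_closed _ _ c irr [set n | cd c' n - cd c n = cd c' n0 - cd c n0] n0) => //.
  + by move=> n /= e Sn S2; have [s [_ [-> ->]]] := step Sn S2; lia.
  + move=> n /= e Sn S2; have := step S2; rewrite subrK => /(_ Sn)[s [_ [e1 e2]]].
    by lia.
- by move=> n; have [_ [-> _]] := hr n; rewrite hpsi rmorphM mulrAC.
- move=> n; have [r0 [_]] := hr (n - 2); rewrite subrK => ->.
  have := hpsi (n - 2); rewrite subrK => ->.
  rewrite mulrAC -rmorphM mulrA mulVf // mul1r.
  by [].
Qed.

End Uniqueness.

(** The jump of the degree from [n] to n + 2. Below [k] the conditions of I and II run downwards,
    whence the opposite sign; as the weights share the parity of [k], n < k means n + 2 <= k. *)
Definition step_sign (cl : hcclass) (n : int) : int :=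
  match cl with
  | ClassI k => if k <= n then -1 else 1
  | ClassII k => if k <= n then 1 else -1
  | ClassIII => 1
  | ClassIV => -1
  end.

Lemma in_class_step (C : numClosedFieldType) (F : hcmodule C) (c : chart F) cl n :
  chart_irreducible c -> in_class cl F -> cS c n -> cS c (n + 2) ->
  cd c (n + 2) = cd c n + step_sign cl n.
Proof.
move=> irr; have wS : weights F = cS c := weights_chart c => icl Sn S2.
have wd k : cS c k -> wdegree F k = cd c k := @wdegree_chart _ _ c k.
have up k e : step_up F k e -> cS c k -> cS c (k + 2) -> cd c (k + 2) = cd c k + e.
  by move=> h Sk Sk2; rewrite -!wd //; apply: h; rewrite wS.
have down k e : step_down F k e -> cS c k -> cS c (k - 2) -> cd c (k - 2) = cd c k + e.
  by move=> h Sk Sk2; rewrite -!wd //; apply: h; rewrite wS.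
have par k : cS c k -> k <= n \/ n + 2 <= k.
  by move=> Sk; have [j e] := even_class irr Sn Sk; lia.
case: cl icl => [k|k||] /= icl; last 2 first.
- exact: up (icl n) Sn S2.
- exact: up (icl n) Sn S2.
- move: icl; rewrite wS => -[/par pk hu hd]; case: ifP => kn.
    exact: up (hu n kn) Sn S2.
  have nk : n + 2 <= k by case: pk => //; rewrite kn.
  by have := down (n + 2) _ (hd _ nk) S2; rewrite addrK => /(_ Sn) ->; ring.
- move: icl; rewrite wS => -[/par pk hu hd]; case: ifP => kn.
    exact: up (hu n kn) Sn S2.
  have nk : n + 2 <= k by case: pk => //; rewrite kn.
  by have := down (n + 2) _ (hd _ nk) S2; rewrite addrK => /(_ Sn) ->; ring.
Qed.

Lemma step_in_class (C : numClosedFieldType) (F : hcmodule C) (c : chart F) cl :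
  chart_irreducible c -> class_allows cl (cS c) ->
  (forall n, cS c n -> cS c (n + 2) -> cd c (n + 2) = cd c n + step_sign cl n) ->
  in_class cl F.
Proof.
move=> irr; have wS : weights F = cS c := weights_chart c => al h.
have wd k : cS c k -> wdegree F k = cd c k := @wdegree_chart _ _ c k.
have up n : step_up F n (step_sign cl n).
  by move=> Sn S2; rewrite wS in Sn S2; rewrite !wd //; exact: h.
have down n : step_down F n (- step_sign cl (n - 2)).
  move=> Sn S2; rewrite wS in Sn S2; rewrite !wd //.
  by have := h (n - 2) S2; rewrite subrK => /(_ Sn) ->; ring.
case: cl al up down h => [k|k||] /= al up down h.
- split=> [|n kn|n nk]; first by rewrite wS.
    by have := up n; rewrite kn.
  have := down n; rewrite ifF ?opprK //.
  by apply/negbTE; rewrite -ltNge; lia.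
- split=> [|n kn|n nk]; first by rewrite wS.
    by have := up n; rewrite kn.
  have := down n; rewrite ifF ?opprK //.
  by apply/negbTE; rewrite -ltNge; lia.
- by move=> n; exact: up.
- by move=> n; exact: up.
Qed.

(** One solution of the recursion given by [step_sign]; rounding down makes it hold for [n] of
    either parity. *)
Definition class_degree (cl : hcclass) (n : int) : int :=
  match cl with
  | ClassI k => - `|((n - k) %/ 2)%Z|
  | ClassII k => `|((n - k) %/ 2)%Z|
  | ClassIII => (n %/ 2)%Z
  | ClassIV => - (n %/ 2)%Z
  end.

Lemma class_degree_step cl n : class_degree cl (n + 2) = class_degree cl n + step_sign cl n.
Proof. by case: cl => [k|k||] /=; try case: ifP => kn; lia. Qed.

Theorem class_unique (C : numClosedFieldType) (F F' : hcmodule C) (c : chart F) (c' : chart F')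
    cl (q : ratfun C) : chart_irreducible c -> chart_irreducible c' -> cS c' = cS c ->
  casimir_acts_by F q -> casimir_acts_by F' q -> in_class cl F -> in_class cl F' ->
  picard_equiv F F'.
Proof.
move=> irr irr' eS hq hq' icl icl'; apply: (chart_unique irr irr' eS).
  move=> n Sn; have [q1 h1] := chart_casimir irr; have [q2 h2] := chart_casimir irr'.
  have e1 := casimir_unique irr (casimir_chart h1) hq.
  have e2 := casimir_unique irr' (casimir_chart h2) hq'.
  have [e3 _] := h1 _ Sn; have [|e4 _] := h2 n; first by rewrite eS.
  have : casimir_value c n = casimir_value c' n by rewrite -e3 -e4 e1 e2.
  rewrite /casimir_value => /addrI/mulfI e; apply/esym/e.
  by apply/eqP => /(@intrK_inj _ 4 0).
move=> n Sn S2; exists (step_sign cl n); split.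
  by case: (cl) => [k|k||] /=; try case: ifP => _; first [by left | by right].
split; first exact: in_class_step icl Sn S2.
by apply: in_class_step icl' _ _; rewrite ?eS.
Qed.

(** * Modules from weight data *)

Record submod (A : comNzRingType) (M : lmodType A) := Submod {
  sm_set : set M;
  sm_0 : sm_set 0;
  sm_lin : forall a m m', sm_set m -> sm_set m' -> sm_set (a *: m + m') }.

Definition sm_pred (A : comNzRingType) (M : lmodType A) (P : submod M) : {pred M} :=
  fun m => `[< sm_set P m >].

Lemma sm_pred_submod (A : comNzRingType) (M : lmodType A) (P : submod M) :
  submod_closed (sm_pred P).
Proof.
split=> [|a m m' /asboolP h /asboolP h']; apply/asboolP; first exact: sm_0.
exact: sm_lin.
Qed.

HB.instance Definition _ (A : comNzRingType) (M : lmodType A) (P : submod M) :=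
  GRing.isSubmodClosed.Build A M (sm_pred P) (sm_pred_submod P).

Record sm_sec (A : comNzRingType) (M : lmodType A) (P : submod M) := SmSec {
  sm_val :> M;
  sm_valP : sm_val \in sm_pred P }.

HB.instance Definition _ (A : comNzRingType) (M : lmodType A) (P : submod M) :=
  [isSub for @sm_val A M P].
HB.instance Definition _ (A : comNzRingType) (M : lmodType A) (P : submod M) :=
  [Choice of sm_sec P by <:].
HB.instance Definition _ (A : comNzRingType) (M : lmodType A) (P : submod M) :=
  [SubChoice_isSubLmodule of sm_sec P by <:].

Section Submod.
Variables (A : comNzRingType) (M : lmodType A) (P : submod M).

Lemma sm_in (m : sm_sec P) : sm_set P (sm_val m).
Proof. by have /asboolP := sm_valP m. Qed.

Definition sm_mk m (H : sm_set P m) : sm_sec P := SmSec (introT (asboolP _) H : m \in sm_pred P).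

Lemma sm_inj (m m' : sm_sec P) : sm_val m = sm_val m' -> m = m'.
Proof. exact: val_inj. Qed.

Lemma sm_val_lin : linear (@sm_val A M P).
Proof. by []. Qed.

End Submod.

(* Corestrict the bilinear map to the submodule P and use both halves of the
   universal property. *)
Lemma tensor_ind (A : comNzRingType) (M N T : lmodType A) (b : M -> N -> T) (P : submod T) :
  is_tensor b -> (forall m n, sm_set P (b m n)) -> forall t, sm_set P t.
Proof.
move=> [[bl br] univ] Pb.
have [|h [[hl hb] _]] := univ (sm_sec P) (fun m n => sm_mk (Pb m n)).
  by split=> [m|n] a x y; apply: sm_inj; rewrite sm_val_lin /=; [exact: bl|exact: br].
have [g [_ gu]] := univ T b (conj bl br).
have e1 : g = @sm_val A T P \o h.
  apply: gu; split=> [a x y|m n] /=; last by rewrite hb.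
  by rewrite hl sm_val_lin.
have e2 : g = id by apply: gu; split.
move=> t; rewrite -[t]/(id t) -e2 e1; exact: sm_in.
Qed.

(** * Flatness of free modules *)

Section FreeFlat.
Variables (A : comNzRingType) (M : lmodType A) (I : eqType).
Variables (e : I -> M) (x : I -> M -> A).
Hypothesis xl : forall i a m m', x i (a *: m + m') = a * x i m + x i m'.
Hypothesis basis : forall m, exists s : seq I,
  [/\ uniq s, forall i, i \notin s -> x i m = 0 & m = \sum_(i <- s) x i m *: e i].

(** Each coordinate [x i] induces a map [p i] from the tensor product to [N], and every [t] is a
    finite sum of the tensors of [e i] with [p i t]. On these coordinates [h] acts by the injective
    [f]. *)
Lemma free_flat : flat M.
Proof.
move=> N N' f fl fi T T' b b' tb tb' h hl hb.
have coord_bil (L : lmodType A) i : bilinear_map (fun (m : M) (n : L) => x i m *: n).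
  split=> [m a n n'|n a m m'] /=; last by rewrite xl scalerDl scalerA.
  by rewrite scalerDr !scalerA mulrC.
have /choice[p hp] : forall i, exists p : T -> N,
    linear p /\ forall m n, p (b m n) = x i m *: n.
  by move=> i; case: tb => _ /(_ N _ (coord_bil N i))[p [hp _]]; exists p.
have /choice[p' hp'] : forall i, exists p : T' -> N',
    linear p /\ forall m n, p (b' m n) = x i m *: n.
  by move=> i; case: tb' => _ /(_ N' _ (coord_bil N' i))[q [hq _]]; exists q.
have comm i t : p' i (h t) = f (p i t).
  have [pl pb] := hp i; have [pl' pb'] := hp' i.
  have bil : bilinear_map (fun m n => x i m *: f n).
    split=> [m a n n'|n a m m'] /=; last by rewrite xl scalerDl scalerA.
    by rewrite fl scalerDr !scalerA mulrC.
  case: tb => _ /(_ N' _ bil)[g [_ gu]].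
  have eg1 : g = (fun t => p' i (h t)).
    apply: gu; split=> [a u v|m n]; first by rewrite hl pl'.
    by rewrite hb pb'.
  have eg2 : g = (fun t => f (p i t)).
    apply: gu; split=> [a u v|m n]; first by rewrite pl fl.
    by rewrite pb (lin_Z fl).
  by have := congr1 (fun q => q t) eg2; rewrite eg1.
have [[bl br] _] := tb.
(* The elements with a finite expansion form a submodule containing the pure tensors, hence
   everything. *)
pose Q : set T := [set t | exists s : seq I, [/\ uniq s, forall i, i \notin s -> p i t = 0 &
  t = \sum_(i <- s) b (e i) (p i t)]].
have ext (s s' : seq I) t : uniq s -> uniq s' -> {subset s <= s'} ->
    (forall i, i \notin s -> p i t = 0) ->
    \sum_(i <- s) b (e i) (p i t) = \sum_(i <- s') b (e i) (p i t).
  move=> us us' ss h0; rewrite [RHS](bigID (mem s)) /= [X in _ + X]big1 ?addr0.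
    rewrite -[RHS]big_filter; apply: perm_big; apply: uniq_perm => //.
      exact: filter_uniq.
    by move=> i; rewrite mem_filter; case: (boolP (i \in s)) => // /ss ->.
  by move=> i /h0 ->; rewrite (lin_0 (bl (e i))).
have Q0 : Q 0.
  exists [::]; split => // [i _|]; last by rewrite big_nil.
  exact: lin_0 (hp i).1.
have Ql a t t' : Q t -> Q t' -> Q (a *: t + t').
  move=> [s [us s0 es]] [s' [us' s0' es']]; exists (undup (s ++ s')).
  have ss : {subset s <= undup (s ++ s')} by move=> i; rewrite mem_undup mem_cat => ->.
  have ss' : {subset s' <= undup (s ++ s')} by move=> i; rewrite mem_undup mem_cat orbC => ->.
  have uu := undup_uniq (s ++ s').
  split=> // [i|].
    rewrite mem_undup mem_cat negb_or => /andP[i1 i2]; rewrite (hp i).1 s0 // s0' //.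
    by rewrite scaler0 addr0.
  rewrite {1}es {1}es' (ext _ _ t us uu ss s0) (ext _ _ t' us' uu ss' s0').
  rewrite scaler_sumr -big_split; apply: eq_bigr => i _ /=.
  by rewrite (hp i).1 bl.
have allQ := @tensor_ind A M N T b (Submod Q0 Ql) tb _.
have inj0 t : h t = 0 -> t = 0.
  move=> t0; have [m n|s [_ _ ->]] := allQ _ t.
    have [s [us s0 es]] := basis m; exists s; split => // [i /s0 xi|].
      by rewrite (hp i).2 xi scale0r.
    rewrite {1}es (lin_sum (br n)); apply: eq_bigr => i _.
    by rewrite (hp i).2 (lin_Z (br n)) (lin_Z (bl (e i))).
  rewrite big1 // => i _; have -> : p i t = 0.
    by apply: fi; rewrite -comm t0 (lin_0 (hp' i).1) (lin_0 fl).
  exact: lin_0 (bl (e i)).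
move=> t t' ht; apply/eqP; rewrite -subr_eq0; apply/eqP/inj0.
by rewrite (lin_B hl) ht subrr.
Qed.

End FreeFlat.

Section AffineGenerator.
Variable C : numClosedFieldType.
Local Notation K := (ratfun C).
Local Notation z := (zfun C).

(* g is the d-th power of the linear form vanishing at a point outside U. *)
Lemma affine_twist (U : zopen C) (d : int) : affine U -> exists2 g : K, g != 0 &
  forall p (f : K), zset U p -> twreg d p f <-> reg p (f / g).
Proof.
move=> [x0 nx0]; exists (lin x0 ^ d); first by rewrite expfz_neq0 ?lin_neq0.
move=> p f Up; have px : p != x0 by apply/eqP => e; apply: nx0; rewrite -e.
have u : uniat p (if p is Some _ then lin x0 else lin x0 / z).
  case: p px {Up} => [t|] px.
    by have := uniat_lin px (isT : Some t != None); rewrite linNone divr1.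
  by have := @uniat_lin _ x0 (Some 0) None px isT; rewrite lin0.
have ue : uniat p (if p is Some _ then lin x0 ^ d else lin x0 ^ d / z ^ d).
  by case: (p) u => [t|] /(@uniatX _ _ _ d) //; rewrite expfzMl exprz_inv invr_expz.
case: p px Up u ue => [t|] px Up u ue; rewrite /twreg.
  split=> r; first by apply: regM => //; exact/uniat_reg/uniatV.
  by apply: reg_uniatM r; exact: uniatV.
have zd : z ^ d != 0 by rewrite expfz_neq0 ?zfun_neq0.
have -> : f * z ^ (- d) = f / lin x0 ^ d * (lin x0 ^ d / z ^ d).
  by rewrite -invr_expz mulrA divfK ?expfz_neq0 ?lin_neq0.
split=> r; first exact: reg_uniatM ue r.
exact: (regM r (uniat_reg ue)).
Qed.

End AffineGenerator.

Lemma seq_bound (T : eqType) (s : seq T) (P : T -> nat -> Prop) :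
  (forall t, t \in s -> exists k, forall l, (k <= l)%N -> P t l) ->
  exists k, forall t, t \in s -> P t k.
Proof.
move=> h; suff [k hk] : exists k, forall t, t \in s -> forall l, (k <= l)%N -> P t l.
  by exists k => t ts; exact: hk.
elim: s h => [|u s IH] h; first by exists 0%N.
have [k hk] := IH (fun t ts => h t (mem_behead (s := u :: s) ts)).
have [k' hk'] := h u (mem_head u s).
exists (maxn k k') => t; rewrite in_cons => /orP[/eqP->|ts] l kl.
  by apply: hk'; exact: leq_trans (leq_maxr _ _) kl.
by apply: hk => //; exact: leq_trans (leq_maxl _ _) kl.
Qed.

(** The difference of the two sides is a multiple of the relation XY - YX = H in weight [n], which
    is the hypothesis. *)
Lemma weight_bracket (R : comNzRingType) (a b : int -> R) h x y h' x' y' (w : int -> R) n :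
  let act h x y w n := h * n%:~R * w n + x * a (n - 2) * w (n - 2) + y * b (n + 2) * w (n + 2) in
  (a (n - 2) * b n) * w n = (n%:~R + a n * b (n + 2)) * w n ->
  act (x * y' - y * x') ((h * x' - x * h') *+ 2) ((y * h' - h * y') *+ 2) w n =
  act h x y (act h' x' y' w) n - act h' x' y' (act h x y w) n.
Proof.
move=> act; rewrite /act !subrK !addrK !(intrD, intrB).
move: (w n) (w (n - 2)) (w (n + 2)) (w (n - 2 - 2)) (w (n + 2 + 2)).
move: (a (n - 2)) (a n) (b n) (b (n + 2)) (a (n - 2 - 2)) (b (n + 2 + 2)) (n%:~R : R).
move=> a1 a0 b0 b2 a4 b4 nn w0 w1 w2 w3 w4 e.
have e' : a1 * b0 * w0 - nn * w0 - a0 * b2 * w0 = 0 by rewrite e; ring.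
apply/eqP; rewrite -subr_eq0; apply/eqP.
have -> : (0 : R) = (y * x' - x * y') * (a1 * b0 * w0 - nn * w0 - a0 * b2 * w0).
  by rewrite e' mulr0.
ring.
Qed.

(* The Lie algebra is spanned by H, X, zY over the finite line and by H, X/z, Y
   near infinity: the regularity conditions say that these preserve the sum of
   the sheaves O(md n). *)
Record model_data (C : numClosedFieldType) := ModelData {
  mS : set int;
  md : int -> int;
  ma : int -> ratfun C;
  mb : int -> ratfun C;
  ma_supp : forall n, ma n <> 0 -> mS n /\ mS (n + 2);
  mb_supp : forall n, mb n <> 0 -> mS n /\ mS (n - 2);
  ma_reg0 : forall n t, reg (Some t) (ma n);
  mb_reg0 : forall n t, reg (Some t) (zfun C * mb n);
  ma_reginf : forall n, mS n -> mS (n + 2) ->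
    reg None (ma n * zfun C ^ (md n - md (n + 2) - 1));
  mb_reginf : forall n, mS n -> mS (n - 2) ->
    reg None (mb n * zfun C ^ (md n - md (n - 2)));
  m_comm : forall n, mS n -> ma (n - 2) * mb n - ma n * mb (n + 2) = n%:~R }.

(** * The module attached to weight data *)

Section Model.
Variables (C : numClosedFieldType) (D : model_data C).
Local Notation K := (ratfun C).
Local Notation z := (zfun C).
Local Notation S := (mS D).
Local Notation d := (md D).
Local Notation a := (ma D).
Local Notation b := (mb D).
Local Notation E := (int -> K^o).
Implicit Types (U V W : zopen C) (w : E).

Definition model_stalk (p : P1 C) : set E := [set w |
  [/\ exists s : seq int, forall n, n \notin s -> w n = 0,
      forall n, ~ S n -> w n = 0 & forall n, twreg (d n) p (w n)]].

Lemma model_stalk0 p : model_stalk p 0.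
Proof. by split=> [|n|n] //; [exists [::]|exact: twreg0]. Qed.

Lemma model_stalk_lin p f w w' : reg p f -> model_stalk p w -> model_stalk p w' ->
  model_stalk p (f *: w + w').
Proof.
move=> rf [[s hs] wS r] [[s' hs'] wS' r']; split.
- exists (s ++ s') => n; rewrite mem_cat negb_or => /andP[n1 n2].
  have -> : (f *: w + w') n = f * w n + w' n by [].
  by rewrite hs // hs' // mulr0 addr0.
- move=> n nS; have -> : (f *: w + w') n = f * w n + w' n by [].
  by rewrite wS // wS' // mulr0 addr0.
- move=> n; have -> : (f *: w + w') n = f * w n + w' n by [].
  exact: twreg_lin.
Qed.

Definition model_stalks : stalks C := Stalks model_stalk0 model_stalk_lin.
Definition model_sheaf : sheaf C := st_sheaf model_stalks.

Definition mval U (m : model_sheaf U) : int -> K := st_val m.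

Lemma mvalP U (m : model_sheaf U) p : zset U p -> model_stalk p (mval m).
Proof. exact: (@st_reg _ model_stalks U m p). Qed.

Lemma mval_inj U (m m' : model_sheaf U) : mval m = mval m' -> m = m'.
Proof. exact: (@st_val_inj _ model_stalks U m m'). Qed.

Definition mmk U (w : int -> K) (H : forall p, zset U p -> model_stalk p w) : model_sheaf U :=
  st_mk (s := model_stalks) H.

Lemma mval_mk U w (H : forall p, zset U p -> model_stalk p w) : mval (mmk H) = w.
Proof. by []. Qed.

Lemma mval_lin U (f : O U) (m m' : model_sheaf U) n :
  mval (f *: m + m') n = Oval f * mval m n + mval m' n.
Proof. by []. Qed.

Lemma mval_Z U (f : O U) (m : model_sheaf U) n : mval (f *: m) n = Oval f * mval m n.
Proof. by []. Qed.

Lemma mval_0 U n : mval (0 : model_sheaf U) n = 0.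
Proof. by []. Qed.

Lemma mval_B U (m m' : model_sheaf U) n : mval (m - m') n = mval m n - mval m' n.
Proof. by []. Qed.

Lemma mval_sum U I (s : seq I) (f : I -> model_sheaf U) n :
  mval (\sum_(i <- s) f i) n = \sum_(i <- s) mval (f i) n.
Proof. exact: (big_morph (fun m => mval m n)). Qed.

Lemma mval_res U V (h : V `<=` U) (m : model_sheaf U) : mval (res h m) = mval m.
Proof. by []. Qed.

Lemma mval_out U (m : model_sheaf U) n : ~ S n -> mval m n = 0.
Proof. by have [p Up] := zopen_nonempty U; have [_ h _] := mvalP m Up; exact: h. Qed.

Lemma mval_fin U (m : model_sheaf U) : exists s : seq int, forall n, n \notin s -> mval m n = 0.
Proof. by have [p Up] := zopen_nonempty U; have [h _ _] := mvalP m Up. Qed.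

Lemma mval_reg U (m : model_sheaf U) n p : zset U p -> twreg (d n) p (mval m n).
Proof. by move=> /(mvalP m)[_ _]; exact. Qed.

(** Restriction does not change the underlying function, so only poles matter: finitely many points
    and weights are involved, and one power of [f] serves for all. *)
Lemma model_qc : quasicoherent model_sheaf.
Proof.
move=> U V h f aU VE; split=> [m e|t f' ef].
  exists 0%N; rewrite expr0 scale1r; apply: mval_inj; apply: funext => n.
  by rewrite -(mval_res h) e.
have /finite_seqP[X eX] := zset_cofinite V; have [s hs] := mval_fin t.
have XP x : ~ zset V x -> x \in X by move=> nV; have : (~` zset V) x by []; rewrite eX.
have [k hk] : exists k, forall xn, xn \in [seq (x, n) | x <- X, n <- s] ->
    zset U xn.1 -> ~ zset V xn.1 -> twreg (d xn.2) xn.1 (Oval f ^+ k * mval t xn.2).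
  apply: (seq_bound (P := fun xn k => zset U xn.1 -> ~ zset V xn.1 ->
    twreg (d xn.2) xn.1 (Oval f ^+ k * mval t xn.2))).
  move=> [x n] _ /=; have [[Ux nVx]|nh] := pselect (zset U x /\ ~ zset V x); last first.
    by exists 0%N => l _ Ux nV; case: nh.
  have f0 : has_value (Oval f) x 0 by apply: contrapT => nf; apply: nVx; apply/VE.
  have [k hk] := kill_pole (if x is Some _ then mval t n else mval t n * z ^ (- d n)) f0.
  exists k => l kl _ _; rewrite /twreg; case: x {Ux nVx f0} hk => [u|] hk; first exact: hk.
  by rewrite -mulrA; exact: hk.
have Ht p : zset U p -> model_stalk p (fun n => Oval f ^+ k * mval t n).
  move=> Up; split=> [|n nS|n].
  - by exists s => n /hs ->; rewrite mulr0.
  - by rewrite mval_out // mulr0.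
  - have [ns|/hs->] := boolP (n \in s); last by rewrite mulr0; exact: twreg0.
    have [Vp|nVp] := pselect (zset V p).
      rewrite -[_ * _]addr0; apply: twreg_lin; [exact/regX/Oreg|exact: mval_reg|exact: twreg0].
    apply: (hk (p, n)) => //; apply/allpairsP; exists (p, n); split => //=.
    exact: XP.
exists k, (mmk Ht); apply: mval_inj; apply: funext => n.
by rewrite mval_res mval_Z OvalX ef.
Qed.

Definition delta (n : int) (f : K) : int -> K := fun k => if k == n then f else 0.

Lemma model_delta U n f : S n -> (forall p, zset U p -> twreg (d n) p f) ->
  forall p, zset U p -> model_stalk p (delta n f).
Proof.
move=> Sn r p Up; split=> [|k|k]; rewrite /delta.
- by exists [:: n] => k; rewrite inE => /negPf->.
- by case: eqP => // ->.
- by case: eqP => [->|_]; [exact: r|exact: twreg0].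
Qed.

(** Over an affine open set each O(d n) is free of rank one, generated by the function [g n] from
    [affine_twist]. *)
Lemma model_flat : flat_sheaf model_sheaf.
Proof.
move=> U aU.
have /choice[g hg] : forall n, exists g : K, g != 0 /\
    forall p (f : K), zset U p -> twreg (d n) p f <-> reg p (f / g).
  by move=> n; have [g g0 h] := affine_twist (d n) aU; exists g.
have rx n (m : model_sheaf U) p : zset U p -> reg p (mval m n / g n).
  by move=> Up; apply/(hg n).2 => //; exact: mval_reg.
have /choice[e he] : forall n, exists e : model_sheaf U, S n -> mval e = delta n (g n).
  move=> n; have [Sn|nS] := pselect (S n); last by exists 0.
  have r p : zset U p -> twreg (d n) p (g n).
    by move=> Up; apply/(hg n).2 => //; rewrite divff ?(hg n).1 //; exact: reg1.
  by exists (mmk (model_delta Sn r)).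
apply: (@free_flat _ _ int e (fun n m => mkO (rx n m))).
  move=> n f m m'; apply: OvalE => /=.
  by rewrite -[X in X / _ = _]/(Oval f * mval m n + mval m' n) mulrDl mulrA.
move=> m; have [s hs] := mval_fin m; exists (undup s); split=> [|n|].
- exact: undup_uniq.
- by rewrite mem_undup => /hs e0; apply: OvalE; rewrite /= e0 mul0r.
apply: mval_inj; apply: funext => k; rewrite mval_sum.
rewrite (eq_bigr (fun n => if n == k then mval m n else 0)) => [|n _].
  rewrite -big_mkcond (sum_pick (fun n => mval m n)) ?undup_uniq // mem_undup.
  by case: ifP => // /negbT/hs.
rewrite mval_Z /=; have [Sn|nS] := pselect (S n).
  rewrite he // /delta [n == k]eq_sym; case: eqP => _; last by rewrite mulr0.
  by rewrite divfK ?(hg n).1.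
by rewrite mval_out // mul0r mul0r if_same.
Qed.

Lemma model_kact_stalk U (t : C) (m : model_sheaf U) p : zset U p ->
  model_stalk p (fun n => constfun (t ^ n) * mval m n).
Proof.
move=> Up; split=> [|n nS|n].
- by have [s hs] := mval_fin m; exists s => n /hs ->; rewrite mulr0.
- by rewrite mval_out // mulr0.
- rewrite -[_ * _]addr0.
  by apply: twreg_lin; [exact: regC|exact: mval_reg|exact: twreg0].
Qed.

Definition model_kact U (t : C) (m : model_sheaf U) : model_sheaf U :=
  mmk (@model_kact_stalk U t m).

(** The entries of the second matrix are the coordinates along H, X and Y. *)
Definition gw (xi : mxpair K) (w : int -> K) (n : int) : K :=
  xi.2 0 0 * n%:~R * w n + xi.2 0 1 * a (n - 2) * w (n - 2) + xi.2 1 0 * b (n + 2) * w (n + 2).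

Lemma gw_gelt h x y w n : gw (gelt z z^-1 h x y) w n =
  h * n%:~R * w n + x * a (n - 2) * w (n - 2) + y * b (n + 2) * w (n + 2).
Proof. by rewrite /gw /= !mx2E. Qed.

Lemma twreg_X p n x (f : K) : greg p 0 x 0 -> S n -> S (n + 2) -> twreg (d n) p f ->
  twreg (d (n + 2)) p (x * a n * f).
Proof.
move=> [_ rx rxz _ _] Sn S2; rewrite /twreg; case: p rx rxz => [t|] rx rxz rf.
  by apply: regM => //; apply: regM => //; exact: ma_reg0.
have z0 := zfun_neq0 C.
have -> : x * a n * f * z ^ (- d (n + 2)) =
    (x * z) * (a n * z ^ (d n - d (n + 2) - 1)) * (f * z ^ (- d n)).
  rewrite !expfzDr // exprN1; move: (expfz_neq0 (d n) z0); rewrite -(invr_expz z (d n)).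
  move: (z ^ d n) (z ^ (- d (n + 2))) (a n) => u v an u0.
  have -> : x * z * (an * (u * v / z)) * (f / u) = x * an * f * v * (z / z) * (u / u) by ring.
  by rewrite !divff // !mulr1.
by apply: regM => //; apply: regM => //; exact: ma_reginf.
Qed.

Lemma twreg_Y p n y (f : K) : greg p 0 0 y -> S n -> S (n - 2) -> twreg (d n) p f ->
  twreg (d (n - 2)) p (y * b n * f).
Proof.
move=> [_ _ _ ry ryz] Sn S2; rewrite /twreg; case: p ry ryz => [t|] ry ryz rf.
  have -> : y * b n * f = y / z * (z * b n) * f.
    by rewrite mulrA divfK // zfun_neq0.
  by apply: regM => //; apply: regM => //; exact: mb_reg0.
have z0 := zfun_neq0 C.
have -> : y * b n * f * z ^ (- d (n - 2)) =
    y * (b n * z ^ (d n - d (n - 2))) * (f * z ^ (- d n)).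
  rewrite !expfzDr //; move: (expfz_neq0 (d n) z0); rewrite -(invr_expz z (d n)).
  move: (z ^ d n) (z ^ (- d (n - 2))) (b n) => u v bn u0.
  have -> : y * (bn * (u * v)) * (f / u) = y * bn * f * v * (u / u) by ring.
  by rewrite divff // mulr1.
by apply: regM => //; apply: regM => //; exact: mb_reginf.
Qed.

Lemma twregD (e : int) p (f g : K) : twreg e p f -> twreg e p g -> twreg e p (f + g).
Proof. by rewrite -{2}[f]mul1r; apply: twreg_lin; exact: reg1. Qed.

Lemma gw_stalk U xi (m : model_sheaf U) : gsec U xi ->
  forall p, zset U p -> model_stalk p (gw xi (mval m)).
Proof.
move=> /gsecP[h [x [y [-> r]]]] p Up; have [r1 r2 r3 r4 r5] := r p Up.
have a0 n : ~ S n \/ ~ S (n + 2) -> a n = 0.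
  by move=> nS; apply: contrapT => /ma_supp[S1 S2]; case: nS.
have b0 n : ~ S n \/ ~ S (n - 2) -> b n = 0.
  by move=> nS; apply: contrapT => /mb_supp[S1 S2]; case: nS.
split=> [|n nS|n].
- have [s hs] := mval_fin m; exists (s ++ [seq n + 2 | n <- s] ++ [seq n - 2 | n <- s]) => n.
  rewrite !mem_cat !negb_or => /and3P[n0 n1 n2]; rewrite gw_gelt hs //.
  have -> : mval m (n - 2) = 0.
    by apply: hs; apply: contra n1 => ns; apply/mapP; exists (n - 2); rewrite ?subrK.
  have -> : mval m (n + 2) = 0.
    by apply: hs; apply: contra n2 => ns; apply/mapP; exists (n + 2); rewrite ?addrK.
  by rewrite !mulr0 !addr0.
- rewrite gw_gelt mval_out // (a0 (n - 2)); last by right; rewrite subrK.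
  by rewrite (b0 (n + 2)) ?mulr0 ?mul0r ?addr0 //; right; rewrite addrK.
- rewrite gw_gelt; apply: twregD; first apply: twregD.
  + rewrite -[_ * _]addr0; apply: twreg_lin; [|exact: mval_reg|exact: twreg0].
    by apply: regM => //; rewrite -(rmorph_int (@constfun C)); exact: regC.
  + have [[S1 S2]|nS] := pselect (S (n - 2) /\ S n); last first.
      rewrite a0 ?mulr0 ?mul0r; first exact: twreg0.
      have [S1|] := pselect (S (n - 2)); last by left.
      by right; rewrite subrK => S2; case: nS.
    rewrite -{1}[n](subrK 2); apply: twreg_X => //; rewrite ?subrK //; last exact: mval_reg.
    by split=> //; rewrite ?mul0r; exact: reg0.
  + have [[S1 S2]|nS] := pselect (S (n + 2) /\ S n); last first.
      rewrite b0 ?mulr0 ?mul0r; first exact: twreg0.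
      have [S1|] := pselect (S (n + 2)); last by left.
      by right; rewrite addrK => S2; case: nS.
    rewrite -{1}[n](addrK 2); apply: twreg_Y => //; rewrite ?addrK //; last exact: mval_reg.
    by split=> //; rewrite ?mul0r; exact: reg0.
Qed.

Definition model_gact U (xi : mxpair K) (m : model_sheaf U) : model_sheaf U :=
  if pselect (gsec U xi) is left g then mmk (gw_stalk m g) else 0.

Lemma model_gactE U xi (m : model_sheaf U) : gsec U xi -> mval (model_gact xi m) = gw xi (mval m).
Proof. by move=> g; rewrite /model_gact; case: pselect. Qed.

Lemma model_bracket U xi eta (m : model_sheaf U) : gsec U xi -> gsec U eta ->
  model_gact (bracket xi eta) m =
  model_gact xi (model_gact eta m) - model_gact eta (model_gact xi m).
Proof.
move=> g g'; have gb := gsec_bracket g g'.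
apply: mval_inj; apply: funext => n; rewrite mval_B !model_gactE //.
have [h [x [y [ex _]]]] := (gsecP _ _).1 g.
have [h' [x' [y' [ex' _]]]] := (gsecP _ _).1 g'.
rewrite ex ex' (bracket_gelt _ _ _ _ _ _ (zzV C)) !gw_gelt.
apply: weight_bracket.
have [Sn|nS] := pselect (S n); last by rewrite mval_out // !mulr0.
by rewrite -(m_comm Sn) subrK.
Qed.

Lemma model_kact_alg U (m : model_sheaf U) : exists s : seq (int * model_sheaf U),
  forall t : C, t != 0 -> model_kact t m = \sum_(u <- s) Oconst U (t ^ u.1) *: u.2.
Proof.
have H n : S n -> forall p, zset U p -> model_stalk p (delta n (mval m n)).
  by move=> Sn; apply: model_delta => // p; exact: mval_reg.
have /choice[u hu] : forall n, exists u : model_sheaf U, mval u = delta n (mval m n).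
  move=> n; have [Sn|nS] := pselect (S n); first by exists (mmk (H n Sn)).
  by exists 0; apply: funext => k; rewrite mval_0 /delta mval_out // if_same.
have [s hs] := mval_fin m; exists [seq (n, u n) | n <- undup s] => t t0.
apply: mval_inj; apply: funext => k; rewrite mval_sum big_map /=.
rewrite (eq_bigr (fun n => if n == k then constfun (t ^ n) * mval m n else 0)) => [|n _].
  rewrite -big_mkcond (sum_pick (fun n => constfun (t ^ n) * mval m n)) ?undup_uniq // mem_undup.
  by case: ifP => // /negbT/hs e; rewrite -[LHS]/(constfun (t ^ k) * mval m k) e mulr0.
rewrite -[LHS]/(constfun (t ^ n) * mval (u n) k) hu /delta [n == k]eq_sym.
by case: eqP => // _; rewrite mulr0.
Qed.

Lemma model_differential U (m : model_sheaf U) (s : seq (int * model_sheaf U)) :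
  (forall t : C, t != 0 -> model_kact t m = \sum_(u <- s) Oconst U (t ^ u.1) *: u.2) ->
  model_gact (secH C) m = \sum_(u <- s) u.2 *~ u.1.
Proof.
move=> h; apply: mval_inj; apply: funext => n; rewrite model_gactE; last exact: gsecH.
rewrite secH_gelt gw_gelt !mul0r !addr0 mul1r mval_sum.
have mz (u : model_sheaf U) (k : int) : mval (u *~ k) n = mval u n *~ k.
  rewrite -[u *~ k]scaler_int mval_Z -[RHS]mulrzl; congr (_ * _).
  have -> : (k%:~R : O U) = Oconst U k%:~R by rewrite rmorph_int.
  by rewrite /= rmorph_int.
under eq_bigr do rewrite mz.
(* In weight [n], the given expansion minus the single term of exponent [n] is a vanishing Laurent
   polynomial. *)
pose s' : seq (int * K^o) := (n, - mval m n) :: [seq (u.1, mval u.2 n) | u <- s].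
have := @laurent_moment C K (K^o) (@constfun C) s' _.
rewrite big_cons big_map /= => /(_ _)/eqP; rewrite mulNrz addrC subr_eq0.
move=> e; rewrite mulrzl; apply/esym/eqP/e => t t0.
rewrite big_cons big_map /= scalerN addrC; apply/eqP; rewrite subr_eq0; apply/eqP.
have := congr1 (fun u => mval u n) (h t t0); rewrite mval_sum mval_mk => e2.
by rewrite -[RHS]/(constfun (t ^ n) * mval m n) e2; apply: eq_bigr.
Qed.

Definition model : hcmodule C.
Proof.
refine (@HCModule C model_sheaf model_qc model_flat model_kact _ _ _ _ model_kact_alg
  model_gact _ _ model_bracket _ _ model_differential).
- move=> U t t0 f m m'; apply: mval_inj; apply: funext => n.
  by rewrite mval_lin !mval_mk mval_lin mulrDr mulrCA.
- by move=> U V h t m t0; apply: mval_inj.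
- move=> U m; apply: mval_inj; apply: funext => n.
  by rewrite mval_mk exp1rz rmorph1 mul1r.
- move=> U t u m t0 u0; apply: mval_inj; apply: funext => n.
  by rewrite !mval_mk exprzMl ?unitfE // rmorphM mulrA.
- move=> U xi g f m m'; apply: mval_inj; apply: funext => n.
  rewrite mval_lin !model_gactE // /gw !mval_lin; ring.
- move=> U f xi eta m g g'; apply: mval_inj; apply: funext => n.
  have g2 := gsec_lin f g g'.
  rewrite mval_lin !model_gactE // /gw /= !mxE; ring.
- move=> U V h xi m g; apply: mval_inj; rewrite mval_res !model_gactE //.
  exact: gsec_sub h g.
- move=> U t xi m t0 g; apply: mval_inj; apply: funext => n.
  rewrite mval_mk !model_gactE //; last exact: gsec_Ad.
  have [h [x [y [ex _]]]] := (gsecP _ _).1 g.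
  rewrite ex Ad_gelt // !gw_gelt !mval_mk.
  rewrite (@expfzDr _ t n (-2) t0) (@expfzDr _ t n 2 t0).
  rewrite (rmorphM (@constfun C) (t ^ n) (t ^ 2)) (rmorphM (@constfun C) (t ^ n) (t ^ (-2))).
  have e : constfun (t ^ 2) * constfun (t ^ (-2)) = 1.
    by rewrite -rmorphM -expfzDr // subrr expr0z rmorph1.
  (* With u = t^2 and v = t^-2, the factor from [Ad] cancels the one from the shifted weight. *)
  have key (u v k w0 w1 w2 aa bb nn : K) : u * v = 1 ->
      k * (h * nn * w0 + x * aa * w1 + y * bb * w2) =
      h * nn * (k * w0) + u * x * aa * (k * v * w1) + v * y * bb * (k * u * w2).
    move=> uv; have -> : u * x * aa * (k * v * w1) = x * aa * k * w1 * (u * v) by ring.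
    have -> : v * y * bb * (k * u * w2) = y * bb * k * w2 * (u * v) by ring.
    rewrite uv; ring.
  exact: key e.
Defined.

Definition model_chart : chart model.
Proof.
refine (@Chart C model S d a b mval _ _ _ mval_fin _ _ mval_out mval_reg _ (@ma_supp _ D) (@mb_supp _ D)).
- by move=> U f m m' n; exact: mval_lin.
- by [].
- by move=> U m m0; apply: mval_inj; apply: funext => n; rewrite m0.
- by [].
- move=> U h x y m n g; rewrite -gw_gelt.
  exact: (congr1 (fun w => w n) (model_gactE m g)).
- move=> U w fin out r; have H p : zset U p -> model_stalk p w by move=> Up; split=> // n; exact: r.
  by exists (mmk H).
Defined.

End Model.

Lemma fin_sum_ext (M : zmodType) (I : eqType) (s s' : seq I) (f : I -> M) :
  uniq s -> uniq s' -> (forall i, i \notin s -> f i = 0) -> (forall i, i \notin s' -> f i = 0) ->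
  \sum_(i <- s) f i = \sum_(i <- s') f i.
Proof.
move=> us us' h h'; have red t : \sum_(i <- t) f i = \sum_(i <- t | f i != 0) f i.
  by rewrite (bigID (fun i => f i != 0)) /= [X in _ + X]big1 ?addr0 // => i /negPn/eqP.
rewrite !red -!(big_filter _ (fun i => f i != 0)); apply: perm_big.
apply: uniq_perm; [exact: filter_uniq|exact: filter_uniq|move=> i].
rewrite !mem_filter; case: eqP => //= /eqP fi.
have -> : i \in s by apply: contraNT fi => /h ->.
by apply/esym; apply: contraNT fi => /h' ->.
Qed.

(** * Generic irreducibility from connectedness of the weights *)

Section GenericallyIrreducible.
Variables (C : numClosedFieldType) (kk : closedFieldType).
Variables (iota : {rmorphism ratfun C -> kk}) (F : hcmodule C) (c : chart F).
Hypothesis irr : chart_irreducible c.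
Local Notation K := (ratfun C).
Local Notation z := (zfun C).
Local Notation S := (cS c).
Local Notation t := (iota z).
Local Notation gelk := (@gelt kk t t^-1).
Implicit Types (U W : zopen C) (n : int).

Lemma chart_quasi_admissible : quasi_admissible F.
Proof.
move=> n U aU; have [Sn|nS] := pselect (S n); last first.
  exists 0%N, (fun=> 0); split=> [[]//|m wm]; exists (fun=> 0); rewrite big_ord0.
  apply: (@ck_eq0 _ _ c) => k; have [->|kn] := eqVneq k n; first exact: ck_out.
  by move/(ck_weight c): wm; apply.
have [g g0 hg] := affine_twist (cd c n) aU.
have rg p : zset U p -> twreg (cd c n) p g.
  by move=> Up; apply/(hg p g Up); rewrite divff //; exact: reg1.
have [e [we ke]] := ck_delta Sn rg.
exists 1%N, (fun=> e); split=> // m wm.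
have r p : zset U p -> reg p (ck c m n / g) by move=> Up; apply/(hg p _ Up); exact: ck_reg.
exists (fun=> mkO r); rewrite big_ord1; apply: (@ck_inj _ _ c); apply: funext => k.
rewrite ckZ ke /=; have [->|kn] := eqVneq k n; first by rewrite divfK.
by move/(ck_weight c): wm => /(_ k kn) ->; rewrite mulr0.
Qed.

(** The generic fiber as the vector space with the weights as basis. *)
Definition fib_set : set (int -> kk^o) := [set v |
  (exists s : seq int, forall n, n \notin s -> v n = 0) /\ forall n, ~ S n -> v n = 0].

Lemma fib_set0 : fib_set 0. Proof. by split=> //; exists [::]. Qed.

Lemma fib_set_lin (f : kk) v w : fib_set v -> fib_set w -> fib_set (f *: v + w).
Proof.
move=> [[s hs] vS] [[s' hs'] wS].
have E n : (f *: v + w) n = f * v n + w n by [].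
split=> [|n nS]; last by rewrite E vS // wS // mulr0 addr0.
exists (s ++ s') => n; rewrite mem_cat negb_or => /andP[n1 n2].
by rewrite E hs // hs' // mulr0 addr0.
Qed.

Definition fib_submod : submod (int -> kk^o) := Submod fib_set0 fib_set_lin.
Definition fib : lmodType kk := sm_sec fib_submod.
Definition fv (v : fib) : int -> kk := sm_val v.

Lemma fv_lin (f : kk) (v w : fib) n : fv (f *: v + w) n = f * fv v n + fv w n.
Proof. by []. Qed.
Lemma fv_Z (f : kk) (v : fib) n : fv (f *: v) n = f * fv v n. Proof. by []. Qed.
Lemma fv_B (v w : fib) n : fv (v - w) n = fv v n - fv w n. Proof. by []. Qed.
Lemma fv_0 n : fv 0 n = 0. Proof. by []. Qed.
Lemma fv_sum I (s : seq I) (f : I -> fib) n : fv (\sum_(i <- s) f i) n = \sum_(i <- s) fv (f i) n.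
Proof. exact: (big_morph (fun v => fv v n)). Qed.
Lemma fv_inj (v w : fib) : fv v = fv w -> v = w. Proof. exact: (@sm_inj _ _ fib_submod). Qed.
Lemma fv_out (v : fib) n : ~ S n -> fv v n = 0.
Proof. by have [_ h] := @sm_in _ _ fib_submod v; exact: h. Qed.
Lemma fv_fin (v : fib) : exists s : seq int, uniq s /\ forall n, n \notin s -> fv v n = 0.
Proof.
have [[s hs] _] := @sm_in _ _ fib_submod v; exists (undup s); split; first exact: undup_uniq.
by move=> n; rewrite mem_undup; exact: hs.
Qed.
Definition fmk (v : int -> kk) (H : fib_set v) : fib := sm_mk (P := fib_submod) H.

Lemma fib_j_set U (m : F U) : fib_set (fun n => iota (ck c m n)).
Proof.
split=> [|n nS]; last by rewrite ck_out // rmorph0.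
by have [s hs] := ck_fin c m; exists s => n /hs ->; rewrite rmorph0.
Qed.
Definition fib_j U (m : F U) : fib := fmk (fib_j_set m).
Lemma fib_jE U (m : F U) n : fv (fib_j m) n = iota (ck c m n). Proof. by []. Qed.

Lemma fib_j_generic : generic_map iota fib_j.
Proof.
split=> [U f m m'|U W h m]; apply: fv_inj; apply: funext => n.
  by rewrite fv_lin !fib_jE ck_lin rmorphD rmorphM.
by rewrite !fib_jE ck_res.
Qed.

Lemma delta_ex n : exists e : F (U0 C), S n -> ck c e = delta n 1.
Proof.
have [Sn|nS] := pselect (S n); last by exists 0.
have [p /U0P[u ->]|e [_ ke]] := @ck_delta _ _ c (U0 C) n 1 Sn; first exact: reg1.
by exists e.
Qed.
Definition dsec n : F (U0 C) := projT1 (cid (delta_ex n)).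
Lemma dsecE n : S n -> ck c (dsec n) = delta n 1.
Proof. exact: (projT2 (cid (delta_ex n))). Qed.

Definition dl n : fib := fib_j (dsec n).
Lemma dlE n k : S n -> fv (dl n) k = if k == n then 1 else 0.
Proof. by move=> Sn; rewrite fib_jE dsecE // /delta; case: eqP; rewrite ?rmorph1 ?rmorph0. Qed.

Lemma fib_sum (v : fib) s : uniq s -> (forall n, n \notin s -> fv v n = 0) ->
  v = \sum_(n <- s) fv v n *: dl n.
Proof.
move=> us hs; apply: fv_inj; apply: funext => k; rewrite fv_sum.
rewrite (eq_bigr (fun n => if n == k then fv v n else 0)) => [|n _].
  rewrite -big_mkcond (sum_pick (fv v)) //.
  by case: ifP => // /negbT/hs.
rewrite fv_Z; have [Sn|nS] := pselect (S n); last by rewrite fv_out // mul0r if_same.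
by rewrite dlE // [k == n]eq_sym; case: eqP => _; rewrite ?mulr1 ?mulr0.
Qed.

(** A compatible map is determined by its values on the sections [dsec n], because over the finite
    line every section is a combination of them. *)
Lemma fib_generic : is_generic_fiber iota fib_j.
Proof.
split; first exact: fib_j_generic.
move=> W j' [jl jr].
have j0 U : j' U 0 = 0.
  by have := jl U (-1) 0 0; rewrite scaler0 addr0 OvalN Oval1 rmorphN rmorph1 scaleN1r addNr.
have jZ U f m : j' U (f *: m) = iota (Oval f) *: j' U m.
  by have := jl U f m 0; rewrite !addr0 j0 addr0.
have jD U m m' : j' U (m + m') = j' U m + j' U m'.
  by have := jl U 1 m m'; rewrite Oval1 rmorph1 !scale1r.
have jsum U I (s : seq I) (f : I -> F U) : j' U (\sum_(i <- s) f i) = \sum_(i <- s) j' U (f i).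
  by apply: (big_morph (j' U)) => [u v|]; [exact: jD|exact: j0].
pose sp v := projT1 (cid (fv_fin v)).
have spP v : uniq (sp v) /\ forall n, n \notin sp v -> fv v n = 0 := projT2 (cid (fv_fin v)).
pose h (v : fib) : W := \sum_(n <- sp v) fv v n *: j' _ (dsec n).
have hE v s : uniq s -> (forall n, n \notin s -> fv v n = 0) ->
    h v = \sum_(n <- s) fv v n *: j' _ (dsec n).
  move=> us hs; have [us' hs'] := spP v.
  by apply: (fin_sum_ext us' us) => n nn; [rewrite (hs' n nn)|rewrite (hs n nn)]; exact: scale0r.
exists h; split; last first.
  move=> h' [hl' hj']; apply: funext => v; have [us hs] := spP v.
  rewrite [in RHS](fib_sum us hs) (lin_sum hl'); apply: eq_bigr => n _.
  by rewrite (lin_Z hl') hj'.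
split=> [f v w|U m].
  have [us hs] := spP v; have [us' hs'] := spP w.
  pose s := undup (sp v ++ sp w).
  have vs n : n \notin s -> fv v n = 0.
    by rewrite mem_undup mem_cat negb_or => /andP[/hs].
  have ws n : n \notin s -> fv w n = 0.
    by rewrite mem_undup mem_cat negb_or => /andP[_ /hs'].
  have uu : uniq s by exact: undup_uniq.
  rewrite (hE _ s uu) => [|n nn]; last by rewrite fv_lin vs // ws // mulr0 addr0.
  rewrite (hE v s uu vs) (hE w s uu ws) scaler_sumr -big_split.
  by apply: eq_bigr => n _; rewrite fv_lin scalerDl scalerA.
have [s hs] := ck_fin c m.
rewrite (hE _ (undup s) (undup_uniq s)) => [|n]; last first.
  by rewrite mem_undup fib_jE => /hs ->; rewrite rmorph0.
pose W0 := capU U (U0 C).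
have r n p : zset W0 p -> reg p (ck c m n).
  by move=> [Up /U0P[u pu]]; have := ck_reg c m n Up; rewrite pu.
rewrite -(jr U W0 (@capUl C U (U0 C)) m).
have -> : res (@capUl C U (U0 C)) m =
    \sum_(n <- undup s) mkO (r n) *: res (@capUr C U (U0 C)) (dsec n).
  apply: (@ck_inj _ _ c); apply: funext => k; rewrite ck_res.
  rewrite (big_morph (fun m => ck c m k) (fun u v => ckD c u v k) (ck0 c _ k)).
  rewrite (eq_bigr (fun n => if n == k then ck c m n else 0)) => [|n _].
    rewrite -big_mkcond (sum_pick (ck c m)) ?undup_uniq // mem_undup.
    by case: ifP => // /negbT/hs.
  rewrite ckZ ck_res /=; have [Sn|nS] := pselect (S n); last first.
    by rewrite (ck_out _ nS) mul0r if_same.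
  by rewrite dsecE // /delta [k == n]eq_sym; case: eqP => _; rewrite ?mulr1 ?mulr0.
rewrite jsum; apply: eq_bigr => n _.
by rewrite jZ jr fib_jE.
Qed.

Definition fact (xi : mxpair kk) (w : int -> kk) (n : int) : kk :=
  xi.2 0 0 * n%:~R * w n + xi.2 0 1 * iota (ca c (n - 2)) * w (n - 2)
  + xi.2 1 0 * iota (cb c (n + 2)) * w (n + 2).

Lemma fact_gelt h x y w n : fact (gelk h x y) w n =
  h * n%:~R * w n + x * iota (ca c (n - 2)) * w (n - 2) + y * iota (cb c (n + 2)) * w (n + 2).
Proof. by rewrite /fact /= !mx2E. Qed.

Lemma fact_set xi (v : fib) : fib_set (fact xi (fv v)).
Proof.
split=> [|n nS]; last first.
  rewrite /fact fv_out //; have -> : ca c (n - 2) = 0.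
    by apply: contrapT => /ca_supp[_]; rewrite subrK.
  have -> : cb c (n + 2) = 0 by apply: contrapT => /cb_supp[_]; rewrite addrK.
  by rewrite rmorph0 !mulr0 !mul0r !addr0.
have [s [_ hs]] := fv_fin v; exists (s ++ [seq n + 2 | n <- s] ++ [seq n - 2 | n <- s]) => n.
rewrite !mem_cat !negb_or => /and3P[n0 n1 n2]; rewrite /fact hs //.
have -> : fv v (n - 2) = 0.
  by apply: hs; apply: contra n1 => ns; apply/mapP; exists (n - 2); rewrite ?subrK.
have -> : fv v (n + 2) = 0.
  by apply: hs; apply: contra n2 => ns; apply/mapP; exists (n + 2); rewrite ?addrK.
by rewrite !mulr0 !addr0.
Qed.

Definition frho (xi : mxpair kk) (v : fib) : fib := fmk (fact_set xi v).
Lemma frhoE xi v n : fv (frho xi v) n = fact xi (fv v) n. Proof. by []. Qed.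

Lemma intrk (k : int) : iota k%:~R = k%:~R. Proof. exact: rmorph_int. Qed.

Lemma intrk_neq0 (k : int) : k != 0 -> (k%:~R : kk) != 0.
Proof.
move=> k0; rewrite -intrk fmorph_eq0; apply: contra_neq k0 => e.
exact: (@intrK_inj C k 0).
Qed.

Lemma frho_rep : lie_rep (generic_lie iota) frho.
Proof.
split=> [xi _ f v w|f xi eta v _ _|xi eta v].
- by apply: fv_inj; apply: funext => n; rewrite fv_lin !frhoE /fact !fv_lin; ring.
- by apply: fv_inj; apply: funext => n; rewrite fv_lin !frhoE /fact /= !mxE; ring.
move=> /generic_lieP[h [x [y ->]]] /generic_lieP[h' [x' [y' ->]]].
apply: fv_inj; apply: funext => n; rewrite fv_B !frhoE.
have tt : t * t^-1 = 1 by rewrite divff // fmorph_eq0 zfun_neq0.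
rewrite (bracket_gelt _ _ _ _ _ _ tt) !fact_gelt.
have E xi' : fv (frho xi' v) = fact xi' (fv v) by [].
rewrite !E !fact_gelt.
apply: (weight_bracket (a := fun n => iota (ca c n)) (b := fun n => iota (cb c n))).
have [Sn|nS] := pselect (S n); last by rewrite fv_out // !mulr0.
have := yx_comm Sn; rewrite /yx subrK => /eqP; rewrite subr_eq => /eqP e.
by rewrite -!rmorphM e rmorphD intrk.
Qed.

Lemma frho_compat U xi (m : F U) : gsec U xi ->
  frho (mpmap iota xi) (fib_j m) = fib_j (gact xi m).
Proof.
move=> /[dup] g /gsecP[h [x [y [exi _]]]]; rewrite exi in g *.
apply: fv_inj; apply: funext => n; rewrite frhoE mpmap_gelt fact_gelt [RHS]fib_jE ck_gact //.
by rewrite !fib_jE !rmorphD !rmorphM intrk.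
Qed.

(** A nonzero stable subspace contains a weight component of one of its vectors, hence some basis
    vector, and the arrows reach all others. *)
Lemma frho_irreducible : irreducible_rep (generic_lie iota) frho.
Proof.
split.
  have [n Sn] := irr.1; exists (dl n) => /(congr1 (fun v => fv v n)).
  by rewrite dlE // eqxx fv_0 => /eqP; rewrite oner_eq0.
move=> P [P0 Pl] Pst.
have [[v [Pv v0]]|nP] := pselect (exists v, P v /\ v <> 0); last first.
  left; apply/seteqP; split=> v /= => [Pv|->//].
  by apply: contrapT => v0; apply: nP; exists v.
right; apply/seteqP; split=> // u _ /=.
have PZ f w : P w -> P (f *: w) by move=> Pw; rewrite -[_ *: _]addr0; exact: Pl.
have glie h x y : generic_lie iota (gelk h x y) by apply/generic_lieP; exists h, x, y.
(* Induction on the other weights in the support: (H - m) / (n - m) removes the component of weight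
   [m] and fixes that of weight [n]. *)
have comp n : forall (s : seq int) (w : fib), n \notin s -> P w ->
    (forall k, k \notin n :: s -> fv w k = 0) ->
    exists w', P w' /\ forall k, fv w' k = if k == n then fv w n else 0.
  elim=> [|m s IH] w ns Pw hw.
    exists w; split=> // k; case: eqP => [->//|/eqP kn].
    by apply: hw; rewrite inE.
  have nm : n - m != 0 by move: ns; rewrite in_cons negb_or subr_eq0 => /andP[].
  pose w1 := (n - m)%:~R^-1 *: (frho (gelk 1 0 0) w - m%:~R *: w).
  have w1E k : fv w1 k = (k - m)%:~R / (n - m)%:~R * fv w k.
    rewrite fv_Z fv_B frhoE fact_gelt fv_Z !mul0r !addr0 mul1r -mulrBl -intrB.
    by rewrite mulrA [_^-1 * _]mulrC.
  have Pw1 : P w1.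
    apply: PZ; rewrite addrC -scaleNr; apply: Pl; first exact: Pw.
    exact: Pst.
  have [|k|w' [Pw' hw']] := IH w1 _ Pw1.
  - by move: ns; rewrite in_cons negb_or => /andP[].
  - move=> kn; rewrite w1E; have [->|km] := eqVneq k m; first by rewrite subrr mul0r mul0r.
    rewrite hw ?mulr0 //; move: kn; rewrite !in_cons !negb_or => /andP[-> ->].
    by rewrite km.
  - exists w'; split=> // k; rewrite hw' w1E divff ?mul1r //.
    exact: intrk_neq0.
have [n0 vn0] : exists n, fv v n != 0.
  apply: contrapT => nn; apply: v0; apply: fv_inj; apply: funext => n.
  by rewrite fv_0; apply: contrapT => /eqP h; apply: nn; exists n.
have Sn0 : S n0 by apply: contrapT => /(fv_out v) e; rewrite e eqxx in vn0.
have Pd0 : P (dl n0).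
  have [s [us hs]] := fv_fin v.
  have [|k|w [Pw hw]] := @comp n0 [seq k <- s | k != n0] v _ Pv.
  - by rewrite mem_filter eqxx.
  - rewrite in_cons mem_filter negb_or negb_and negbK => /andP[/negPf -> /= ks].
    exact: hs.
  have -> : dl n0 = (fv v n0)^-1 *: w; last exact: PZ.
  apply: fv_inj; apply: funext => k; rewrite dlE // fv_Z hw.
  by case: eqP => _; rewrite ?mulr0 // mulVf.
have all_dl : forall n, S n -> P (dl n).
  case: irr => _ /(_ [set n | P (dl n)]); apply; last by exists n0.
  - move=> n Pn an; have [S1 S2] := ca_supp an.
    have e : dl (n + 2) = (iota (ca c n))^-1 *: frho (gelk 0 1 0) (dl n).
      apply: fv_inj; apply: funext => k; rewrite fv_Z frhoE fact_gelt !dlE // !mul0r add0r addr0 mul1r.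
      have -> : (k - 2 == n) = (k == n + 2) by rewrite subr_eq.
      have a0 : iota (ca c n) != 0 by rewrite fmorph_eq0; apply/eqP.
      by case: eqP => [->|_]; rewrite ?mulr0 // addrK mulr1 mulVf.
    by rewrite /mkset e; apply: PZ; exact: Pst.
  - move=> n Pn bn; have [S1 S2] := cb_supp bn.
    have e : dl (n - 2) = (iota (cb c n))^-1 *: frho (gelk 0 0 1) (dl n).
      apply: fv_inj; apply: funext => k; rewrite fv_Z frhoE fact_gelt !dlE // !mul0r !add0r mul1r.
      have -> : (k + 2 == n) = (k == n - 2) by rewrite -subr_eq opprK.
      have b0 : iota (cb c n) != 0 by rewrite fmorph_eq0; apply/eqP.
      by case: eqP => [->|_]; rewrite ?mulr0 // subrK mulr1 mulVf.
    by rewrite /mkset e; apply: PZ; exact: Pst.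
have [s [us hs]] := fv_fin u; rewrite (fib_sum us hs).
elim: s {us hs} => [|n s IH]; first by rewrite big_nil.
rewrite big_cons; have [Sn|nS] := pselect (S n); last by rewrite fv_out // scale0r add0r.
by apply: Pl => //; exact: all_dl.
Qed.

Lemma chart_giqa : giqa iota F.
Proof.
split; last exact: chart_quasi_admissible.
exists fib, fib_j, frho; split.
- exact: fib_generic.
- exact: frho_rep.
- by move=> U xi m; exact: frho_compat.
- exact: frho_irreducible.
Qed.

End GenericallyIrreducible.

(** * The classification *)

(** What remains of [chart_irreducible] when all neighbouring weights are joined by arrows in both
    directions. *)
Definition weight_connected (S : set int) : Prop := forall A : set int,
  (forall n, A n -> S n -> S (n + 2) -> A (n + 2)) ->
  (forall n, A n -> S n -> S (n - 2) -> A (n - 2)) ->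
  (exists2 n, S n & A n) -> forall n, S n -> A n.

Lemma interval_connected (S : set int) :
  (forall m n, S m -> S n -> exists j : int, n = m + 2 * j) ->
  (forall m n j : int, S m -> S n -> m <= m + 2 * j <= n -> S (m + 2 * j)) ->
  weight_connected S.
Proof.
move=> par conv A up down [m Sm Am] n Sn; have [j ej] := par m n Sm Sn.
case: j ej => j ej.
  suff h i : (i <= j)%N -> A (m + 2 * i%:Z) /\ S (m + 2 * i%:Z).
    by rewrite ej; case: (h j (leqnn _)).
  elim: i => [|i IH] ij; first by rewrite mulr0 addr0.
  have [Ai Si] := IH (ltnW ij).
  have Si' : S (m + 2 * i.+1%:Z) by apply: (conv m n) => //; lia.
  split=> //; move: Si'; rewrite (_ : m + 2 * i.+1%:Z = m + 2 * i%:Z + 2); last by lia.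
  exact: up.
suff h i : (i <= j.+1)%N -> A (m - 2 * i%:Z) /\ S (m - 2 * i%:Z).
  have := h j.+1 (leqnn _); rewrite (_ : m - 2 * j.+1%:Z = n); [by case|lia].
elim: i => [|i IH] ij; first by rewrite mulr0 subr0.
have [Ai Si] := IH (ltnW ij).
have Si' : S (m - 2 * i.+1%:Z).
  rewrite (_ : m - _ = n + 2 * (j.+1%:Z - i.+1%:Z)); last by lia.
  by apply: (conv n m) => //; lia.
split=> //; move: Si'; rewrite (_ : m - 2 * i.+1%:Z = m - 2 * i%:Z - 2); last by lia.
exact: down.
Qed.

(** * Existence in each class *)

Section Existence.
Variables (C : numClosedFieldType) (kk : closedFieldType).
Variable iota : {rmorphism ratfun C -> kk}.
Local Notation K := (ratfun C).
Local Notation z := (zfun C).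
Variables (S : set int) (cl : hcclass) (q : K) (c1 c0 cm1 : C).
Hypothesis qE : q = casimir_fun c1 c0 cm1.
Hypothesis S0 : exists n, S n.
Hypothesis conn : weight_connected S.
Hypothesis inner : forall n, S n -> S (n + 2) -> q <> (n * (n + 2))%:~R.
Hypothesis top : forall n, S n -> ~ S (n + 2) -> q = (n * (n + 2))%:~R.
Hypothesis bot : forall n, S n -> ~ S (n - 2) -> q = (n * (n - 2))%:~R.
Hypothesis al : class_allows cl S.

(** The scalar of YX in weight [n] that the Casimir value [q] dictates. *)
Definition pval (n : int) : K := (q - (n * (n + 2))%:~R) / 4.

Lemma four_neq0 : (4 : K) != 0.
Proof. by apply/eqP => /(@intrK_inj C 4 0). Qed.

Lemma pval_form n : exists d1 d0 dm1 : C, pval n = casimir_fun d1 d0 dm1.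
Proof.
have e4 : (4 : K)^-1 = constfun 4^-1 by rewrite fmorphV rmorph_nat.
exists (c1 / 4), ((c0 - (n * (n + 2))%:~R) / 4), (cm1 / 4).
rewrite /pval qE /casimir_fun e4; move: (n * (n + 2)) => k.
by rewrite !rmorphM rmorphB rmorph_int; ring.
Qed.

Lemma pval_reg0 n u : reg (Some u) (z * pval n).
Proof.
have [d1 [d0 [dm1 ->]]] := pval_form n.
have -> : z * casimir_fun d1 d0 dm1 =
    constfun d1 * z * z + constfun d0 * z + constfun dm1 * (z / z).
  by rewrite /casimir_fun; ring.
rewrite divff ?zfun_neq0 // mulr1.
apply: regD; last exact: regC.
by do ?[apply: regD|apply: regM]; (exact: regC || exact: reg_z).
Qed.

Lemma pval_reginf n : reg None (pval n / z).
Proof.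
have [d1 [d0 [dm1 ->]]] := pval_form n.
have -> : casimir_fun d1 d0 dm1 / z =
    constfun d1 * (z / z) + constfun d0 * z^-1 + constfun dm1 * z^-1 * z^-1.
  by rewrite /casimir_fun; ring.
rewrite divff ?zfun_neq0 // mulr1.
apply: regD; last by apply: regM; [apply: regM; [exact: regC|exact: reg_zV]|exact: reg_zV].
by apply: regD; [exact: regC|apply: regM; [exact: regC|exact: reg_zV]].
Qed.

(** Normal form with product [pval]: X is 1 where the degree drops, Y is 1/z where it rises, and the
    other arrow takes the rest. *)
Definition xval (n : int) : K :=
  if pselect (S n /\ S (n + 2)) then (if step_sign cl n == -1 then 1 else z * pval n) else 0.
Definition yval (n : int) : K :=
  if pselect (S n /\ S (n - 2)) then
    (if step_sign cl (n - 2) == -1 then pval (n - 2) else z^-1) else 0.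

Lemma step_signP n : step_sign cl n = 1 \/ step_sign cl n = -1.
Proof. by case: cl => [k|k||] /=; try case: ifP => _; first [by left | by right]. Qed.

Lemma pval_top n : S n -> ~ S (n + 2) -> pval n = 0.
Proof. by move=> h1 h2; rewrite /pval (top h1 h2) subrr mul0r. Qed.
Lemma pval_bot n : S n -> ~ S (n - 2) -> pval (n - 2) = 0.
Proof. by move=> h1 h2; rewrite /pval (bot h1 h2) subrK [n * _]mulrC subrr mul0r. Qed.

(** At a highest weight both sides vanish, by the condition on [q] there. *)
Lemma xy_up n : S n -> xval n * yval (n + 2) = pval n.
Proof.
move=> Sn; rewrite /xval /yval addrK.
case: pselect => [[S1 S2]|nS]; last first.
  by rewrite mul0r pval_top // => S2; apply: nS.
case: pselect => [h|nS]; last by case: nS.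
case: ifP => _; first by rewrite mul1r.
by rewrite mulrAC divff ?mul1r // zfun_neq0.
Qed.

Lemma xy_down n : S n -> xval (n - 2) * yval n = pval (n - 2).
Proof.
move=> Sn; have [S2|nS] := pselect (S (n - 2)).
  by have := xy_up S2; rewrite subrK.
by rewrite pval_bot // /xval; case: pselect => h; [by case: nS; case: h|exact: mul0r].
Qed.

(** (n (n + 2) - (n - 2) n) / 4 = n, so the value of [q] does not affect the relation [X, Y] = H. *)
Lemma pval_step n : pval (n - 2) - pval n = n%:~R.
Proof.
rewrite /pval subrK -mulrBl; apply: (mulIf four_neq0); rewrite divfK ?four_neq0 //.
rewrite !(intrM, intrB, intrD); ring.
Qed.

Definition class_model_data : model_data C.
Proof.
refine (@ModelData C S (class_degree cl) xval yval _ _ _ _ _ _ _).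
- by move=> n; rewrite /xval; case: pselect.
- by move=> n; rewrite /yval; case: pselect.
- move=> n u; rewrite /xval; case: pselect => h /=; last exact: reg0.
  by case: ifP => _; [exact: reg1|exact: pval_reg0].
- move=> n u; rewrite /yval; case: pselect => h /=; last by rewrite mulr0; exact: reg0.
  case: ifP => _; first exact: pval_reg0.
  by rewrite divff ?zfun_neq0 //; exact: reg1.
- move=> n Sn S2; rewrite class_degree_step opprD addrA subrr sub0r.
  rewrite /xval; case: pselect => h /=; last by rewrite mul0r; exact: reg0.
  case: (step_signP n) => -> /=.
    have -> : z * pval n * z ^ (-1 - 1) = pval n / z.
      rewrite expfzDr ?zfun_neq0 // exprN1 mulrACA divff ?zfun_neq0 // mul1r.
      by [].
    exact: pval_reginf.
  by rewrite opprK subrr expr0z mulr1; exact: reg1.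
- move=> n Sn S2; have := class_degree_step cl (n - 2); rewrite subrK => ->.
  rewrite addrAC subrr add0r.
  rewrite /yval; case: pselect => h /=; last by rewrite mul0r; exact: reg0.
  case: (step_signP (n - 2)) => -> /=.
    by rewrite expr1z mulVf ?zfun_neq0 //; exact: reg1.
  by rewrite exprN1; exact: pval_reginf.
- by move=> n Sn; rewrite xy_up // xy_down // pval_step.
Defined.

Lemma class_model : exists F : hcmodule C,
  [/\ giqa iota F, in_class cl F, weights F = S & casimir_acts_by F q].
Proof.
pose c := model_chart class_model_data.
have yxE n : S n -> yx c n = pval n by move=> Sn; exact: xy_up.
have four_pval (n : int) : (n * (n + 2))%:~R + 4 * pval n = q.
  by rewrite /pval [4 * _]mulrC divfK ?four_neq0 // addrC subrK.
have pn0 n : S n -> S (n + 2) -> pval n != 0.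
  move=> Sn S2; apply/eqP => e; apply: (inner Sn S2).
  by rewrite -(four_pval n) e mulr0 addr0.
(* Both arrows between neighbouring weights are nonzero, since their product [pval n] is nonzero by
   [inner]. *)
have irr : chart_irreducible c.
  split=> [|A AX AY]; first exact: S0.
  apply: conn => n An Sn S2.
    apply: AX => // a0; have := pn0 _ Sn S2.
    by rewrite -(xy_up Sn) -[xval n]/(ca c n) a0 mul0r eqxx.
  apply: AY => // b0; have := pn0 _ S2; rewrite subrK => /(_ Sn).
  by rewrite -(xy_down Sn) -[yval n]/(cb c n) b0 mulr0 eqxx.
exists (model class_model_data); split.
- exact: chart_giqa irr.
- apply: (step_in_class irr) => // n _ _; exact: class_degree_step.
- exact: weights_chart c.
- apply: (casimir_chart (c := c)) => n Sn; rewrite /casimir_value yxE // four_pval; split=> //.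
  have -> : yx c (n - 2) = pval (n - 2) by rewrite /yx subrK; exact: xy_down.
  by rewrite four_pval.
Qed.

End Existence.

(** The last clause supplies an end, at which the Casimir value is forced; the others feed the
    existence construction. *)
Lemma extreme_weights_data (S : set int) (q : int) : extreme_weights S q ->
  [/\ exists n, S n,
      weight_connected S,
      forall n, S n -> S (n + 2) -> q <> n * (n + 2),
      (forall n, S n -> ~ S (n + 2) -> q = n * (n + 2)) /\
      (forall n, S n -> ~ S (n - 2) -> q = n * (n - 2)) &
      exists2 n, S n & ~ S (n + 2) \/ ~ S (n - 2)].
Proof.
case=> [l l1|l l1|d].
- split.
  + by exists l, 0%N; lia.
  + apply: interval_connected => [m n [i ->] [j ->]|m n j [i ->] [i' ->] h].
      by exists (j%:Z - i%:Z); lia.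
    by exists (absz (i%:Z + j)); lia.
  (* n (n + 2) - l (l - 2) = 4 (i + 1)(l + i), positive because l >= 1. *)
  + by move=> n [i ->] _; nia.
  + split=> n [i ->] h; first by case: h; exists i.+1; lia.
    case: i h => [|i] h; first by rewrite expr2; nia.
    by case: h; exists i; lia.
  + by exists l; [exists 0%N; lia|right; case=> i; lia].
- split.
  + by exists l, 0%N; lia.
  + apply: interval_connected => [m n [i ->] [j ->]|m n j [i ->] [i' ->] h].
      by exists (i%:Z - j%:Z); lia.
    by exists (absz (i%:Z - j)); lia.
  (* As n + 2 is a weight, i >= 1; then n (n + 2) - l (l + 2) = 4 i (i - l - 1) is positive. *)
  + by move=> n [i ->] [j]; nia.
  + split=> n [i ->] h; last by case: h; exists i.+1; lia.
    case: i h => [|i] h; first by rewrite expr2; nia.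
    by case: h; exists i; lia.
  + by exists l; [exists 0%N; lia|left; case=> i; lia].
split.
- by exists d%:Z, 0%N => //; lia.
- apply: interval_connected => [m n [i _ ->] [j _ ->]|m n j [i h1 ->] [i' h2 ->] h].
    by exists (i%:Z - j%:Z); lia.
  by exists (absz (i%:Z - j)); lia.
(* n (n + 2) - d (d + 2) = 4 i (i - d - 1), negative for 1 <= i <= d. *)
- by move=> n [i h ->] [j h' e]; nia.
- split=> n [i hi ->] h.
    case: i h hi => [|i] h hi; first by nia.
    by case: h; exists i; lia.
  have [e|ne] := eqVneq i d; first by rewrite e; nia.
  by case: h; exists i.+1; lia.
by exists d%:Z; [exists 0%N => //; lia|left; case=> i; lia].
Qed.

Lemma parity_step b n : parity_weights b n <-> parity_weights b (n + 2).
Proof. by rewrite /parity_weights /mkset; split; lia. Qed.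

Lemma parity_down b n : parity_weights b n <-> parity_weights b (n - 2).
Proof. by rewrite (parity_step b (n - 2)) subrK. Qed.

Lemma parity_connected b : weight_connected (parity_weights b).
Proof.
apply: interval_connected => [m n|m n j]; rewrite /parity_weights /mkset.
  by move=> hm hn; exists ((n - m) %/ 2)%Z; lia.
by move=> hm hn _; lia.
Qed.

(** * The three statements of the classification *)

Section Classification.
Variables (C : numClosedFieldType) (kk : closedFieldType).
Variable iota : {rmorphism ratfun C -> kk}.
Local Notation K := (ratfun C).
Implicit Types (F : hcmodule C) (S : set int) (cl : hcclass).

Lemma constfun_int (k : int) : constfun (k%:~R : C) = k%:~R.
Proof. exact: rmorph_int. Qed.

Lemma giqa_weights F : giqa iota F ->
  [\/ weights F = parity_weights false, weights F = parity_weights true,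
      exists2 l : int, 1 <= l & weights F = weights_from l |
      (exists2 l : int, l <= -1 & weights F = weights_upto l) \/
      (exists d : nat, weights F = weights_between d)].
Proof.
move=> /giqa_chart[c irr]; have [q hq] := chart_casimir irr.
by rewrite (weights_chart c); exact: (chart_weights irr hq).
Qed.

Lemma extreme_casimir S (q : int) F : extreme_weights S q ->
  giqa iota F -> weights F = S -> casimir_acts_by F (constfun q%:~R).
Proof.
move=> /extreme_weights_data[_ _ _ [top bot] [n Sn ext]] /giqa_chart[c irr].
rewrite (weights_chart c) => eS; have [q' hq] := chart_casimir irr.
rewrite -eS in Sn ext; suff -> : constfun q%:~R = q' by exact: (casimir_chart hq).
rewrite constfun_int; case: ext => ext.
  by rewrite (casimir_top hq Sn ext) (top n) -?eS.
by rewrite (casimir_bot hq Sn ext) (bot n) -?eS.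
Qed.

Lemma giqa_class_unique S cl q F F' :
  giqa iota F -> giqa iota F' -> weights F = S -> weights F' = S ->
  in_class cl F -> in_class cl F' -> casimir_acts_by F q -> casimir_acts_by F' q ->
  picard_equiv F F'.
Proof.
move=> /giqa_chart[c irr] /giqa_chart[c' irr'].
rewrite (weights_chart c) (weights_chart c') => <- eS icl icl' hq hq'.
exact: (class_unique irr irr' eS hq hq' icl icl').
Qed.

Lemma extreme_unique S (q : int) cl : extreme_weights S q -> class_allows cl S ->
  unique_up_to_picard (fun F => [/\ giqa iota F, in_class cl F & weights F = S]).
Proof.
move=> ext al; split; last first.
  move=> F F' [g icl w] [g' icl' w'].
  exact: (giqa_class_unique g g' w w' icl icl'
    (extreme_casimir ext g w) (extreme_casimir ext g' w')).
have [S0 conn inner [top bot] _] := extreme_weights_data ext.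
have qE : (q%:~R : K) = casimir_fun 0 q%:~R 0.
  by rewrite /casimir_fun rmorph0 !mul0r add0r addr0 constfun_int.
have [|n Sn h|n Sn h|F [g icl w _]] := class_model iota qE S0 conn _ _ _ al.
- by move=> n Sn S2 /(@intrK_inj C); exact: inner.
- by rewrite (top n Sn h).
- by rewrite (bot n Sn h).
by exists F.
Qed.

(** Without ends every weight [m] has the weight m + 2 above it, so m (m + 2) is an excluded
    value. *)
Lemma parity_casimir b F : giqa iota F -> weights F = parity_weights b ->
  (exists c1 c0 cm1 : C, casimir_acts_by F (casimir_fun c1 c0 cm1)) /\
  (forall m : int, parity_weights b m ->
    ~ casimir_acts_by F (constfun (m * (m + 2))%:~R)).
Proof.
move=> /giqa_chart[c irr]; rewrite (weights_chart c) => eS.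
have [q hq] := chart_casimir irr; split; last first.
  move=> m pm; rewrite constfun_int => hm.
  have Sm : cS c m by rewrite eS.
  have Sm2 : cS c (m + 2) by rewrite eS; exact: (parity_step b m).1.
  apply: (casimir_inner irr hq Sm Sm2).
  exact: (casimir_unique irr (casimir_chart hq) hm).
have [n Sn] := irr.1; have [d1 [d0 [dm1 e]]] := yx_form c n.
(* The coefficients of n (n + 2) + 4 yx n. *)
exists (4 * d1), ((n * (n + 2))%:~R + 4 * d0), (4 * dm1).
suff <- : q = casimir_fun (4 * d1) ((n * (n + 2))%:~R + 4 * d0) (4 * dm1).
  exact: (casimir_chart hq).
have [-> _] := hq n Sn; rewrite /casimir_value e /casimir_fun.
have M4 (x : C) : constfun (4 * x) = 4 * constfun x.
  by rewrite -[4 in RHS](rmorph_nat (@constfun C) 4) -rmorphM.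
move: (n * (n + 2)) => k.
have -> : constfun (k%:~R + 4 * d0) = k%:~R + 4 * constfun d0.
  by rewrite -constfun_int -M4 -rmorphD.
by rewrite !M4; ring.
Qed.

Lemma parity_unique b cl (c1 c0 cm1 : C) : class_allows cl (parity_weights b) ->
  (forall m : int, parity_weights b m ->
    casimir_fun c1 c0 cm1 <> constfun (m * (m + 2))%:~R) ->
  unique_up_to_picard (fun F =>
    [/\ giqa iota F, in_class cl F, weights F = parity_weights b &
        casimir_acts_by F (casimir_fun c1 c0 cm1)]).
Proof.
move=> al hm; split; last first.
  move=> F F' [g icl w hq] [g' icl' w' hq'].
  exact: (giqa_class_unique g g' w w' icl icl' hq hq').
apply: (class_model iota (erefl _) _ (@parity_connected b) _ _ _ al).
- by exists b%:Z; rewrite /parity_weights /mkset; case: b {al hm}.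
- by move=> n pn _; rewrite -constfun_int; exact: hm.
- by move=> n pn []; exact: (parity_step b n).1.
- by move=> n pn []; exact: (parity_down b n).1.
Qed.

End Classification.

Theorem mainTheorem1 (R : realType) (kk : closedFieldType)
    (iota : {rmorphism ratfun R[i] -> kk})
    (kk_alg : forall u : kk, algebraicOver iota u) (c : hcclass) :
  [/\ forall F : hcmodule R[i], giqa iota F ->
        [\/ weights F = parity_weights false,
            weights F = parity_weights true,
            exists2 l : int, 1 <= l & weights F = weights_from l |
            (exists2 l : int, l <= -1 & weights F = weights_upto l) \/
            (exists d : nat, weights F = weights_between d)],
      forall (S : set int) (q : int), extreme_weights S q -> class_allows c S ->
        (forall F : hcmodule R[i], giqa iota F -> weights F = S ->
           casimir_acts_by F (constfun q%:~R)) /\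
        unique_up_to_picard (fun F : hcmodule R[i] =>
           [/\ giqa iota F, in_class c F & weights F = S]) &
      forall b : bool, class_allows c (parity_weights b) ->
        (forall F : hcmodule R[i], giqa iota F -> weights F = parity_weights b ->
           (exists c1 c0 cm1 : R[i], casimir_acts_by F (casimir_fun c1 c0 cm1)) /\
           (forall m : int, parity_weights b m ->
              ~ casimir_acts_by F (constfun (m * (m + 2))%:~R))) /\
        (forall c1 c0 cm1 : R[i],
           (forall m : int, parity_weights b m ->
              casimir_fun c1 c0 cm1 <> constfun (m * (m + 2))%:~R) ->
           unique_up_to_picard (fun F : hcmodule R[i] =>
             [/\ giqa iota F, in_class c F, weights F = parity_weights b &
                 casimir_acts_by F (casimir_fun c1 c0 cm1)]))].
Proof.
split=> [F|S q ext al|b al].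
- exact: giqa_weights.
- by split=> [F|]; [exact: (extreme_casimir ext)|exact: (extreme_unique iota ext al)].
- by split=> [F|c1 c0 cm1]; [exact: parity_casimir|exact: parity_unique].
Qed.
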